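(* Let $X\subseteq\mathbb{A}^n_{\overline{\mathbb{Q}}}$ be an affine variety over $\overline{\mathbb{Q}}$, let $K$ be a number field, let $S$ be a finite set of places of $K$, and let $\mathcal{X}\subseteq\mathbb{A}^n_{\mathcal{O}_{K,S}}$ be a model for $X$ over $\mathcal{O}_{K,S}$. Let $A\supseteq\mathcal{O}_{K,S}$ be a $\mathbb{Z}$-finitely generated integral domain with quotient field $L$, and let $R\subseteq\mathcal{X}(A)$ be a subset. Assume that (1) $X$ is arithmetically hyperbolic over $\overline{\mathbb{Q}}$, and (2) for each finite set of function fields $\{F_1,\dots,F_t\}$ with $F_i\supseteq L$, there is a subset $R'\subseteq R$ with the same Zariski closure $\overline{R'}=\overline{R}$ such that, for every $i\in\{1,\dots,t\}$, $h^{\mathrm{aff}}_{F_i}$ is bounded on $R'\subseteq X_{F_i}(F_i)$. Then $R$ is finite.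
   Context: A variety over a field is an integral separated scheme of finite type over it. $\mathcal{O}_{K,S}$ denotes the ring of $S$-integers of $K$. A model for a variety $X$ over a ring $A_0$ contained in an algebraically closed field $k$ of characteristic zero is a finite type separated $A_0$-scheme $\mathcal{X}$ with $\mathcal{X}_k\cong X$ over $k$; here $\mathcal{X}$ is a closed subscheme of $\mathbb{A}^n_{\mathcal{O}_{K,S}}$ compatible with $X\subseteq\mathbb{A}^n_{\overline{\mathbb{Q}}}$. A variety $X$ over $k$ is arithmetically hyperbolic over $k$ if there are a $\mathbb{Z}$-finitely generated subring $A\subset k$ and a model $\mathcal{X}$ for $X$ over $A$ such that, for all $\mathbb{Z}$-finitely generated subrings $A'\subset k$ containing $A$, the set $\mathcal{X}(A')$ is finite. A function field $F$ means an algebraic function field over some algebraically closed field $k$ of characteristic zero, i.e. the function field of a smooth projective curve $C$ over $k$ (equivalently, a finite extension of $k(t)$); $F\supseteq L$ means that an embedding of $L$ in $F$ is given. Its set of places is $M_F=C(k)$, with valuations $v_p=\mathrm{ord}_p$. For $(x_1,\dots,x_n)\in F^n$, $h_F^{\mathrm{aff}}(x_1,\dots,x_n)=\sum_{p\in M_F}\max\{0,-v_p(x_1),\dots,-v_p(x_n)\}$. Through $A\subseteq L\subseteq F$, one has $\mathcal{X}(A)\subseteq \mathcal{X}(F)=X_F(F)\subseteq F^n$. Zariski closures of subsets of $\mathcal{X}(A)$ are taken in $\mathcal{X}_L$. *)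

(* Defs.v *)
From HB Require Import structures.
From mathcomp Require Import all_boot all_order all_algebra all_field.
From mathcomp Require Import fraction mpoly.
From mathcomp Require Import boolp classical_sets functions cardinality.
From mathcomp Require Import reals constructive_ereal.
(* Not imported: the notations of esum and mpoly clash. *)
From mathcomp Require esum.

Set Implicit Arguments.
Unset Strict Implicit.
Unset Printing Implicit Defensive.

Import Order.TTheory GRing.Theory Num.Theory.

Local Open Scope classical_set_scope.
Local Open Scope ring_scope.

Section Ideals.
Variable B : comPzRingType.

Definition ideal (I : set B) : Prop :=
  [/\ I 0, forall x y, I x -> I y -> I (x + y) & forall b x, I x -> I (b * x)].

Definition prime_ideal (I : set B) : Prop :=
  [/\ ideal I, ~ I 1 & forall x y, I (x * y) -> I x \/ I y].

Definition ideal_span (G : set B) : set B :=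
  [set y | exists (m : nat) (c g : 'I_m -> B),
     (forall i, G (g i)) /\ y = \sum_(i < m) c i * g i].

End Ideals.

(* Algebras over A, including the zero ring. *)
Record algebra (A : comNzRingType) := Algebra {
  alg_ring :> comPzRingType;
  alg_map : {rmorphism A -> alg_ring}
}.

Record alg_hom (A : comNzRingType) (B C : algebra A) := AlgHom {
  alg_hom_fun :> {rmorphism B -> C};
  alg_homP : forall a, alg_hom_fun (alg_map B a) = alg_map C a
}.

Section RestrictionOfScalars.
Variables (A A' : comNzRingType) (f : {rmorphism A -> A'}).

Definition restrict (B : algebra A') : algebra A :=
  Algebra (alg_map B \o f : {rmorphism A -> B}).

Definition restrict_hom (B C : algebra A') (g : alg_hom B C) :
    alg_hom (restrict B) (restrict C) :=
  @AlgHom A (restrict B) (restrict C) g (fun a => alg_homP g (f a)).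

End RestrictionOfScalars.

(* This is mmap (alg_map B) x p, which the library only provides when the
   target B is a nonzero ring. *)
Definition poly_eval (A : comNzRingType) (B : algebra A) (n : nat)
    (x : 'I_n -> B) (p : {mpoly A[n]}) : B :=
  \sum_(m <- msupp p) alg_map B p@_m * \prod_(i < n) x i ^+ m i.

Definition finite_type (A : comNzRingType) (B : algebra A) : Prop :=
  exists (n : nat) (x : 'I_n -> B),
    forall b, exists p : {mpoly A[n]}, b = poly_eval x p.

Definition Z_finitely_generated (A : comNzRingType) : Prop :=
  finite_type (Algebra (intmul 1 : {rmorphism int -> A})).

(* The B-points of the closed subscheme of affine n-space over A cut out by J,
   for an A-algebra B. *)
Definition zeros (A : comNzRingType) (n : nat) (J : set {mpoly A[n]})
    (B : algebra A) : set ('I_n -> B) :=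
  [set x | forall p, J p -> poly_eval x p = 0].
Arguments zeros {A n} J B.

(* The ideal of the base change of that subscheme along f. *)
Definition base_change (A A' : comNzRingType) (f : {rmorphism A -> A'})
    (n : nat) (J : set {mpoly A[n]}) : set {mpoly A'[n]} :=
  ideal_span [set map_mpoly f p | p in J].

(* Schemes over A, as functors of points on A-algebras (Demazure-Gabriel):
   Zariski sheaves with an open cover by representable functors. *)
Record functor_of_points (A : comNzRingType) := FunctorOfPoints {
  fop_obj :> algebra A -> Type;
  fop_map : forall B C : algebra A, alg_hom B C -> fop_obj B -> fop_obj C;
  fop_map_id : forall (B : algebra A) (f : alg_hom B B),
    f =1 id -> fop_map f =1 id;
  fop_map_comp : forall (B C D : algebra A)
      (g : alg_hom C D) (f : alg_hom B C) (h : alg_hom B D),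
    h =1 g \o f -> fop_map h =1 fop_map g \o fop_map f
}.

Definition is_localization (A : comNzRingType) (B C : algebra A) (b : B)
    (l : alg_hom B C) : Prop :=
  [/\ exists u, l b * u = 1,
      forall c, exists (b' : B) (m : nat), c * l b ^+ m = l b' &
      forall b', l b' = 0 -> exists m : nat, b ^+ m * b' = 0].

Section Schemes.
Variables (A : comNzRingType) (X : functor_of_points A).

(* Sections s i over a standard cover of Spec B by the D(b i) that agree on
   overlaps; agreement is tested on every algebra receiving both
   localizations, of which the localization at b i * b j is initial. *)
Definition Zariski_sheaf : Prop :=
  forall (B : algebra A) (m : nat) (b : 'I_m -> B) (C : 'I_m -> algebra A)
    (l : forall i, alg_hom B (C i)) (s : forall i, X (C i)),
  ideal_span (range b) 1 ->
  (forall i, is_localization (b i) (l i)) ->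
  (forall i j (D : algebra A) (g : alg_hom (C i) D) (h : alg_hom (C j) D),
     g \o l i =1 h \o l j -> fop_map g (s i) = fop_map h (s j)) ->
  exists! x : X B, forall i, fop_map (l i) x = s i.

Definition subfunctor (U : forall B : algebra A, set (X B)) : Prop :=
  forall (B C : algebra A) (f : alg_hom B C) x, U B x -> U C (fop_map f x).

Definition open_subfunctor (U : forall B : algebra A, set (X B)) : Prop :=
  subfunctor U /\
  forall (B : algebra A) (x : X B), exists2 I : set B, ideal I &
    forall (C : algebra A) (f : alg_hom B C),
      U C (fop_map f x) <-> ideal_span (f @` I) 1.

(* U is isomorphic to Spec B0 with B0 an A-algebra of finite type; u is the
   universal point. *)
Definition affine_of_finite_type (U : forall B : algebra A, set (X B)) : Prop :=
  exists2 B0 : algebra A, finite_type B0 &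
    exists2 u : X B0, U B0 u &
      forall (C : algebra A) (x : X C), U C x ->
        exists2 f : alg_hom B0 C, fop_map f u = x &
          forall g : alg_hom B0 C, fop_map g u = x -> g =1 f.

(* Open subfunctors cover a scheme when they do so on field-valued points. *)
Definition finite_affine_open_cover : Prop :=
  exists (m : nat) (U : 'I_m -> forall B : algebra A, set (X B)),
    (forall i, open_subfunctor (U i) /\ affine_of_finite_type (U i)) /\
    forall (k : fieldType) (f : {rmorphism A -> k}) (x : X (Algebra f)),
      exists i, U i (Algebra f) x.

(* The diagonal is a closed immersion. *)
Definition separated : Prop :=
  forall (B : algebra A) (x y : X B), exists2 I : set B, ideal I &
    forall (C : algebra A) (f : alg_hom B C),
      fop_map f x = fop_map f y <-> (forall b, I b -> f b = 0).

Definition separated_finite_type_scheme : Prop :=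
  [/\ Zariski_sheaf, finite_affine_open_cover & separated].

(* An isomorphism from X_k to the closed subscheme of affine n-space over k
   cut out by I. *)
Definition base_change_iso (k : fieldType) (iota : {rmorphism A -> k}) (n : nat)
    (I : set {mpoly k[n]}) : Prop :=
  exists phi : forall B : algebra k, X (restrict iota B) -> 'I_n -> B,
    (forall B : algebra k, set_bij setT (zeros I B) (phi B)) /\
    forall (B C : algebra k) (f : alg_hom B C) x,
      phi C (fop_map (restrict_hom iota f) x) = f \o phi B x.

End Schemes.

(* Subrings of k are given as rings with an injective morphism to k. *)
Definition arithmetically_hyperbolic (k : fieldType) (n : nat)
    (I : set {mpoly k[n]}) : Prop :=
  exists (A : comNzRingType) (iota : {rmorphism A -> k})
      (X : functor_of_points A),
    [/\ injective iota, Z_finitely_generated A,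
        separated_finite_type_scheme X, base_change_iso X iota I &
        forall (A' : comNzRingType) (iota' : {rmorphism A' -> k})
            (j : {rmorphism A -> A'}),
          injective iota' -> Z_finitely_generated A' -> iota' \o j =1 iota ->
          finite_set [set: X (Algebra j)]].

Section SIntegers.
Variables (R : realType) (K : fieldType).

(* A place of K is an equivalence class of such absolute values. *)
Definition nontrivial_absolute_value (v : K -> R) : Prop :=
  [/\ forall x, 0 <= v x, forall x, v x = 0 <-> x = 0,
      forall x y, v (x * y) = v x * v y,
      forall x y, v (x + y) <= v x + v y &
      exists2 x, x != 0 & v x != 1].

Definition nonarchimedean (v : K -> R) : Prop :=
  forall x y, v (x + y) <= Num.max (v x) (v y).

Definition same_place (v w : K -> R) : Prop := forall x, v x < 1 <-> w x < 1.

Definition S_integer (S : set (K -> R)) : {pred K} := fun x =>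
  `[< forall v, nontrivial_absolute_value v -> nonarchimedean v ->
        (forall w, S w -> ~ same_place w v) -> v x <= 1 >].

Lemma S_integer_subring_closed (S : set (K -> R)) :
  subring_closed (S_integer S).
Proof.
have v1 v : nontrivial_absolute_value v -> v 1 = 1.
  case=> _ v0 vM _ _; have /eqP : v 1 * v 1 = 1 * v 1 by rewrite -vM !mul1r.
  rewrite -subr_eq0 -mulrBl mulf_eq0 => /orP[|/eqP/v0/eqP].
    by rewrite subr_eq0 => /eqP.
  by rewrite oner_eq0.
have vN v x : nontrivial_absolute_value v -> v (- x) = v x.
  move=> va; case: (va) => vp _ vM _ _; rewrite -mulN1r vM.
  have /eqP : v (-1) ^+ 2 = 1 by rewrite expr2 -vM mulrNN mulr1 v1.
  by rewrite sqrp_eq1// => /eqP ->; rewrite mul1r.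
split=> [|x y /asboolP xS /asboolP yS|x y /asboolP xS /asboolP yS];
  apply/asboolP => v va vu vS.
- by rewrite v1.
- by rewrite (le_trans (vu _ _))// ge_max xS//= vN// yS.
- case: (va) => vp _ vM _ _; rewrite vM.
  by apply: mulr_ile1; [exact: vp|exact: vp|exact: xS|exact: yS].
Qed.

HB.instance Definition _ (S : set (K -> R)) :=
  GRing.isSubringClosed.Build K (S_integer S) (S_integer_subring_closed S).

(* The ring O_{K,S}; the elements of S are absolute values representing places. *)
Record S_integers (S : set (K -> R)) := SIntegers {
  S_integers_val :> K;
  _ : S_integers_val \in S_integer S
}.

HB.instance Definition _ (S : set (K -> R)) :=
  [isSub for @S_integers_val S].
HB.instance Definition _ (S : set (K -> R)) :=
  [Choice of S_integers S by <:].
HB.instance Definition _ (S : set (K -> R)) :=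
  [SubChoice_isSubComNzRing of S_integers S by <:].

End SIntegers.

(* The point of Spec L[x_1, ..., x_n] defined by an L-rational point. *)
Definition point_ideal (L : fieldType) (n : nat) (x : 'I_n -> L) :
    set {mpoly L[n]} :=
  [set p | p.@[x] = 0].

Section Zariski.
Variables (L : fieldType) (n : nat) (J : set {mpoly L[n]}).

(* Spec (L[x_1, ..., x_n] / J) *)
Definition spectrum : set (set {mpoly L[n]}) :=
  [set P | prime_ideal P /\ J `<=` P].

Definition Zariski_closed (Z : set (set {mpoly L[n]})) : Prop :=
  exists E : set {mpoly L[n]}, Z = [set P | spectrum P /\ E `<=` P].

Definition Zariski_closure (T : set (set {mpoly L[n]})) :
    set (set {mpoly L[n]}) :=
  \bigcap_(Z in [set Z | Zariski_closed Z /\ T `<=` Z]) Z.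

End Zariski.

(* A function field over an algebraically closed field k of characteristic
   zero, i.e. a finite extension of k(t), with an embedding of L. *)
Record function_field (L : fieldType) := FunctionField {
  ff_const : closedFieldType;
  ff_pchar0 : [pchar ff_const] =i pred0;
  ff_field :> fieldExtType {fraction {poly ff_const}};
  ff_embed : {rmorphism L -> ff_field}
}.

(* The valuations ord_p, for p a point of the smooth projective curve over k
   with function field F, are the normalized discrete valuations of F that are
   trivial on k.  The value v 0 = 0 is a convention replacing +oo; it makes v
   unique and does not change max {0, - v x_1, ..., - v x_n}. *)
Definition place (k : closedFieldType) (F : fieldExtType {fraction {poly k}})
    (v : F -> int) : Prop :=
  [/\ v 0 = 0,
      forall x y, x != 0 -> y != 0 -> v (x * y) = v x + v y,
      forall x y, x != 0 -> y != 0 -> x + y != 0 ->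
        Num.min (v x) (v y) <= v (x + y),
      forall c : k, c != 0 -> v (tofrac c%:P)%:A = 0 &
      exists2 x, x != 0 & v x = 1].

Definition affine_height (R : realType) (k : closedFieldType)
    (F : fieldExtType {fraction {poly k}}) (n : nat) (x : 'I_n -> F) : \bar R :=
  esum.esum [set v : F -> int | place v]
    (fun v => ((\big[Num.max/0]_(i < n) - v (x i))%:~R)%:E).

(* Main.v *)
(* By transcendence and Galois theory, A embeds into a Galois extension N of
   E = Qbar(t_1, ..., t_d), compatibly with O_{K,S} in Qbar.  Fix i, make the
   t_j with j <> i constant, and let sigma be an automorphism of N: composing
   with sigma, A embeds into a finite extension of W(t_i), W being an algebraic
   closure of Frac A.  On the set R' given by these finitely many function
   fields, the conjugates of a coordinate f of x - y have boundedly many poles,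
   so the norm of f, an element of E, has bounded degree in each t_i.  Hence
   finitely many points of Qbar^d suffice for every such norm, if nonzero, to
   have a nonzero value at one of them; this gives finitely many
   specializations A -> Qbar that together separate the points of R'.  They map
   R' to points of X over one finitely generated subring of Qbar, and those are
   finitely many since X is arithmetically hyperbolic.  Thus R' is finite, its
   points are closed, and R is contained in the closure of R', so R = R'.

   For the hyperbolicity argument, the model of X is only a scheme that becomes
   isomorphic to X over Qbar.  The generic point of X descends to a section of
   that scheme over a finitely generated subring of the coordinate ring of X,
   by gluing on a cover by affine pieces; specializing this section at the
   points of X turns them into points of the model. *)

Require Import Defs.
From HB Require Import structures.
From mathcomp Require Import all_boot all_order all_algebra all_field.
From mathcomp Require Import fraction mpoly.
From mathcomp Require Import boolp classical_sets functions cardinality.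
From mathcomp Require Import reals constructive_ereal.
From mathcomp Require esum fsbigop.
From mathcomp Require Import ring ring_quotient.

Set Implicit Arguments.
Unset Strict Implicit.
Unset Printing Implicit Defensive.

Import Order.TTheory GRing.Theory Num.Theory.

Local Open Scope classical_set_scope.
Local Open Scope ring_scope.

(** * Partial ring homomorphisms and places *)

(** Norms enter because a specialization of [A] is read off from a place of [N] above a
    specialization of [E]: if it kills [f] while all conjugates of [f] stay finite, it kills the
    norm of [f]. So it is enough to keep the norm away from 0. The obstacle is that this norm is a
    quotient [P / Q] whose degree is bounded in one variable at a time, and only after cancellation
    over a field where the other variables have become constants. [P] and [Q] themselves may have
    large degrees and may vanish together at a point of the grid. Degree bounds are therefore kept
    as relations [P * w = Q * u] with [u] and [w] small, and the variables are specialized one after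
    the other, a common power of ['X - c] being divided out at each stage. Heights are tested on
    finite sets of places only: one place above each root of a denominator and one above infinity
    bound the degrees of a rational function. Places, localizations and specializations are all
    graphs of partial homomorphisms. Chevalley's extension theorem for them yields the valuations of
    function fields, the embedding of [algC] and the specializations of [A]. *)

Lemma rmorph_of (R S : pzRingType) (f : R -> S) :
  zmod_morphism f -> monoid_morphism f -> {g : {rmorphism R -> S} | g =1 f}.
Proof.
move=> fB fM; pose fZ := GRing.isZmodMorphism.Build R S f fB.
pose fR := GRing.isMonoidMorphism.Build R S f fM.
by exists (HB.pack f fZ fR : {rmorphism R -> S}).
Qed.

Section PartialHom.
Variables L W : comPzRingType.

(* The graphs of the ring homomorphisms to W defined on a subring of L. *)
Definition partial_hom (G : set (L * W)) : Prop :=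
  [/\ G (1, 1),
      forall x a y b, G (x, a) -> G (y, b) -> G (x - y, a - b),
      forall x a y b, G (x, a) -> G (y, b) -> G (x * y, a * b) &
      forall a, G (0, a) -> a = 0].

Variables (G : set (L * W)) (hG : partial_hom G).

Lemma partial_hom1 : G (1, 1). Proof. by case: hG. Qed.

Lemma partial_homB x a y b : G (x, a) -> G (y, b) -> G (x - y, a - b).
Proof. by case: hG => _ + _ _; apply. Qed.

Lemma partial_homM x a y b : G (x, a) -> G (y, b) -> G (x * y, a * b).
Proof. by case: hG => _ _ + _; apply. Qed.

Lemma partial_hom_eq0 a : G (0, a) -> a = 0.
Proof. by case: hG => _ _ _; apply. Qed.

Lemma partial_hom0 : G (0, 0).
Proof.
by have := partial_homB partial_hom1 partial_hom1; rewrite !subrr.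
Qed.

Lemma partial_homN x a : G (x, a) -> G (- x, - a).
Proof. by move=> /(partial_homB partial_hom0); rewrite !sub0r. Qed.

Lemma partial_homD x a y b : G (x, a) -> G (y, b) -> G (x + y, a + b).
Proof. by move=> xa /partial_homN /(partial_homB xa); rewrite !opprK. Qed.

Lemma partial_hom_inj x a b : G (x, a) -> G (x, b) -> a = b.
Proof.
move=> xa /(partial_homB xa); rewrite subrr => /partial_hom_eq0.
by move/eqP; rewrite subr_eq0 => /eqP.
Qed.

Lemma partial_homX n x a : G (x, a) -> G (x ^+ n, a ^+ n).
Proof.
move=> xa; elim: n => [|n IH]; first exact: partial_hom1.
by rewrite !exprS; apply: partial_homM.
Qed.

Lemma partial_hom_sum I (r : seq I) (P : pred I) (f : I -> L) (g : I -> W) :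
  (forall i, P i -> G (f i, g i)) ->
  G (\sum_(i <- r | P i) f i, \sum_(i <- r | P i) g i).
Proof.
move=> fg; apply: (big_ind2 (fun x a => G (x, a))) => //.
  exact: partial_hom0.
by move=> x a y b; apply: partial_homD.
Qed.

Lemma partial_hom_domM x y :
  (exists a, G (x, a)) -> (exists a, G (y, a)) -> exists a, G (x * y, a).
Proof. by move=> [a xa] [b yb]; exists (a * b); apply: partial_homM. Qed.

Lemma partial_hom_domX n x :
  (exists a, G (x, a)) -> exists a, G (x ^+ n, a).
Proof. by move=> [a xa]; exists (a ^+ n); apply: partial_homX. Qed.

Lemma partial_hom_dom_sum I (r : seq I) (P : pred I) (f : I -> L) :
  (forall i, P i -> exists a, G (f i, a)) ->
  exists a, G (\sum_(i <- r | P i) f i, a).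
Proof.
move=> fP; apply: (big_ind (fun x => exists a, G (x, a))) => //; first by exists 0; apply: partial_hom0.
by move=> x y [a xa] [b yb]; exists (a + b); apply: partial_homD.
Qed.

Lemma partial_homM0 x y : G (x, 0) -> (exists a, G (y, a)) -> G (x * y, 0).
Proof. by move=> x0 [a ya]; rewrite -(mul0r a); apply: partial_homM. Qed.

End PartialHom.

(** * Chevalley's extension theorem for places *)

Section PlaceExtension.
Variables (L : fieldType) (W : closedFieldType).

(** For a partial homomorphism this makes [G] a place: its domain is a valuation ring of [L], whose
    maximal ideal consists of the elements sent to 0. *)
Definition valuative (G : set (L * W)) : Prop :=
  forall x, x != 0 -> (exists a, G (x, a)) \/ G (x^-1, 0).

Section Maximal.
Variables (G : set (L * W)) (hG : partial_hom G).
Hypothesis Gmax : forall G', partial_hom G' -> G `<=` G' -> G' `<=` G.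

(** Otherwise [G] would extend to the fractions [x / b ^+ n]. Hence the domain of a maximal [G] is a
    local ring, and its image in [W] is a field. *)
Let max_inv b beta : G (b, beta) -> beta != 0 -> G (b^-1, beta^-1).
Proof.
move=> Gb beta0; have b0 : b != 0.
  by apply: contra_neq beta0 => b0; apply: (partial_hom_eq0 hG); rewrite -b0.
pose G' := [set z | exists n x a, [/\ G (x, a), z.1 = x / b ^+ n
                                    & z.2 = a / beta ^+ n]].
have hG' : partial_hom G'.
  split.
  - by exists 0, 1, 1; split; rewrite ?divr1 //; apply: partial_hom1.
  - move=> _ _ _ _ [n [x [a [xa /= -> ->]]]] [m [y [c [yc /= -> ->]]]].
    exists (n + m)%N, (x * b ^+ m - y * b ^+ n),
      (a * beta ^+ m - c * beta ^+ n); split=> /=.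
    + by apply: partial_homB => //; apply: partial_homM => //;
        apply: partial_homX.
    + rewrite mulrBl !exprD !invfM; congr (_ - _).
        by rewrite -mulrA (mulrCA (b ^+ m)) mulfV ?expf_neq0 // mulr1.
      by rewrite -mulrA (mulrA (b ^+ n)) mulfV ?expf_neq0 // mul1r.
    + rewrite mulrBl !exprD !invfM; congr (_ - _).
        by rewrite -mulrA (mulrCA (beta ^+ m)) mulfV ?expf_neq0 // mulr1.
      by rewrite -mulrA (mulrA (beta ^+ n)) mulfV ?expf_neq0 // mul1r.
  - move=> _ _ _ _ [n [x [a [xa /= -> ->]]]] [m [y [c [yc /= -> ->]]]].
    exists (n + m)%N, (x * y), (a * c); split=> /=.
    + exact: partial_homM.
    + by rewrite mulf_div exprD.
    + by rewrite mulf_div exprD.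
  - move=> _ [n [x [a [xa /= /esym/eqP + ->]]]].
    rewrite mulf_eq0 invr_eq0 expf_eq0 (negPf b0) andbF orbF => /eqP x0.
    by rewrite (partial_hom_eq0 hG (a := a)) ?mul0r -?x0.
apply: (Gmax hG') => [[x a] xa|].
  by exists 0, x, a; rewrite !divr1.
exists 1, 1, 1; split=> //=; rewrite ?div1r ?expr1 //.
exact: partial_hom1.
Qed.

Let PG (p : {poly L}) (q : {poly W}) := forall i, G (p`_i, q`_i).

Let PGM p q p' q' : PG p q -> PG p' q' -> PG (p * p') (q * q').
Proof.
move=> pq pq' i; rewrite !coefM; apply: partial_hom_sum => // j _.
exact: partial_homM.
Qed.

Let PGB p q p' q' : PG p q -> PG p' q' -> PG (p - p') (q - q').
Proof. by move=> pq pq' i; rewrite !coefB; apply: partial_homB. Qed.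

Let PGC c d : G (c, d) -> PG c%:P d%:P.
Proof.
by move=> cd i; rewrite !coefC; case: eqP => // _; apply: partial_hom0.
Qed.

Let PG1 : PG 1 1.
Proof. by rewrite -!polyC1; apply: PGC; apply: partial_hom1. Qed.

Let PGX : PG 'X 'X.
Proof.
move=> i; rewrite !coefX; case: eqP => _ /=; first exact: partial_hom1.
exact: partial_hom0.
Qed.

Let PGXn n : PG 'X^n 'X^n.
Proof.
elim: n => [|n IH]; first exact: PG1.
by rewrite !exprS; apply: PGM.
Qed.

(** With m the maximal ideal of the domain, the conclusion is that 1 lies in m[x]. The reductions of
    the polynomials over the domain that vanish at [x] form an ideal [J] over the image field. It
    has no common root in [W], since [x] could be sent to such a root, so it contains 1. *)
Let max_small x : ~ (exists a, G (x, a)) ->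
  exists2 p : {poly L}, (forall i, G (p`_i, 0)) & p.[x] = 1.
Proof.
move=> xD; pose J q := exists2 p, PG p q & p.[x] = 0.
(* Sending [p.[x]] to [q.[alpha]] is well defined exactly when all of [J] vanishes at [alpha]; it
   would then extend [G] to [x]. *)
have Jroot alpha : exists2 q, J q & q.[alpha] != 0.
  apply: contrapT => noq; apply: xD; exists alpha.
  pose G' := [set z | exists p q, [/\ PG p q, z.1 = p.[x] & z.2 = q.[alpha]]].
  have hG' : partial_hom G'.
    split.
    - by exists 1, 1; rewrite !hornerC; split=> //; apply: PG1.
    - move=> _ _ _ _ [p [q [pq /= -> ->]]] [p' [q' [pq' /= -> ->]]].
      exists (p - p'), (q - q'); rewrite !hornerE; split=> //; exact: PGB.
    - move=> _ _ _ _ [p [q [pq /= -> ->]]] [p' [q' [pq' /= -> ->]]].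
      exists (p * p'), (q * q'); rewrite !hornerE; split=> //; exact: PGM.
    - move=> _ [p [q [pq /= px ->]]]; apply/eqP/negPn/negP => q0; apply: noq.
      by exists q => //; exists p.
  apply: (Gmax hG') => [[y a] ya|].
    by exists y%:P, a%:P; rewrite !hornerC; split=> //; apply: PGC.
  by exists 'X, 'X; rewrite !hornerX.
have JM c q : J q -> (exists p, PG p c) -> J (c * q).
  move=> [p pq px] [p' pc]; exists (p' * p); first exact: PGM.
  by rewrite hornerM px mulr0.
have JB q q' : J q -> J q' -> J (q - q').
  move=> [p pq px] [p' pq' px']; exists (p - p'); first exact: PGB.
  by rewrite hornerD hornerN px px' subrr.
have lead_inv q : J q -> q != 0 -> exists p, PG p (lead_coef q)^-1%:P.
  move=> [p pq px] q0; exists (p`_(size q).-1)^-1%:P; apply: PGC.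
  by apply: max_inv; [exact: pq | rewrite lead_coef_eq0].
(* By [max_inv] the inverse of a leading coefficient is again a reduction, so a nonzero member of
   least size can be made monic without leaving [J]. *)
have [q0 [Jq0 q0_monic] q0min] : exists2 q0, J q0 /\ q0 \is monic &
    forall q, J q -> q != 0 -> (size q0 <= size q)%N.
  have exJ : exists n, `[< exists q, [/\ J q, q != 0 & size q = n] >].
    have [q Jq q0] := Jroot 0; exists (size q); apply/asboolP; exists q.
    by split=> //; apply: contra_neq q0 => ->; rewrite horner0.
  case: (ex_minnP exJ) => n /asboolP[q [Jq q0 sq]] nmin.
  exists ((lead_coef q)^-1%:P * q).
    split; first by apply: JM => //; apply: lead_inv.
    by rewrite mul_polyC monicE lead_coefZ mulVf // lead_coef_eq0.
  move=> q' Jq' q'0; rewrite mul_polyC size_scale ?invr_eq0 ?lead_coef_eq0 //.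
  by rewrite sq; apply: nmin; apply/asboolP; exists q'.
(* The division is carried out by hand because each multiplier has to be the reduction of a
   polynomial over the domain of [G]. *)
have q0dvd q : J q -> q0 %| q.
  have [n] := ubnP (size q); elim: n q => // n IH q /ltnSE sq Jq.
  have [->|qn0] := eqVneq q 0; first by rewrite dvdp0.
  pose r := q - (lead_coef q)%:P * 'X^(size q - size q0) * q0.
  have Jr : J r.
    apply: JB => //; apply: JM => //; case: Jq => p pq _.
    exists ((p`_(size q).-1)%:P * 'X^(size q - size q0)).
    by apply: PGM => //; apply: PGC; apply: pq.
  have sqq0 := q0min _ Jq qn0.
  have q0n0 := monic_neq0 q0_monic.
  have : q0 %| r.
    apply: IH => //; apply: leq_trans sq; rewrite (polySpred qn0) ltnS.
    have sq0 : (0 < size q0)%N by rewrite size_poly_gt0.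
    apply/leq_sizeP => j jq; rewrite coefB -mulrA coefCM mulrC.
    rewrite coefXnM ltnNge (leq_trans _ jq) /=; last first.
      by rewrite -subn1 leq_sub2l.
    have [ej|] := eqVneq j (size q).-1.
      rewrite ej (_ : ((size q).-1 - (size q - size q0))%N = (size q0).-1).
        have -> : q0`_(size q0).-1 = 1 by apply/eqP; rewrite -monicE.
        by rewrite mul1r -lead_coefE subrr.
      by rewrite -subn1 subnAC subKn // subn1.
    move=> jn; have {jn}jq : (size q <= j)%N.
      by rewrite (polySpred qn0) ltn_neqAle eq_sym jn.
    rewrite !nth_default ?mul0r ?subrr //.
    by rewrite leq_subRL ?leq_subr ?subnK // (leq_trans _ jq) ?leq_subr.
  by rewrite /r dvdp_subl ?dvdp_mull.
(* A root of the generator [q0] in the closed field [W] would be a common root of [J]. *)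
have [p pq px] : J 1.
  suff <- : q0 = 1 by [].
  apply/eqP; rewrite -eqp_monic ?monic1 // -size_poly_eq1.
  apply/negPn/negP => /closed_rootP.
  move=> [alpha q0a]; have [q1 /q0dvd /dvdpP[r ->]] := Jroot alpha.
  by rewrite hornerM (rootP q0a) mulr0 eqxx.
have Gp0 : G (p`_0, 1) by have := pq 0; rewrite coef1.
have p0 : p`_0 != 0.
  apply: contra_neq (oner_neq0 W) => e0.
  by rewrite e0 in Gp0; apply: (partial_hom_eq0 hG Gp0).
have Gp0V := max_inv Gp0 (oner_neq0 _).
(* Since [p] reduces to 1, its constant coefficient is sent to 1 and the others to 0; after division
   by the constant coefficient, the relation [p.[x] = 0] expresses 1. *)
exists (1 - (p`_0)^-1%:P * p); last first.
  by rewrite !hornerE px mulr0 subr0.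
move=> i; rewrite coefB coefCM coef1; case: (eqVneq i 0) => [->|i0].
  by rewrite mulVf // subrr; apply: partial_hom0.
rewrite sub0r -[X in G (_, X)]oppr0; apply: partial_homN => //.
rewrite -[X in G (_, X)](mulr0 1^-1); apply: partial_homM => //.
by have := pq i; rewrite coef1 (negPf i0).
Qed.

(** Chevalley's descent on the degrees of two expressions of 1, one in m[x] and one in m[x^-1]: the
    shorter one serves to lower the degree of the longer one. *)
Let small_excl n m x : x != 0 ->
  (exists p : {poly L}, [/\ forall i, G (p`_i, 0), p.[x] = 1 & (size p <= n)%N]) ->
  (exists p : {poly L},
     [/\ forall i, G (p`_i, 0), p.[x^-1] = 1 & (size p <= m)%N]) -> False.
Proof.
have [k] := ubnP (n + m); elim: k n m x => // k IH n m x /ltnSE nmk x0.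
wlog le_mn : n m x nmk x0 / (m <= n)%N.
  move=> H pn pm; case/orP: (leq_total m n) => le; first exact: (H n m x).
  by apply: (H m n x^-1) => //; rewrite ?invrK ?invr_eq0 // addnC.
move=> [p [Gp px sp]] [q [Gq qx sq]].
have nz (r : {poly L}) y : r.[y] = 1 -> r != 0.
  by move=> ry; apply: contra_eq_neq ry => ->; rewrite horner0 eq_sym oner_eq0.
have m0 : (0 < m)%N by rewrite (leq_trans _ sq) // size_poly_gt0 (nz _ _ qx).
have n0 : (0 < n)%N by rewrite (leq_trans _ le_mn).
have Gu : G (1 - q`_0, 1).
  by rewrite -[X in G (_, X)]subr0; apply: partial_homB => //; apply: partial_hom1.
have u0 : 1 - q`_0 != 0.
  apply: contra_neq (oner_neq0 W) => e0.
  by rewrite e0 in Gu; apply: (partial_hom_eq0 hG Gu).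
have GuV : G ((1 - q`_0)^-1, 1) by rewrite -[X in G (_, X)]invr1; apply: max_inv => //; rewrite oner_neq0.
pose r := \poly_(i < m.-1) ((1 - q`_0)^-1 * q`_(m.-1 - i)).
have Gr i : G (r`_i, 0).
  rewrite coef_poly; case: ifP => _; last exact: partial_hom0.
  by rewrite -[X in G (_, X)](mulr0 1); apply: partial_homM.
have rx : r.[x] = x ^+ m.-1.
  rewrite horner_poly; apply: (mulfI u0).
  rewrite mulr_sumr; under eq_bigr do rewrite mulrA mulVKf //.
  rewrite mulrBl mul1r; apply/eqP; rewrite eq_sym subr_eq; apply/eqP.
  rewrite -[LHS]mul1r -qx (horner_coef_wide _ sq) mulr_suml.
  rewrite -[m in LHS]prednK // big_ord_recl /= expr0 mulr1 addrC; congr (_ + _).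
  rewrite [RHS](reindex_inj rev_ord_inj) /=; apply: eq_bigr => i _.
  rewrite /bump /= add1n subKn // -mulrA exprVn; congr (_ * _).
  by rewrite mulrC -exprB ?unitfE.
have [p' [Gp' p'x sp']] : exists p' : {poly L},
    [/\ forall i, G (p'`_i, 0), p'.[x] = 1 & (size p' <= n.-1)%N].
  (* The top term of [p] is replaced through [r], shifted by ['X^(n - m)]. *)
  pose c := p`_n.-1.
  exists (\poly_(i < n.-1) p`_i + c%:P * 'X^(n - m) * r); split.
  - move=> i; rewrite coefD -[X in G (_, X)](addr0 0); apply: partial_homD => //.
      by rewrite coef_poly; case: ifP => _ //; apply: partial_hom0.
    rewrite -mulrA coefCM coefXnM; case: ifP => _.
      by rewrite mulr0; apply: partial_hom0.
    by rewrite -[X in G (_, X)](mulr0 0); apply: partial_homM => //; apply: Gp.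
  - rewrite hornerD hornerM rx !hornerE -mulrA -exprD.
    have -> : ((n - m) + m.-1 = n.-1)%N.
      by rewrite -subn1 addnBA // subnK // subn1.
    rewrite horner_poly -px (horner_coef_wide _ sp) -(prednK n0) big_ord_recr /=.
    by rewrite -/c.
  - rewrite (leq_trans (size_polyD _ _)) // geq_max size_poly /= -mulrA.
    rewrite (leq_trans (size_polyMleq _ _)) //.
    rewrite (leq_trans (n := (size ('X^(n - m) * r)%R))) //.
      by rewrite size_polyC; case: eqP => _ /=; rewrite ?add0n ?leq_pred.
    rewrite (leq_trans (size_polyMleq _ _)) // size_polyXn addSn /=.
    rewrite (leq_trans (leq_add (leqnn _) (size_poly _ _))) //.
    by rewrite -[m.-1]subn1 addnBA // subnK // subn1.
apply: (IH n.-1 m x _ x0); [|by exists p'|by exists q].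
by rewrite (leq_trans _ nmk) // -{2}(prednK n0) addSn.
Qed.

(** If [x^-1] had a nonzero image, then [x] would lie in the domain by [max_inv]. So if both
    alternatives fail, [max_small] applies to [x] and to [x^-1], against [small_excl]. *)
Lemma maximal_valuative : valuative G.
Proof.
move=> x x0; apply: contrapT => /not_orP[xD x'0].
have x'D : ~ exists a, G (x^-1, a).
  move=> [a x'a]; have [a0|a0] := eqVneq a 0; first by apply: x'0; rewrite -a0.
  by apply: xD; exists a^-1; rewrite -[x]invrK; apply: max_inv.
have [p Gp px] := max_small xD; have [q Gq qx] := max_small x'D.
by apply: (small_excl (n := size p) (m := size q) x0); [exists p | exists q].
Qed.

End Maximal.

Lemma place_extension (G0 : set (L * W)) : partial_hom G0 ->
  exists G, [/\ G0 `<=` G, partial_hom G & valuative G].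
Proof.
move=> hG0.
(* The order is on the sets [X] added to [G0], so that the union over the empty chain is admissible
   as well. *)
have [|A [hA Amax]] := @Zorn_bigcup _ [set X | partial_hom (G0 `|` X)].
  move=> F FP Ftot; have [[X0 FX0]|noF] := pselect (exists X, F X); last first.
    rewrite (_ : \bigcup_(X in F) X = set0) /= ?setU0 //.
    by apply/seteqP; split=> // z [X FX]; case: noF; exists X.
  have two z t : (G0 `|` \bigcup_(X in F) X) z -> (G0 `|` \bigcup_(X in F) X) t ->
      exists X, [/\ F X, (G0 `|` X) z & (G0 `|` X) t].
    move=> [zG|[X FX Xz]] [tG|[Y FY Yt]].
    - by exists X0; split=> //; left.
    - by exists Y; split=> //; [left|right].
    - by exists X; split=> //; [right|left].
    - have [XY|YX] := Ftot _ _ FX FY.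
        by exists Y; split=> //; right=> //; apply: XY.
      by exists X; split=> //; right=> //; apply: YX.
  have up X : F X -> G0 `|` X `<=` G0 `|` \bigcup_(X in F) X.
    by move=> FX z [|Xz]; [left|right; exists X].
  split.
  - by left; apply: (partial_hom1 hG0).
  - move=> x a y b /two H /H[X [FX xa yb]]; apply: (up _ FX).
    exact: (partial_homB (FP _ FX) xa yb).
  - move=> x a y b /two H /H[X [FX xa yb]]; apply: (up _ FX).
    exact: (partial_homM (FP _ FX) xa yb).
  - move=> a za; have [X [FX xa _]] := two _ _ za za.
    exact: (partial_hom_eq0 (FP _ FX) xa).
exists (G0 `|` A); split; [by move=> z ?; left | exact: hA |].
apply: maximal_valuative => // G' hG' sub.
have [GA|nGA] := pselect (G' `<=` A); first by move=> z /GA; right.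
case: (Amax G'); first by split=> // z Az; apply: sub; right.
rewrite /= (_ : G0 `|` G' = G') //; apply/seteqP; split=> z; last by move=> ?; right.
by case=> // G0z; apply: sub; left.
Qed.

End PlaceExtension.

Section Valuative.
Variables (L : fieldType) (W : closedFieldType) (G : set (L * W)).
Hypotheses (hG : partial_hom G) (vG : valuative G).

Lemma valuative_inv x a : G (x, a) -> a != 0 -> G (x^-1, a^-1).
Proof.
move=> xa a0; have x0 : x != 0.
  by apply: contra_neq a0 => x0; apply: (partial_hom_eq0 hG); rewrite -x0.
have xVx : x^-1 != 0 by rewrite invr_eq0.
have [[b xVb]|] := vG xVx; last first.
  by rewrite invrK => /(partial_hom_inj hG xa) a0'; rewrite a0' eqxx in a0.
suff -> : a^-1 = b by [].
apply: (mulfI a0); rewrite mulfV //; apply: (partial_hom_inj hG (x := 1)).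
  exact: partial_hom1.
by rewrite -(mulfV x0); apply: partial_homM.
Qed.

(** A valuation ring is integrally closed: if [x] were outside, [x^-1] would be sent to 0, and
    dividing the equation by the leading power of [x] would send -1 to 0. *)
Lemma valuative_integral (p : {poly L}) x : p \is monic ->
  (forall i, exists a, G (p`_i, a)) -> root p x -> exists a, G (x, a).
Proof.
move=> pm pG /rootP px.
have [->|x0] := eqVneq x 0; first by exists 0; apply: partial_hom0.
have [//|xV0] := vG x0.
have p0 := monic_neq0 pm; have : (0 < size p)%N by rewrite size_poly_gt0.
case sp: (size p) => [//|n] _.
have : G (\sum_(i < n) p`_i * x^-1 ^+ (n - i), \sum_(i < n) 0).
  apply: partial_hom_sum => // i _; rewrite mulrC; apply: partial_homM0 => //.
  rewrite -(subnSK (ltn_ord i)) exprS; apply: partial_homM0 => //.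
  by apply: partial_hom_domX => //; exists 0.
rewrite [X in G (_, X)]big1 //; have -> : \sum_(i < n) p`_i * x^-1 ^+ (n - i) = -1.
  apply: (mulfI (expf_neq0 n x0)); rewrite mulr_sumr mulrN1.
  move/eqP: px; rewrite horner_coef sp big_ord_recr /= addr_eq0.
  rewrite (_ : p`_n = 1) ?mul1r; last first.
    by move: pm; rewrite monicE lead_coefE sp => /eqP.
  move=> /eqP <-; apply: eq_bigr => i _; rewrite mulrCA; congr (_ * _).
  by rewrite exprVn exprB ?unitfE // 1?ltnW // invfM invrK mulrA mulfV ?mul1r ?expf_neq0.
move=> /(partial_homN hG); rewrite opprK oppr0 => G10.
have /eqP := partial_hom_inj hG (partial_hom1 hG) G10.
by rewrite oner_eq0.
Qed.

End Valuative.

(** * Places of a finite extension above a discrete place are discrete *)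

Section DiscretePlace.
Variables (k : closedFieldType) (F0 : fieldType) (F : fieldExtType F0).
Variables (G : set (F * k)) (hG : partial_hom G) (vG : valuative G).
Variable y : F.
Hypotheses (y_neq0 : y != 0) (Gy : G (y, 0)).
Hypothesis G_divy : forall z : F0, G (in_alg F z, 0) -> exists a, G (in_alg F z / y, a).
Hypothesis G_muly : forall z : F0, exists r a, G (y ^+ r * in_alg F z, a).

(** [D] is the valuation ring of the place, [M] its maximal ideal and [U] its group of units. The
    section hypotheses say that [y] behaves on the base field like a uniformizer. *)
Let D x := exists a, G (x, a).
Let M x := G (x, 0).
Let U x := exists2 a, a != 0 & G (x, a).
Let n := \dim {:F}.

Let DM x z : D x -> D z -> D (x * z). Proof. exact: partial_hom_domM. Qed.
Let DX m x : D x -> D (x ^+ m). Proof. exact: partial_hom_domX. Qed.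
Let D0 : D 0. Proof. by exists 0; apply: partial_hom0. Qed.
Let D1 : D 1. Proof. by exists 1; apply: partial_hom1. Qed.
Let D_M x : M x -> D x. Proof. by exists 0. Qed.
Let M1F : ~ M 1.
Proof.
move=> /(partial_hom_inj hG (partial_hom1 hG))/eqP; by rewrite oner_eq0.
Qed.
Let MM x z : M x -> D z -> M (x * z). Proof. exact: partial_homM0. Qed.
Let UP x : D x -> ~ M x -> U x.
Proof.
by move=> [a xa] xM; exists a => //; apply/eqP => a0; apply: xM; rewrite /M -a0.
Qed.
Let UV x : U x -> U x^-1.
Proof.
move=> [a a0 xa]; exists a^-1; rewrite ?invr_eq0 //.
exact: (valuative_inv hG vG).
Qed.
Let UM x z : U x -> U z -> U (x * z).
Proof.
move=> [a a0 xa] [b b0 zb]; exists (a * b); rewrite ?mulf_neq0 //.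
exact: partial_homM.
Qed.
Let DU x : U x -> D x. Proof. by case=> a _; exists a. Qed.
Let U1 : U 1. Proof. by exists 1; rewrite ?oner_eq0 //; apply: partial_hom1. Qed.

(** An entry of least valuation. Dividing a linear relation by such a coefficient makes all
    coefficients integral and one of them a unit. *)
Let max_elt (s : seq F) : (exists2 z, z \in s & z != 0) ->
  exists z, [/\ z \in s, z != 0 & forall t, t \in s -> D (t / z)].
Proof.
elim: s => [[z]|x s IH]; first by rewrite in_nil.
move=> [z0 z0s z00].
have [[z zs zn0]|nos] := pselect (exists2 z, z \in s & z != 0); last first.
  have s0 t : t \in s -> t = 0.
    by move=> ts; apply/eqP/negPn/negP => t0; apply: nos; exists t.
  have xn0 : x != 0.
    move: z0s; rewrite in_cons => /orP[/eqP <- //|/s0 z0E].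
    by rewrite z0E eqxx in z00.
  exists x; split; rewrite ?mem_head // => t; rewrite in_cons => /orP[/eqP ->|/s0 ->].
    by rewrite mulfV.
  by rewrite mul0r.
have [|{zs zn0}z [zs zn0 zD]] := IH; first by exists z.
have [->|xn0] := eqVneq x 0.
  exists z; split=> // [|t]; first by rewrite in_cons zs orbT.
  by rewrite in_cons => /orP[/eqP ->|/zD //]; rewrite mul0r.
have xz0 : x / z != 0 by rewrite mulf_neq0 ?invr_eq0.
have [xzD|] := vG xz0.
  exists z; split=> // [|t]; first by rewrite in_cons zs orbT.
  by rewrite in_cons => /orP[/eqP ->|/zD].
rewrite invfM invrK mulrC => zx.
exists x; split; rewrite ?mem_head // => t; rewrite in_cons => /orP[/eqP ->|ts].
  by rewrite mulfV.
rewrite (_ : t / x = t / z * (z / x)); last by rewrite mulrA divfK.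
by apply: DM; [exact: zD | exact: D_M].
Qed.

Let dependent x : exists c : 'I_n.+1 -> F0,
  (exists i, c i != 0) /\ \sum_(i < n.+1) in_alg F (c i) * x ^+ i = 0.
Proof.
pose X := [tuple x ^+ i | i < n.+1].
have nX : ~ free X.
  move=> /eqP Xfree; have := dimvS (subvf <<X>>%VS).
  by rewrite Xfree size_tuple ltnn.
have [c] : exists c : 'I_n.+1 -> F0, ~ (\sum_(i < n.+1) c i *: X`_i = 0 ->
    forall i, c i = 0) by apply/existsNP => /freeP.
move=> /not_implyP[cX /existsNP[i /eqP ci]]; exists c; split; first by exists i.
rewrite -[RHS]cX; apply: eq_bigr => j _; rewrite mulr_algl; congr (_ *: _).
by rewrite (nth_mktuple _ _ j).
Qed.

(* Normalise an algebraic relation for x to have coefficients in the valuation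
   ring, not all in its maximal ideal: the terms before the first unit
   coefficient are divisible by y. *)
Let dvd_y x : M x -> D (x ^+ n / y).
Proof.
move=> xM; have [c [[i0 ci0] cx]] := dependent x.
have [|z [/codomP[i1 zE] zn0 zD]] := @max_elt (codom (fun i => in_alg F (c i))).
  by exists (in_alg F (c i0)); rewrite ?codom_f // fmorph_eq0.
pose d i : F := in_alg F (c i / c i1).
have ci1 : c i1 != 0 by apply: contra_neq zn0 => ci1; rewrite zE ci1 rmorph0.
have dD i : D (d i).
  have -> : d i = in_alg F (c i) / z by rewrite zE /d fmorph_div.
  exact/zD/codom_f.
have dx : \sum_(i < n.+1) d i * x ^+ i = 0.
  apply: (mulfI zn0); rewrite mulr0 -[RHS]cx mulr_sumr; apply: eq_bigr => i _.
  by rewrite mulrA zE -rmorphM /= mulrCA mulfV // mulr1.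
have exl : exists l : nat, `[< exists i : 'I_n.+1, i = l :> nat /\ ~ M (d i) >].
  exists i1; apply/asboolP; exists i1; split=> //.
  by rewrite /d mulfV // rmorph1.
case: (ex_minnP exl) => _ /asboolP[l [<- dlM]] lmin.
have dM (i : 'I_n.+1) : (i < l)%N -> M (d i).
  move=> il; apply: contrapT => di.
  have /lmin : `[< exists j : 'I_n.+1, j = i :> nat /\ ~ M (d j) >].
    by apply/asboolP; exists i.
  by rewrite leqNgt il.
pose u := \sum_(i < n.+1 | (l <= i)%N) d i * x ^+ (i - l).
have uU : U u.
  have [a a0 da] := UP (dD l) dlM; exists a => //.
  rewrite /u (bigD1 l) //= subnn expr0 mulr1 -[a]addr0.
  apply: partial_homD => //.
  have : G (\sum_(i < n.+1 | (l <= i)%N && (i != l)) d i * x ^+ (i - l),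
            \sum_(i < n.+1 | (l <= i)%N && (i != l)) 0).
    apply: partial_hom_sum => // i /andP[li il]; rewrite mulrC; apply: MM => //.
    have : (0 < i - l)%N by rewrite subn_gt0 ltn_neqAle li eq_sym il.
    by case: (i - l)%N => // m _; rewrite exprS; apply: MM => //; apply/DX/D_M.
  by rewrite [X in G (_, X)]big1.
have Ey i : d i / y * x ^+ i * y = d i * x ^+ i by rewrite mulrAC divfK.
have : x ^+ l / y = - u^-1 * \sum_(i < n.+1 | (i < l)%N) (d i / y) * x ^+ i.
  have u0 : u != 0.
    by case: uU => a a0 ua; apply: contra_neq a0 => u0; apply: (partial_hom_eq0 hG);
      rewrite -u0.
  apply: (mulfI u0); rewrite [RHS]mulrA mulrN mulfV // mulN1r mulrA.
  apply: (mulIf y_neq0); rewrite divfK // mulNr [in RHS]mulr_suml.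
  under [in RHS]eq_bigr do rewrite Ey.
  apply/eqP; rewrite -addr_eq0 -[X in _ == X]dx; apply/eqP.
  rewrite [RHS](bigID (fun i : 'I_n.+1 => (l <= i)%N)) /=; congr (_ + _).
    rewrite mulr_suml; apply: eq_bigr => i li.
    by rewrite -mulrA -exprD subnK.
  by apply: eq_bigl => i; rewrite ltnNge.
move=> xly; rewrite -(subnK (ltn_ord l : (l <= n)%N)) exprD -mulrA xly.
apply: DM; first exact/DX/D_M.
apply: DM; first by have [a ua] := DU (UV uU); exists (- a); apply: partial_homN.
apply: partial_hom_dom_sum => // i il; apply: DM; last exact/DX/D_M.
by apply: G_divy; apply: dM.
Qed.

(** The ramification index is at most the degree [n]: by [dvd_y], [y] divides [pi ^+ n], so if
    [pi ^+ e] divides [y] with [e > n] then [pi] is invertible. *)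
Let y_pow_bound (pi : F) e : M pi -> pi != 0 -> D (y / pi ^+ e) -> (e <= n)%N.
Proof.
move=> piM pi0 ye; rewrite leqNgt; apply/negP => ne; apply: M1F.
have : D (pi^-1).
  rewrite (_ : pi^-1 = (pi ^+ n / y) * (y / pi ^+ e) * pi ^+ (e - n.+1)).
    by apply: DM; [apply: DM => //; apply: dvd_y | apply/DX/D_M].
  pose m := (e - n.+1)%N; have eE : e = (n.+1 + m)%N by rewrite subnKC.
  rewrite -/m eE mulrA divfK // exprD exprSr invfM -2!mulrA.
  rewrite mulVf ?expf_neq0 // mulr1 invfM mulrA mulfV ?expf_neq0 //.
  by rewrite mul1r.
by move=> H; rewrite -(mulfV pi0); apply: MM.
Qed.

(** Take [pi] in [M] such that the largest possible power [e] of it divides [y]. If [pi] does not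
    divide some [x] in [M], then [pi / x] is in [M]; the square of [x] or of [pi / x], whichever has
    smaller valuation, divides [pi], and its power [2e] divides [y]. *)
Lemma discrete_uniformizer : exists pi e, [/\ M pi, pi != 0, (0 < e)%N, D (y / pi ^+ e) &
  forall x, M x -> D (x / pi)].
Proof.
pose P e := `[< exists pi, [/\ M pi, pi != 0 & D (y / pi ^+ e)] >].
have exP : exists e, P e.
  by exists 1%N; apply/asboolP; exists y; split; rewrite // expr1 mulfV.
have Pn e : P e -> (e <= n)%N.
  by move=> /asboolP[pi [piM pi0]]; apply: y_pow_bound.
case: (ex_maxnP exP Pn) => e /asboolP[pi [piM pi0 yD]] emax.
have e0 : (0 < e)%N.
  by apply: emax; apply/asboolP; exists y; split; rewrite // expr1 mulfV.
exists pi, e; split=> // x xM; apply: contrapT => xpi.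
have x0 : x != 0 by apply/eqP => x0; apply: xpi; rewrite x0 mul0r.
have xpi0 : x / pi != 0 by rewrite mulf_neq0 ?invr_eq0.
have [//|] := vG xpi0; rewrite invfM invrK mulrC => pixM.
have pix0 : pi / x != 0 by rewrite mulf_neq0 ?invr_eq0.
suff [w [wM w0 piw]] : exists w, [/\ M w, w != 0 & D (pi / w ^+ 2)].
  suff : (e * 2 <= e)%N by rewrite muln2 -addnn -{3}[e]addn0 leq_add2l leqNgt e0.
  apply: emax; apply/asboolP; exists w; split=> //.
  rewrite (_ : y / _ = y / pi ^+ e * (pi / w ^+ 2) ^+ e).
    by apply: DM => //; apply: DX.
  by rewrite exprMn exprVn -exprM mulnC mulrA divfK ?expf_neq0.
have q0 : x / (pi / x) != 0 by rewrite mulf_neq0 ?invr_eq0.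
have [H|H] := vG q0.
  exists (pi / x); split=> //; rewrite (_ : _ / _ = x / (pi / x)) //.
  by rewrite expr2 !invfM !invrK !mulrA mulfV // mul1r.
exists x; split=> //; rewrite (_ : _ / _ = (x / (pi / x))^-1); first exact: D_M.
by rewrite expr2 !invfM !invrK mulrCA.
Qed.

(** The largest [j] such that [pi ^+ j] divides [x] gives a unit quotient. That such [j] are bounded
    follows from an algebraic relation for [x], solved for its lowest nonzero term. *)
Let unit_mul_pow pi e x : M pi -> pi != 0 -> D (y / pi ^+ e) ->
  (forall z, M z -> D (z / pi)) -> x != 0 -> D x -> exists j, U (x / pi ^+ j).
Proof.
move=> piM pi0 ye piD x0 xD.
pose P j := `[< D (x / pi ^+ j) >].
have exP : exists j, P j by exists 0%N; apply/asboolP; rewrite divr1.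
suff [b Pb] : exists b, forall j, P j -> (j <= b)%N.
  case: (ex_maxnP exP Pb) => j /asboolP jD jmax; exists j; apply: UP => // jM.
  suff /jmax : P j.+1 by rewrite ltnn.
  by apply/asboolP; rewrite exprSr invfM mulrA; apply: piD.
have [c [[i0 ci0] cx]] := dependent x.
have exl : exists l : nat, [exists i : 'I_n.+1, (i == l :> nat) && (c i != 0)].
  by exists i0; apply/existsP; exists i0; rewrite eqxx.
case: (ex_minnP exl) => _ /existsP[l /andP[/eqP <- cl0]] lmin.
have c0 (i : 'I_n.+1) : (i < l)%N -> c i = 0.
  move=> il; apply/eqP/negPn/negP => ci.
  have /lmin : [exists j : 'I_n.+1, (j == i :> nat) && (c j != 0)].
    by apply/existsP; exists i; rewrite eqxx.
  by rewrite leqNgt il.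
have [r rD] : exists r, forall i, D (y ^+ r * in_alg F (c i / c l)).
  have /choice[r rD] i := G_muly (c i / c l).
  exists (\max_i r i)%N => i.
  rewrite -(subnK (leq_bigmax i : (r i <= _)%N)) exprD -mulrA.
  by apply: DM; [exact/DX/D_M | exact: rD].
(* [y ^+ r] clears the denominators of the relation and [y] divides [pi ^+ n]. Hence if [j] exceeds
   [n * r], then [x / y ^+ r] is in [M]. *)
exists (n * r)%N => j /asboolP jD; rewrite leqNgt; apply/negP => nrj.
have xyM : M (x / y ^+ r).
  rewrite (_ : x / _ = pi * (pi ^+ (j - (n * r).+1) * (x / pi ^+ j * (pi ^+ n / y) ^+ r))).
    by apply: MM => //; apply: DM; [exact/DX/D_M|apply: DM => //; exact/DX/dvd_y].
  rewrite exprMn exprVn -exprM mulrA -exprS -subSn // subSS.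
  rewrite !mulrA; congr (_ / _); rewrite mulrAC (mulrC (pi ^+ _) x) -!mulrA.
  by rewrite (mulrA (pi ^+ _) (pi ^+ _)) -exprD subnK ?mulfV ?mulr1 ?expf_neq0 // ltnW.
apply: M1F; have cl0' : in_alg F (c l) != 0 by rewrite fmorph_eq0.
(* The relation divided by its lowest term; every summand on the right is in [M]. *)
have -> : 1 = - \sum_(i < n.+1 | (l < i)%N)
    (x / y ^+ r) * (y ^+ r * in_alg F (c i / c l) * x ^+ (i - l.+1)).
  apply: (mulfI (expf_neq0 l x0)); apply: (mulfI cl0').
  rewrite mulr1 2!mulrN mulrA mulr_sumr; apply/eqP; rewrite -addr_eq0.
  rewrite -[X in _ == X]cx; apply/eqP; rewrite [RHS](bigD1 l) //.
  congr (_ + _).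
  rewrite [RHS](bigID (fun i : 'I_n.+1 => (l < i)%N)) [X in _ = _ + X]big1 ?addr0.
    apply: eq_big => [i|i li]; first by rewrite andb_idl // => /gtn_eqF /negbT.
    have -> : in_alg F (c i) = in_alg F (c l) * in_alg F (c i / c l).
      by rewrite -rmorphM /= mulrCA mulfV ?mulr1.
    rewrite -[in RHS](subnKC li) exprD exprSr -[RHS]mulrA -[LHS]mulrA.
    congr (_ * _).
    move: (in_alg F _) (x ^+ (i - l.+1)) => u v.
    rewrite [RHS]mulrCA -!mulrA; congr (_ * _); congr (_ * _).
    by rewrite mulrA mulrA mulVf ?expf_neq0 // mul1r.
  move=> i /andP[/= il li]; rewrite c0 ?scale0r ?rmorph0 ?mul0r //.
  by rewrite ltn_neqAle leqNgt li andbT.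
have : G (\sum_(i < n.+1 | (l < i)%N)
    (x / y ^+ r) * (y ^+ r * in_alg F (c i / c l) * x ^+ (i - l.+1)),
    \sum_(i < n.+1 | (l < i)%N) 0).
  by apply: partial_hom_sum => // i _; apply: MM => //; apply: DM => //; exact: DX.
by rewrite [X in G (_, X)]big1 // => /(partial_homN hG); rewrite oppr0.
Qed.

(** [v x] is the exponent [m] for which [x * pi ^ (- m)] is a unit. It exists by [unit_mul_pow],
    applied to [x] or to [x^-1], and is unique because a power of [pi] is a unit only for exponent
    0. *)
Lemma discrete_place : exists v : F -> int,
  [/\ v 0 = 0,
      forall x z, x != 0 -> z != 0 -> v (x * z) = v x + v z,
      forall x z, x != 0 -> z != 0 -> x + z != 0 ->
        Num.min (v x) (v z) <= v (x + z),
      exists2 x, x != 0 & v x = 1 &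
      (forall x a, a != 0 -> G (x, a) -> v x = 0) /\
      (forall x, x != 0 -> G (x, 0) -> 1 <= v x)].
Proof.
have [pi [e [piM pi0 e0 ye piD]]] := discrete_uniformizer.
have UX (x : F) (m : nat) : U x -> U (x ^+ m).
  by move=> xU; elim: m => [|m IH]; rewrite ?exprS //; apply: UM.
have MX (m : nat) : (0 < m)%N -> M (pi ^+ m).
  by case: m => // m _; rewrite exprS; apply: MM => //; apply/DX/D_M.
have nUM x : U x -> M x -> False.
  move=> [a a0 xa] xM; have aE := partial_hom_inj hG xa xM.
  by rewrite aE eqxx in a0.
have nUMV x : U x -> M x^-1 -> False by move=> /UV; apply: nUM.
have powU (m : int) : U (pi ^ m) -> m = 0.
  case: m => [[//|m]|m].
    by move=> /nUM[]; apply: MX.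
  by rewrite NegzE -exprnN => /nUMV; rewrite invrK => -[]; apply: MX.
have ex_v x : exists m : int, x != 0 -> U (x * pi ^ (- m)).
  have [->|x0] := eqVneq x 0; first by exists 0.
  have [xD|xM] := vG x0.
    have [j jU] := unit_mul_pow piM pi0 ye piD x0 xD.
    by exists j%:Z => _; rewrite -exprnN.
  have xV0 : x^-1 != 0 by rewrite invr_eq0.
  have [j jU] := unit_mul_pow piM pi0 ye piD xV0 (D_M xM).
  exists (- j%:Z) => _; rewrite opprK -exprnP.
  by have := UV jU; rewrite invfM !invrK.
have [v0 v0P] := choice ex_v.
pose v x := if x == 0 then 0 else v0 x.
have vE x m : x != 0 -> U (x * pi ^ (- m)) -> v x = m.
  move=> x0 mU; rewrite /v (negPf x0); apply/eqP; rewrite -subr_eq0; apply/eqP.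
  apply: powU; rewrite (_ : pi ^ _ = x * pi ^ (- m) * (x * pi ^ (- v0 x))^-1).
    by apply: UM => //; apply: UV; apply: v0P.
  by rewrite invfM invr_expz opprK mulrACA mulfV // mul1r -expfzDr // addrC.
have vP x : x != 0 -> U (x * pi ^ (- v x)).
  by move=> x0; have := v0P _ x0; rewrite /v (negPf x0).
have vM x z : x != 0 -> z != 0 -> v (x * z) = v x + v z.
  move=> x0 z0; apply: vE; first by rewrite mulf_neq0.
  by rewrite opprD expfzDr // mulrACA; apply: UM; apply: vP.
have vU x : U x -> v x = 0.
  move=> xU; have [->|x0] := eqVneq x 0; first by rewrite /v eqxx.
  by apply: vE => //; rewrite oppr0 expr0z mulr1.
have vpi : v pi = 1.
  by apply: vE => //; rewrite -(exprnN _ 1) expr1 mulfV.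
have D_v x : x != 0 -> 0 <= v x -> D x.
  move=> x0; have := vP _ x0; case: (v x) => // m mU _.
  rewrite -[x](divfK (expf_neq0 m pi0)); apply: DM; last exact/DX/D_M.
  by apply: DU; rewrite exprnN.
have v_D x : x != 0 -> D x -> 0 <= v x.
  move=> x0 xD; rewrite leNgt; apply/negP => vx.
  have := vP _ x0; case: (v x) vx => // m _; rewrite NegzE opprK -exprnP.
  by move=> /nUM[]; rewrite mulrC; apply: MM => //; apply: MX.
exists v; split=> //; first by rewrite /v eqxx.
- move=> x z x0 z0 xz0.
  wlog le : x z x0 z0 xz0 / v x <= v z.
    move=> H; case/orP: (le_total (v x) (v z)) => le; first exact: (H x z).
    by rewrite minC addrC; apply: (H z x) => //; rewrite addrC.
  rewrite min_l //.
  have -> : x + z = x * (1 + x^-1 * z) by rewrite mulrDr mulr1 mulVKf.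
  have w0 : 1 + x^-1 * z != 0.
    by apply: contra_neq xz0 => w0; rewrite -[z](mulVKf x0) -{1}[x]mulr1 -mulrDr w0 mulr0.
  rewrite vM // lerDl; apply: v_D => //.
  have [a xza] : D (x^-1 * z).
    apply: D_v; rewrite ?mulf_neq0 ?invr_eq0 //.
    rewrite vM ?invr_eq0 // -(lerD2l (v x)) addrA -vM ?invr_eq0 //.
    by rewrite mulfV // (vU 1) // add0r addr0.
  by exists (1 + a); apply: partial_homD => //; apply: partial_hom1.
- by exists pi.
- split=> [x a a0 xa|x x0 xM]; first by apply: vU; exists a.
  rewrite -[x](divfK pi0) vM ?mulf_neq0 ?invr_eq0 // vpi lerDr.
  by apply: v_D; rewrite ?mulf_neq0 ?invr_eq0 //; apply: piD.
Qed.

End DiscretePlace.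

(** * Function fields *)

Lemma frac_repr (B : idomainType) (x : {fraction B}) :
  exists p q, q != 0 /\ x = tofrac p / tofrac q.
Proof.
elim/quotW: x => -[[p q] /= q0]; exists p, q; split=> //.
have q0' : tofrac q != 0 :> {fraction B} by rewrite tofrac_eq0.
apply: (mulIf q0'); rewrite divfK //; unlock tofrac.
rewrite !piE; apply/eqmodP => /=.
rewrite FracField.equivfE /FracField.mulf !numden_Ratio ?mulf_neq0 ?oner_neq0 //.
by rewrite !mulr1 mulrC.
Qed.

Lemma div_sub_div (L : fieldType) (a b c d : L) : b != 0 -> d != 0 ->
  a / b - c / d = (a * d - c * b) / (b * d).
Proof. by move=> b0 d0; rewrite -[in LHS]mulNr addf_div // mulNr. Qed.

Section LocGraph.
Variables (B : comNzRingType) (L W : fieldType).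
Variables (e : {rmorphism B -> L}) (h : {rmorphism B -> W}).
Hypothesis e_inj : injective e.

(* The extension of h to the localization of B at the kernel of h, inside L. *)
Definition loc_graph : set (L * W) :=
  [set z | exists p q, [/\ h q != 0, z.1 = e p / e q & z.2 = h p / h q]].

Lemma loc_graph_neq0 q : h q != 0 -> e q != 0.
Proof. by apply: contra_neq => /eqP; rewrite -(rmorph0 e) (inj_eq e_inj) => /eqP ->; rewrite rmorph0. Qed.

Lemma loc_graph_base p : loc_graph (e p, h p).
Proof. by exists p, 1; rewrite !rmorph1 !divr1 oner_neq0. Qed.

Lemma loc_graph_hom : partial_hom loc_graph.
Proof.
split.
- by rewrite -(rmorph1 e) -(rmorph1 h); apply: loc_graph_base.
- move=> _ _ _ _ [p [q [q0 /= -> ->]]] [p' [q' [q'0 /= -> ->]]].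
  exists (p * q' - p' * q), (q * q'); have eq0 := loc_graph_neq0 q0.
  have eq'0 := loc_graph_neq0 q'0.
  split; rewrite ?rmorphB ?rmorphM ?mulf_neq0 //=.
    exact: div_sub_div.
  exact: div_sub_div.
- move=> _ _ _ _ [p [q [q0 /= -> ->]]] [p' [q' [q'0 /= -> ->]]].
  exists (p * p'), (q * q'); split; rewrite ?rmorphM ?mulf_neq0 //=;
  by rewrite mulf_div.
- move=> _ [p [q [q0 /= /esym/eqP + ->]]].
  rewrite mulf_eq0 invr_eq0 (negPf (loc_graph_neq0 q0)) orbF.
  by rewrite -(rmorph0 e) (inj_eq e_inj) => /eqP ->; rewrite rmorph0 mul0r.
Qed.

End LocGraph.

(** The kernel of [h] is zero, so the localization at it is the whole fraction field and [loc_graph]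
    is everywhere defined. *)
Lemma frac_lift (B : idomainType) (F : fieldType) (h : {rmorphism B -> F}) :
  injective h ->
  {g : {rmorphism {fraction B} -> F} | forall b, g (tofrac b) = h b}.
Proof.
move=> h_inj; pose e : {rmorphism B -> {fraction B}} := @tofrac B.
have e_inj : injective e by move=> x z /eqP; rewrite tofrac_eq => /eqP.
have hG := loc_graph_hom h e_inj; set G := loc_graph e h in hG.
have /all_sig[g gG] : forall x, {a | G (x, a)}.
  move=> x; apply: cid; have [p [q [q0 ->]]] := frac_repr x.
  exists (h p / h q), p, q; split=> //.
  by rewrite -(rmorph0 h) (inj_eq h_inj).
have [||g' gE] := @rmorph_of _ _ g.
- move=> x z; apply: (partial_hom_inj hG (gG _)); exact: partial_homB.
- split; first by apply: (partial_hom_inj hG (gG _)); apply: partial_hom1.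
  move=> x z; apply: (partial_hom_inj hG (gG _)); exact: partial_homM.
exists g' => b; rewrite gE; apply: (partial_hom_inj hG (gG _)).
exact: loc_graph_base.
Qed.

Section MapGraph.
Variables (L L' : fieldType) (W : comPzRingType) (e : {rmorphism L -> L'}).

(** Carries a partial homomorphism to the larger field, where [place_extension] can be applied. *)
Definition map_graph (G : set (L * W)) : set (L' * W) :=
  [set z | exists2 x, z.1 = e x & G (x, z.2)].

Lemma map_graph_hom (G : set (L * W)) : partial_hom G -> partial_hom (map_graph G).
Proof.
move=> hG; split.
- by exists 1; rewrite ?rmorph1 //; apply: partial_hom1.
- move=> _ a _ b [x /= -> xa] [z /= -> zb]; exists (x - z); rewrite ?rmorphB //.
  exact: partial_homB.
- move=> _ a _ b [x /= -> xa] [z /= -> zb]; exists (x * z); rewrite ?rmorphM //.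
  exact: partial_homM.
- move=> a [x /= /esym/eqP]; rewrite fmorph_eq0 => /eqP ->.
  exact: partial_hom_eq0.
Qed.

End MapGraph.

Lemma expr_absz_shift (L : fieldType) (y z : L) (m : int) : y != 0 ->
  y ^+ absz m * z = z * y ^ (- m) * y ^+ absz (m + (absz m)%:Z)%R.
Proof.
move=> y0; case: m => m.
  by rewrite -exprnN -mulrA exprD mulKf ?expf_neq0 // mulrC.
by rewrite NegzE abszN opprK addNr mulr1 -exprnP mulrC.
Qed.

Lemma mul_div_exprz (L : fieldType) (a b u : L) (m m' : nat) : u != 0 -> b != 0 ->
  a * u ^+ m / (b * u ^+ m') * u ^ (- (m%:Z - m'%:Z)) = a / b.
Proof.
move=> u0 b0; rewrite opprB expfzDr // -exprnN -exprnP; field.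
by rewrite b0 !expf_neq0.
Qed.

Lemma mul_div_exprzV (L : fieldType) (a b u : L) (m m' : nat) : u != 0 -> b != 0 ->
  a / b * u^-1 ^ (- (m%:Z - m'%:Z)) = a * u ^+ m / (b * u ^+ m').
Proof.
move=> u0 b0; rewrite exprz_inv opprK expfzDr // -exprnN -exprnP; field.
by rewrite b0 !expf_neq0.
Qed.

Lemma mul_div_exprD (L : fieldType) (a b u : L) (m j : nat) : u != 0 -> b != 0 ->
  a * u ^+ m / (b * u ^+ (m + j)) = a / b * u^-1 ^+ j.
Proof.
move=> u0 b0; rewrite exprD exprVn; field.
by rewrite b0 !expf_neq0.
Qed.

Section PlaceOverBase.
Variables (k : closedFieldType) (F : fieldExtType {fraction {poly k}}).
Variables (G0 : set ({fraction {poly k}} * k)) (y : {fraction {poly k}}).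
Hypotheses (hG0 : partial_hom G0) (y0 : y != 0) (G0y : G0 (y, 0)).
Hypothesis G0_const : forall c : k, G0 (tofrac c%:P, c).
Hypothesis G0_unif : forall z, z != 0 ->
  exists (m : int) a, a != 0 /\ G0 (z * y ^ (- m), a).

(** [G0] is a discrete place of k(t) with uniformizer [y], extended to [F] by Chevalley's theorem.
    The value at [y] is the ramification index, for which the lower bound 1 suffices. *)
Lemma place_over_base : exists v : F -> int,
  [/\ place v, 1 <= v (in_alg F y) &
      forall x a, a != 0 -> G0 (x, a) -> v (in_alg F x) = 0].
Proof.
have hG1 := map_graph_hom (in_alg F) hG0; set G1 := map_graph _ _ in hG1.
have [G [G1G hG vG]] := place_extension hG1.
have GG0 x a : G0 (x, a) -> G (in_alg F x, a) by move=> xa; apply: G1G; exists x.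
have yF0 : in_alg F y != 0 by rewrite fmorph_eq0.
have yD m : exists a, G (in_alg F y ^+ m, a).
  by exists (0 ^+ m); apply: partial_homX => //; apply: GG0.
have zE z m : z = z * y ^ (- m) * y ^ m by rewrite -invr_expz divfK ?expfz_neq0.
have [||||v [v0 vM vA v1 [vU v_pos]]] := @discrete_place k _ F G hG vG (in_alg F y).
- by [].
- exact: GG0.
- move=> z zM; have [->|zn0] := eqVneq z 0.
    by rewrite rmorph0 mul0r; exists 0; apply: partial_hom0.
  have [m [a [a0 ma]]] := G0_unif zn0.
  (* Only a positive exponent is possible: otherwise [z * y ^ (- m)] would be sent to 0, whereas its
     value [a] is nonzero. *)
  case: m ma => [[|m]|m] ma; last 1 first.
  + rewrite NegzE opprK -exprnP in ma.
    have := partial_homM0 hG zM (yD m.+1); rewrite -rmorphXn -rmorphM.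
    by move=> /(partial_hom_inj hG (GG0 _ _ ma)) aE; rewrite aE eqxx in a0.
  + rewrite oppr0 expr0z mulr1 in ma.
    by have aE := partial_hom_inj hG (GG0 _ _ ma) zM; rewrite aE eqxx in a0.
  + rewrite {1}(zE z m.+1) -exprnP exprSr mulrA rmorphM mulfK //.
    rewrite rmorphM rmorphXn; apply: (partial_hom_domM hG) => //.
    by exists a; apply: GG0.
- move=> z; have [->|zn0] := eqVneq z 0.
    by exists 0%N; rewrite rmorph0 mulr0; exists 0; apply: partial_hom0.
  have [m [a [a0 ma]]] := G0_unif zn0; exists `|m|%N.
  have -> : in_alg F y ^+ absz m * in_alg F z =
      in_alg F (z * y ^ (- m)) * in_alg F y ^+ absz (m + (absz m)%:Z)%R.
    by rewrite -!rmorphXn -!rmorphM (expr_absz_shift z m y0).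
  by apply: (partial_hom_domM hG) => //; exists a; apply: GG0.
exists v; split.
- split=> // c c0; apply: (vU _ c) => //; exact: GG0.
- by apply: v_pos => //; apply: GG0.
- by move=> x a a0 xa; apply: (vU _ a) => //; apply: GG0.
Qed.

End PlaceOverBase.

Section Places.
Variables (k : closedFieldType) (F : fieldExtType {fraction {poly k}}).
Local Notation ratio p q := (in_alg F (tofrac p / tofrac q)).

(** A place above the point [c] of the affine line: [G0] is the local ring of the line at [c], with
    uniformizer ['X - c%:P]. *)
Lemma place_at (c : k) : exists v : F -> int,
  [/\ place v, 1 <= v (in_alg F (tofrac ('X - c%:P))) &
      forall p q : {poly k}, p.[c] != 0 -> q.[c] != 0 -> v (ratio p q) = 0].
Proof.
pose e : {rmorphism {poly k} -> {fraction {poly k}}} := @tofrac {poly k}.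
have e_inj : injective e by move=> x z /eqP; rewrite tofrac_eq => /eqP.
pose h : {rmorphism {poly k} -> k} := horner_eval c.
have hG := loc_graph_hom h e_inj; set G0 := loc_graph e h in hG.
have [||||v [pv vy vU]] := @place_over_base k F G0 (tofrac ('X - c%:P)) hG.
- by rewrite tofrac_eq0 polyXsubC_eq0.
- have -> : 0 = h ('X - c%:P) by rewrite /h /= /horner_eval !hornerE subrr.
  exact: loc_graph_base.
- move=> d; have {2}-> : d = h d%:P by rewrite /h /= /horner_eval hornerC.
  exact: loc_graph_base.
- move=> z z0; have [p [q [q0 zE]]] := frac_repr z.
  have p0 : p != 0.
    by apply: contra_neq z0 => p0; rewrite zE p0 tofrac0 mul0r.
  have [m [p1 p1c pE]] := multiplicity_XsubC p c.
  have [m' [q1 q1c qE]] := multiplicity_XsubC q c.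
  rewrite p0 q0 /= in p1c q1c; rewrite /root in p1c q1c.
  exists (m%:Z - m'%:Z), (h p1 / h q1); split.
    by rewrite mulf_neq0 ?invr_eq0.
  exists p1, q1; split=> //=; rewrite zE pE qE !tofracM !tofracXn.
  have X0 : tofrac ('X - c%:P) != 0 :> {fraction {poly k}}.
    by rewrite tofrac_eq0 polyXsubC_eq0.
  have q10 : tofrac q1 != 0 :> {fraction {poly k}}.
    by rewrite tofrac_eq0; apply: contra_neq q1c => ->; rewrite horner0.
  rewrite mul_div_exprz; [reflexivity | exact: X0 | exact: q10].
exists v; split=> // p q pc qc; apply: (vU _ (h p / h q)).
  by rewrite mulf_neq0 ?invr_eq0.
by exists p, q.
Qed.

Lemma coefM_top (A : nzRingType) (p q : {poly A}) n m :
  (size p <= n.+1)%N -> (size q <= m.+1)%N -> (p * q)`_(n + m) = p`_n * q`_m.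
Proof.
move=> sp sq; rewrite coefM (bigD1 (inord n)) //= inordK; last first.
  by rewrite ltnS leq_addr.
rewrite addKn big1 ?addr0 // => i; rewrite -val_eqE /= inordK; last first.
  by rewrite ltnS leq_addr.
rewrite neq_ltn => /orP[] ni.
  rewrite (@nth_default _ _ q) ?mulr0 //; apply: leq_trans sq _.
  by rewrite ltn_subRL ltn_add2r.
by rewrite nth_default ?mul0r // (leq_trans sp).
Qed.

(* The places over infinity have the uniformizer 1 / 'X. *)
Let infty_graph : set ({fraction {poly k}} * k) :=
  [set z | exists n (p q : {poly k}),
    [/\ (size p <= n.+1)%N, (size q <= n.+1)%N, q`_n != 0,
        z.1 = tofrac p / tofrac q & z.2 = p`_n / q`_n]].

Let infty_graph_hom : partial_hom infty_graph.
Proof.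
have nz (q : {poly k}) n : q`_n != 0 -> tofrac q != 0 :> {fraction {poly k}}.
  by rewrite tofrac_eq0; apply: contra_neq => ->; rewrite coef0.
have sM (p q : {poly k}) n m : (size p <= n.+1)%N -> (size q <= m.+1)%N ->
    (size (p * q)%R <= (n + m).+1)%N.
  move=> sp sq; rewrite (leq_trans (size_polyMleq _ _)) //.
  by rewrite -subn1 leq_subLR add1n -addSn -addnS leq_add.
split.
- by exists 0%N, 1, 1; split; rewrite /= ?size_poly1 ?coef1 ?tofrac1 ?divr1 ?oner_neq0.
- move=> _ _ _ _ [n [p [q [sp sq q0 /= -> ->]]]] [m [p' [q' [sp' sq' q'0 /= -> ->]]]].
  exists (n + m)%N, (p * q' - p' * q), (q * q').
  have tq := nz _ _ q0; have tq' := nz _ _ q'0; split=> /=.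
  + rewrite (leq_trans (size_polyD _ _)) // size_polyN geq_max sM //=.
    by rewrite addnC sM.
  + exact: sM.
  + by rewrite coefM_top // mulf_neq0.
  + rewrite tofracB !tofracM (div_sub_div _ _ tq tq'); reflexivity.
  + rewrite coefB (coefM_top sp sq') (coefM_top sq sq') (addnC n m).
    by rewrite (coefM_top sp' sq) (div_sub_div _ _ q0 q'0).
- move=> _ _ _ _ [n [p [q [sp sq q0 /= -> ->]]]] [m [p' [q' [sp' sq' q'0 /= -> ->]]]].
  exists (n + m)%N, (p * p'), (q * q').
  have tq := nz _ _ q0; have tq' := nz _ _ q'0; split=> /=.
  + exact: sM.
  + exact: sM.
  + by rewrite coefM_top // mulf_neq0.
  + rewrite !tofracM mulf_div; reflexivity.
  + by rewrite !coefM_top // mulf_div.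
- move=> _ [n [p [q [sp sq q0 /= /esym/eqP + ->]]]].
  rewrite mulf_eq0 invr_eq0 (negPf (nz _ _ q0)) orbF tofrac_eq0 => /eqP ->.
  by rewrite coef0 mul0r.
Qed.

Lemma place_powX (v : F -> int) x n : place v -> x != 0 -> v (x ^+ n) = v x *+ n.
Proof.
move=> [_ vM _ vC _] x0; elim: n => [|n IH].
  have := vC 1; rewrite oner_neq0 => /(_ isT).
  by rewrite !rmorph1 scale1r expr0.
by rewrite exprS vM ?expf_neq0 // IH mulrS.
Qed.

Lemma place_prod (v : F -> int) (I : Type) (r : seq I) (f : I -> F) : place v ->
  (forall i, f i != 0) -> v (\prod_(i <- r) f i) = \sum_(i <- r) v (f i).
Proof.
move=> pv f0; elim: r => [|i r IH].
  by rewrite !big_nil -(expr0 1) place_powX ?oner_neq0.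
rewrite !big_cons -IH; case: pv => _ vM _ _ _; apply: vM; first exact: f0.
by apply: (big_ind (fun x => x != 0)); [apply: oner_neq0|apply: mulf_neq0|move=> ? _; apply: f0].
Qed.

(** Up to a unit at infinity, [p / q] is the power of the uniformizer [1 / 'X] with exponent deg q -
    deg p, which is at most 0, and the uniformizer has value at least 1. *)
Lemma place_at_infty : exists v : F -> int, place v /\
  forall p q : {poly k}, p != 0 -> q != 0 -> (size q <= size p)%N ->
    v (ratio p q) <= (size q)%:Z - (size p)%:Z.
Proof.
have X0 : tofrac 'X != 0 :> {fraction {poly k}} by rewrite tofrac_eq0 polyX_eq0.
(* Both polynomials now have degree deg p + deg q, so the value at infinity is the quotient of the
   leading coefficients. *)
have unit_eq (p q : {poly k}) : p != 0 -> q != 0 ->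
    exists a, a != 0 /\ infty_graph (tofrac (p * 'X^((size q).-1)) / tofrac (q * 'X^((size p).-1)), a).
  move=> p0 q0; exists (lead_coef p / lead_coef q); split.
    by rewrite mulf_neq0 ?invr_eq0 ?lead_coef_eq0.
  exists ((size p).-1 + (size q).-1)%N, (p * 'X^((size q).-1)), (q * 'X^((size p).-1)).
  rewrite !size_mulXn // -?polySpred // !lead_coefE; split=> //=.
  - by rewrite -addSn -polySpred // addnC.
  - by rewrite -addnS -polySpred.
  - by rewrite coefMXn ltnNge leq_addr /= addKn -lead_coefE lead_coef_eq0.
  - by rewrite !coefMXn !ltnNge leq_addr leq_addl /= addKn addnK.
have [||||v [pv vy vU]] :=
    @place_over_base k F infty_graph (tofrac 'X)^-1 infty_graph_hom.
- by rewrite invr_eq0.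
- exists 1%N, 1, 'X; rewrite size_poly1 size_polyX coefX coef1 /= oner_neq0.
  by rewrite rmorph1 div1r mul0r.
- by move=> c; exists 0%N, c%:P, 1; rewrite size_polyC_leq1 size_poly1 !coefC !rmorph1 /= !divr1 oner_neq0.
- move=> z z0; have [p [q [q0 zE]]] := frac_repr z.
  have p0 : p != 0.
    by apply: contra_neq z0 => p0; rewrite zE p0 tofrac0 mul0r.
  exists ((size q).-1%:Z - (size p).-1%:Z).
  have [a [a0 H]] := unit_eq p q p0 q0; exists a; split=> //.
  have q0' : tofrac q != 0 :> {fraction {poly k}} by rewrite tofrac_eq0.
  congr (infty_graph (_, _)): H; rewrite zE !rmorphM !rmorphXn.
  rewrite mul_div_exprzV; [reflexivity | exact: X0 | exact: q0'].
exists v; split=> // p q p0 q0 spq.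
have [a [a0 H]] := unit_eq p q p0 q0; have := vU _ _ a0 H.
have vM x z : x != 0 -> z != 0 -> v (x * z) = v x + v z.
  by case: pv => _ + _ _ _; apply.
have q0' : tofrac q != 0 :> {fraction {poly k}} by rewrite tofrac_eq0.
have -> : in_alg F (tofrac (p * 'X^((size q).-1)) / tofrac (q * 'X^((size p).-1))) =
    ratio p q * in_alg F (tofrac 'X)^-1 ^+ (size p - size q).
  rewrite -rmorphXn -rmorphM; congr (in_alg F _).
  have -> : ((size p).-1 = (size q).-1 + (size p - size q))%N.
    by rewrite -[(size q).-1]subn1 addnC addnBA ?size_poly_gt0 // subnK // subn1.
  rewrite !rmorphM !rmorphXn; rewrite mul_div_exprD; [reflexivity | exact: X0 | exact: q0'].
have r0 : ratio p q != 0.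
  by rewrite fmorph_eq0; apply: mulf_neq0; rewrite ?invr_eq0 tofrac_eq0.
have w0 : in_alg F (tofrac 'X)^-1 != 0.
  by rewrite fmorph_eq0 invr_eq0; exact: X0.
rewrite (vM _ _ r0 (expf_neq0 _ w0)) (place_powX _ pv w0).
move=> /eqP; rewrite addr_eq0 => /eqP ->.
rewrite -opprB lerN2 subzn // -[leLHS]natz.
exact: ler_wMn2r.
Qed.

End Places.

(** * Heights and degrees *)

Lemma div_mul_expr (L : fieldType) (a b u : L) m : u != 0 -> b != 0 ->
  a / (u ^+ m * b) * u ^+ m = a / b.
Proof. by move=> u0 b0; rewrite invfM (mulrC (_ ^+ _)^-1) mulrA divfK ?expf_neq0. Qed.

Section Heights.
Variables (k : closedFieldType) (F : fieldExtType {fraction {poly k}}).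

(** The degree of the polar divisor of [f] is at most [N], tested on finite sets of distinct
    places. *)
Definition poles_le (f : F) (N : nat) : Prop :=
  forall s : seq (F -> int), uniq s -> (forall v, v \in s -> place v) ->
    \sum_(v <- s) Num.max 0 (- v f) <= N%:Z.

Lemma affine_height_sum (R : realType) (n : nat) (x : 'I_n -> F) (b : R)
    (s : seq (F -> int)) : (affine_height R x <= b%:E)%E ->
  uniq s -> (forall v, v \in s -> place v) ->
  (\sum_(v <- s) \big[Num.max/0]_(i < n) - v (x i))%:~R <= b.
Proof.
move=> hb us sP; rewrite -lee_fin; apply: le_trans hb.
rewrite rmorph_sum /= -sumEFin; apply: esum.esum_ge.
exists [set` s]; last by rewrite fsbigop.fsbig_seq.
by split=> [|v /sP //]; apply: finite_seq.
Qed.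

Lemma placeN (v : F -> int) x : place v -> v (- x) = v x.
Proof.
move=> [v0 vM _ vC _]; have [->|x0] := eqVneq x 0; first by rewrite oppr0.
have N1 : (-1 : F) != 0 by rewrite oppr_eq0 oner_eq0.
rewrite -mulN1r vM //; suff -> : v (-1) = 0 by rewrite add0r.
have := vC 1; rewrite oner_neq0 => /(_ isT).
rewrite !rmorph1 scale1r => v1.
have := vM (-1) (-1) N1 N1; rewrite mulrNN mulr1 v1 => /esym/eqP.
by rewrite -mulr2n mulrn_eq0 /= => /eqP.
Qed.

(** By the ultrametric inequality, the pole order of the difference at a place is at most the sum of
    the local heights of [x] and [y]; whence the factor 2. *)
Lemma poles_leB (R : realType) (n : nat) (x y : 'I_n -> F) (b : R) N j :
  (affine_height R x <= b%:E)%E -> (affine_height R y <= b%:E)%E ->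
  b *+ 2 <= N%:R -> poles_le (x j - y j) N.
Proof.
move=> hx hy bN s us sP.
pose H (z : 'I_n -> F) (v : F -> int) := \big[Num.max/0]_(i < n) - v (z i).
have H0 z v : 0 <= H z v by apply: bigmax_ge_id.
have Hj z v : - v (z j) <= H z v.
  exact: (le_bigmax 0 (fun i => - v (z i)) j).
have le_v v : place v -> Num.max 0 (- v (x j - y j)) <= H x v + H y v.
  move=> pv; rewrite ge_max addr_ge0 //=.
  case: (pv) => v0 _ vA _ _.
  have [->|xy0] := eqVneq (x j - y j) 0; first by rewrite v0 oppr0 addr_ge0.
  have le_yH : - v (- y j) <= H x v + H y v by rewrite placeN // ler_wpDl.
  have le_xH : - v (x j) <= H x v + H y v by rewrite ler_wpDr.
  have [x0|x0] := eqVneq (x j) 0; first by rewrite x0 sub0r.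
  have [y0|y0] := eqVneq (y j) 0; first by rewrite y0 subr0.
  have := vA (x j) (- y j) x0; rewrite oppr_eq0 => /(_ y0 xy0).
  rewrite ge_min => /orP[] h; [apply: le_trans le_xH|apply: le_trans le_yH];
    by rewrite lerN2.
rewrite -(ler_int R).
apply: (@le_trans _ _ ((\sum_(v <- s) H x v)%:~R + (\sum_(v <- s) H y v)%:~R)).
  rewrite -rmorphD ler_int /= -big_split /= big_seq [leRHS]big_seq.
  by apply: ler_sum => v /sP /le_v.
apply: le_trans bN; rewrite mulr2n; apply: lerD; exact: affine_height_sum.
Qed.

Lemma poles_le_prod (phi : F) (I : finType) (f : I -> F) N (s : seq (F -> int)) :
  (forall i, f i != 0) -> (forall i, poles_le (f i) N) -> phi = \prod_i f i ->
  uniq s -> (forall v, v \in s -> place v) ->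
  \sum_(v <- s) - v phi <= (#|I| * N)%N%:Z.
Proof.
move=> f0 fN -> us sP.
apply: (@le_trans _ _ (\sum_(v <- s) \sum_i Num.max 0 (- v (f i)))).
  rewrite big_seq [leRHS]big_seq; apply: ler_sum => v /sP pv.
  rewrite place_prod // -sumrN; apply: ler_sum => i _.
  by rewrite le_max lexx orbT.
rewrite exchange_big /=; apply: (@le_trans _ _ (\sum_(i : I) N%:Z)).
  by apply: ler_sum => i _; apply: fN.
by rewrite sumr_const -mulr_natl PoszM natz.
Qed.

(** In lowest terms, each root of [q] is a pole of [phi] of at least the same multiplicity, which
    bounds deg q by #|I| * N. A place above infinity bounds deg p - deg q by the same number, so deg
    p is at most twice that. *)
Lemma degree_bound (phi : {fraction {poly k}}) (I : finType) (f : I -> F) N :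
  (forall i, f i != 0) -> (forall i, poles_le (f i) N) ->
  in_alg F phi = \prod_i f i ->
  exists p q : {poly k}, [/\ q != 0, phi = tofrac p / tofrac q,
    (size q <= (#|I| * N).+1)%N & (size p <= (#|I| * N + #|I| * N).+1)%N].
Proof.
move=> f0 fN phiE; have poles := poles_le_prod f0 fN phiE.
have phi0 : phi != 0.
  suff : in_alg F phi != 0 by apply: contra_neq => ->; rewrite rmorph0; reflexivity.
  rewrite phiE.
  by apply: (big_ind (fun x => x != 0)); [apply: oner_neq0|apply: mulf_neq0|move=> ? _; apply: f0].
have [p0 [q0 [q00 phiE0]]] := frac_repr phi.
pose d := gcdp p0 q0; have d0 : d != 0 by rewrite gcdp_eq0 negb_and q00 orbT.
pose p := p0 %/ d; pose q := q0 %/ d.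
have p0E : p0 = p * d by rewrite divpK // dvdp_gcdl.
have q0E : q0 = q * d by rewrite divpK // dvdp_gcdr.
have qn0 : q != 0 by apply: contra_neq q00 => qe; rewrite q0E qe mul0r.
have cpq : coprimep p q by rewrite coprimep_div_gcd ?q00 ?orbT.
have tq0 : tofrac q != 0 :> {fraction {poly k}} by rewrite tofrac_eq0.
have td0 : tofrac d != 0 :> {fraction {poly k}} by rewrite tofrac_eq0.
have phiE1 : phi = tofrac p / tofrac q.
  rewrite phiE0 p0E q0E !tofracM -mulf_div mulfV; last exact: td0.
  by rewrite mulr1; reflexivity.
have pn0 : p != 0.
  by apply: contra_neq phi0 => pe; rewrite phiE1 pe tofrac0 mul0r; reflexivity.
have [V VP] := choice (@place_at k F).
have sq : (size q <= (#|I| * N).+1)%N.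
  have [rs qE] := closed_field_poly_normal q.
  have lq0 : lead_coef q != 0 by rewrite lead_coef_eq0.
  have szq : size q = (size rs).+1 by rewrite qE size_scale // size_prod_XsubC.
  (* One place is taken above each distinct root of [q]. These places differ, since ['X - c%:P] has
     positive value at the one above [c] and value 0 at the others. *)
  rewrite szq ltnS -lez_nat; apply: le_trans (poles (map V (undup rs)) _ _).
  - rewrite -sum1_size -big_undup_iterop_count /= big_map.
    have -> : (\sum_(i <- undup rs) iterop (count_mem i rs) addn 1 0)%N%:Z =
       \sum_(i <- undup rs) (count_mem i rs)%:Z.
      rewrite (big_morph Posz PoszD (erefl _)); apply: eq_bigr => i _; congr Posz.
      by elim: (count_mem i rs) => // m IH; rewrite iteropS -[RHS]addn1; elim: m {IH} => //= m ->.
    rewrite big_seq [leRHS]big_seq; apply: ler_sum => c; rewrite mem_undup => crs.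
    pose q1 := lead_coef q *: \prod_(z <- rs | z != c) ('X - z%:P).
    pose m := count_mem c rs.
    have qE1 : q = ('X - c%:P) ^+ m * q1.
      rewrite {1}qE (bigID (pred1 c)) /= -scalerAr; congr (_ *: (_ * _)).
      rewrite (eq_bigr (fun=> 'X - c%:P)) => [|i /eqP -> //].
      by rewrite big_const_seq /m; elim: (count _ _) => //= j ->; rewrite exprS.
    have m0 : (0 < m)%N by rewrite -has_count has_pred1.
    have q1c : q1.[c] != 0.
      rewrite hornerZ mulf_neq0 // horner_prod prodf_seq_neq0.
      by apply/allP => z _; rewrite hornerXsubC subr_eq0 eq_sym; apply/implyP.
    have pc : p.[c] != 0.
      apply: (coprimep_root (p := q)); first by rewrite coprimep_sym.
      by rewrite qE1 /root hornerM horner_exp hornerXsubC subrr expr0n -leqn0 leqNgt m0 mul0r.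
    have [pV yV uV] := VP c; case: (pV) => _ vM _ _ _.
    have X0 : in_alg F (tofrac ('X - c%:P)) != 0.
      by rewrite fmorph_eq0 tofrac_eq0 polyXsubC_eq0.
    have phiF0 : in_alg F phi != 0 by rewrite fmorph_eq0; exact: phi0.
    have := uV p q1 pc q1c.
    have -> : tofrac p / tofrac q1 = phi * tofrac ('X - c%:P) ^+ m.
      have tX0 : tofrac ('X - c%:P) != 0 :> {fraction {poly k}}.
        by rewrite tofrac_eq0 polyXsubC_eq0.
      have tq1 : tofrac q1 != 0 :> {fraction {poly k}}.
        by rewrite tofrac_eq0; apply: contra_neq q1c => ->; rewrite horner0.
      rewrite phiE1 qE1 tofracM tofracXn.
      by rewrite (div_mul_expr _ _ tX0 tq1); reflexivity.
    rewrite rmorphM rmorphXn (vM _ _ phiF0 (expf_neq0 _ X0)) (place_powX _ pV X0).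
    move=> /eqP; rewrite addr_eq0 => /eqP ->; rewrite opprK -/m -[leLHS]natz.
    exact: ler_wMn2r.
  - rewrite map_inj_uniq ?undup_uniq // => c c' Vcc'; apply/eqP/negPn/negP => cc'.
    have [_ yV _] := VP c; have [_ _ uV] := VP c'.
    have := uV ('X - c%:P) 1; rewrite hornerXsubC hornerC subr_eq0 eq_sym cc' oner_neq0.
    move=> /(_ isT isT); rewrite tofrac1 divr1 -Vcc' => VE.
    by rewrite VE in yV.
  - by move=> v /mapP[c _ ->]; have [] := VP c.
exists p, q; split; [exact: qn0|exact: phiE1|exact: sq|].
(* The place above infinity is needed when [p] has the larger degree. *)
have [spq|/ltnW spq] := leqP (size p) (size q).
  by rewrite (leq_trans spq) // (leq_trans sq) // ltnS leq_addr.
have [v [pv vP]] := @place_at_infty k F.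
have := vP p q pn0 qn0 spq; rewrite -phiE1.
have := poles [:: v] isT; rewrite big_seq1 => H1 H2.
have {}H1 : - v (in_alg F phi) <= (#|I| * N)%N%:Z.
  by apply: H1 => w; rewrite inE => /eqP ->.
have : (size p)%:Z <= (#|I| * N + size q)%N%:Z.
  rewrite PoszD -lerBlDr; apply: le_trans H1; rewrite lerNr opprB.
  exact: H2.
rewrite lez_nat => H3; rewrite (leq_trans H3) // -addnS leq_add2l; exact: sq.
Qed.

End Heights.

(** * Iterated polynomial rings *)

Section Strip.
Variable D : idomainType.
Implicit Types (W : {poly {poly D}}) (c : D).

Local Notation sp c := (map_poly (horner_eval c)).

(** If all coefficients vanish at [c], then ['X - c%:P] divides all of them. This can happen only
    finitely often, since each division lowers the degree of the leading coefficient. *)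
Lemma strip_XsubC W c : W != 0 ->
  exists r W', [/\ W = (('X - c%:P) ^+ r)%:P * W', sp c W' != 0 &
    (size W' <= size W)%N].
Proof.
have [n] := ubnP (size (lead_coef W)); elim: n W => // n IH W /ltnSE lW W0.
have [sW|sW] := eqVneq (sp c W) 0; last first.
  by exists 0%N, W; rewrite expr0 mul1r.
have /choice[f fP] i : exists q, W`_i = q * ('X - c%:P).
  apply/factor_theorem; rewrite /root -[_.[c]]/(horner_eval c W`_i).
  by rewrite -coef_map sW coef0.
pose W1 := \poly_(i < size W) f i.
have WE : W = ('X - c%:P)%:P * W1.
  apply/polyP => i; rewrite coefCM coef_poly; case: ltnP => iW.
    by rewrite fP mulrC.
  by rewrite mulr0 nth_default.
have W10 : W1 != 0 by apply: contra_neq W0 => W10; rewrite WE W10 mulr0.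
have sW1 : size W1 = size W.
  by rewrite WE mul_polyC size_scale // polyXsubC_eq0.
have [|r [W' [W1E W'0 sW']]] := IH W1 _ W10.
  rewrite (leq_trans _ lW) // WE lead_coefM lead_coefC.
  rewrite size_proper_mul ?size_XsubC //.
  by rewrite lead_coefXsubC mul1r lead_coef_eq0 lead_coef_eq0.
exists r.+1, W'; split=> //; last by rewrite -sW1.
by rewrite {1}WE {1}W1E mulrA -polyCM -exprS.
Qed.

(** The relation survives the specialization of the inner variable at [c]: after powers of ['X - c]
    are removed from [w] and [u], the leftover power is trivial, because one side specializes to a
    nonzero product. *)
Lemma strip_rel (A1 A2 w u : {poly {poly D}}) c :
  sp c A1 != 0 -> sp c A2 != 0 -> w != 0 -> u != 0 -> A1 * w = A2 * u ->
  exists w' u' : {poly D}, [/\ w' != 0, u' != 0, (size w' <= size w)%N,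
    (size u' <= size u)%N & sp c A1 * w' = sp c A2 * u'].
Proof.
move=> A10 A20 /(strip_XsubC c)[r [w' [wE w'0 sw]]].
move=> /(strip_XsubC c)[s [u' [uE u'0 su]]].
wlog rs : A1 A2 w u w' u' r s A10 A20 w'0 u'0 wE uE sw su / (r <= s)%N.
  move=> H E; case/orP: (leq_total r s) => rs; first exact: (H A1 A2 w u w' u' r s).
  have [x [y [x0 y0 sx sy xyE]]] := H A2 A1 u w u' w' s r A20 A10 u'0 w'0 uE wE su sw rs (esym E).
  by exists y, x.
move=> E.
have Xr0 : (('X - c%:P) ^+ r)%:P != 0 :> {poly {poly D}}.
  by rewrite polyC_eq0 expf_neq0 // polyXsubC_eq0.
have {}E : A1 * w' = A2 * ((('X - c%:P) ^+ (s - r))%:P * u').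
  apply: (mulfI Xr0); rewrite mulrCA -wE E uE [RHS]mulrCA; congr (_ * _).
  by rewrite mulrA -polyCM -exprD subnKC.
exists (sp c w'), (sp c u'); split=> //.
- by rewrite (leq_trans (size_poly _ _)).
- by rewrite (leq_trans (size_poly _ _)).
have := congr1 (sp c) E; rewrite !rmorphM /= map_polyC /= /horner_eval.
rewrite horner_exp hornerXsubC subrr => spE.
move: spE; case: (s - r)%N => [|j]; first by rewrite expr0 polyC1 mul1r.
rewrite expr0n polyC0 mul0r mulr0 => /eqP; rewrite mulf_eq0.
by rewrite (negPf A10) (negPf w'0).
Qed.

End Strip.

Section Tower.
Variable C : fieldType.

(* The variable of index e is the outermost one of [tower e.+1]. *)
Fixpoint tower (d : nat) : idomainType :=
  if d is e.+1 then {poly tower e} else C.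

Definition horner_step (D S : comNzRingType) (g : {rmorphism D -> S}) (x : S) :
    {rmorphism {poly D} -> S} := horner_eval x \o map_poly g.

Fixpoint tower_eval (d : nat) (S : comNzRingType) (f : {rmorphism C -> S})
    (t : nat -> S) : {rmorphism tower d -> S} :=
  if d is e.+1 then horner_step (tower_eval e f t) (t e) else f.

Fixpoint tower_const (d : nat) : {rmorphism C -> tower d} :=
  if d is e.+1 then @polyC (tower e) \o tower_const e else idfun.

Fixpoint tower_var (d : nat) (j : nat) : tower d :=
  if d is e.+1 return tower d then
    if j == e then 'X else (tower_var e j)%:P else 0.

Lemma tower_evalS d S f t (p : {poly tower d}) :
  @tower_eval d.+1 S f t p = (map_poly (tower_eval d f t) p).[t d].
Proof. by []. Qed.

(** Uniqueness in the universal property of polynomial rings; the substitution identities below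
    reduce to it by comparing values on constants and variables. *)
Lemma tower_eval_comp d (S S' : comNzRingType) (g : {rmorphism S -> S'})
    (f : {rmorphism C -> S}) (t : nat -> S) (f' : {rmorphism C -> S'}) (t' : nat -> S') :
  (forall c, g (f c) = f' c) -> (forall j, (j < d)%N -> g (t j) = t' j) ->
  forall p, g (tower_eval d f t p) = tower_eval d f' t' p.
Proof.
move=> gf; elim: d => [|d IH] gt p; first exact: gf.
rewrite !tower_evalS -horner_map /= gt // -map_poly_comp; congr horner.
by apply: eq_map_poly => a /=; apply: IH => j jd; apply: gt; rewrite ltnS ltnW.
Qed.

Lemma tower_eval_const d S f t c : @tower_eval d S f t (tower_const d c) = f c.
Proof.
by elim: d => [//|d IH]; rewrite tower_evalS /= map_polyC hornerC.
Qed.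

Lemma tower_eval_var d S f t j : (j < d)%N ->
  @tower_eval d S f t (tower_var d j) = t j.
Proof.
elim: d => [//|d IH]; rewrite ltnS leq_eqVlt tower_evalS /=.
have [->|jd] := eqVneq j d; first by rewrite map_polyX hornerX.
by move=> /= /IH <-; rewrite map_polyC hornerC.
Qed.

Lemma tower_eval_id d p : tower_eval d (tower_const d) (tower_var d) p = p.
Proof.
elim: d p => [//|d IH] p; rewrite tower_evalS /= eqxx.
rewrite -[RHS]comp_polyXr /comp_poly; congr horner; apply: eq_map_poly => a.
rewrite -[in RHS](IH a); apply/esym/tower_eval_comp => //= j jd.
by rewrite (ltn_eqF jd).
Qed.

(* The polynomial as a polynomial in the variable of index i. *)
Definition tower_sub (d i : nat) : {rmorphism tower d -> {poly tower d}} :=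
  tower_eval d (@polyC (tower d) \o tower_const d)
    (fun j => if j == i then 'X else (tower_var d j)%:P).

Lemma tower_subK d i p : (tower_sub d i p).[tower_var d i] = p.
Proof.
rewrite -[RHS]tower_eval_id -[LHS]/(horner_eval _ _).
apply: tower_eval_comp => [c|j jd] /=; rewrite /horner_eval ?hornerC //.
by have [->|_] := eqVneq j i; rewrite ?hornerX ?hornerC.
Qed.

Lemma tower_sub_inj d i : injective (tower_sub d i).
Proof. by move=> p q pq; rewrite -[p](tower_subK i) pq tower_subK. Qed.

Lemma tower_sub_last d (p : {poly tower d}) :
  tower_sub d.+1 d p = map_poly polyC p.
Proof.
rewrite /tower_sub tower_evalS eqxx.
rewrite -[RHS]comp_polyXr /comp_poly -map_poly_comp; congr horner.
apply: eq_map_poly => a /=.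
rewrite -[in RHS](tower_eval_id (d := d) a); apply/esym.
apply: (tower_eval_comp (g := polyC \o polyC)) => //= j jd.
by rewrite (ltn_eqF jd).
Qed.

(** Both sides are evaluations of [p] with the same values on constants and variables. *)
Lemma tower_sub_horner d i (p : {poly tower d}) (c : C) : (i < d)%N ->
  map_poly (horner_eval (tower_const d c)) (tower_sub d.+1 i p) =
  tower_sub d i p.[tower_const d c].
Proof.
move=> id; pose g : {rmorphism tower d.+1 -> tower d} := horner_eval (tower_const d c).
rewrite -[p.[_]]/(g p) -[in RHS](tower_eval_id (d := d.+1) p).
rewrite (tower_eval_comp (g := g) (f' := tower_const d)
  (t' := fun j => if j == d then tower_const d c else tower_var d j)); last first.
- move=> j _ /=; rewrite /g /= /horner_eval.
  by case: eqP => _; rewrite ?hornerX ?hornerC.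
- by move=> a; rewrite /g /= /horner_eval hornerC.
pose h : nat -> {poly tower d} := fun j => if j == d then (tower_const d c)%:P
  else if j == i then 'X else (tower_var d j)%:P.
rewrite (tower_eval_comp (g := tower_sub d i) (f' := polyC \o tower_const d) (t' := h)).
- rewrite /tower_sub.
  apply: (tower_eval_comp (g := map_poly g)) => [a|j jd] /=.
    by rewrite map_polyC /= /horner_eval hornerC.
  rewrite /h; have [->|ji] := eqVneq j i.
    by rewrite map_polyX (ltn_eqF id).
  rewrite map_polyC /= /horner_eval; case: eqP => _; by rewrite ?hornerX ?hornerC.
- by move=> a; rewrite /tower_sub tower_eval_const.
- move=> j jd; rewrite /h; case: eqP => [_|/eqP jd'].
    by rewrite /tower_sub tower_eval_const.
  by rewrite /tower_sub tower_eval_var // ltn_neqAle jd' -ltnS.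
Qed.

End Tower.

(** * Values at the points of a grid *)

Section CompGraph.
Variables (L M : fieldType) (W : comPzRingType).

Definition comp_graph (G : set (L * M)) (H : set (M * W)) : set (L * W) :=
  [set z | exists2 y, G (z.1, y) & H (y, z.2)].

Lemma comp_graph_hom (G : set (L * M)) (H : set (M * W)) :
  partial_hom G -> partial_hom H -> partial_hom (comp_graph G H).
Proof.
move=> hG hH; split.
- by exists 1; apply: partial_hom1.
- move=> x a z b [y /= xy ya] [y' /= zy' y'b]; exists (y - y') => /=.
    exact: partial_homB.
  exact: partial_homB.
- move=> x a z b [y /= xy ya] [y' /= zy' y'b]; exists (y * y') => /=.
    exact: partial_homM.
  exact: partial_homM.
- move=> a [y /= /(partial_hom_eq0 hG) ->]; exact: partial_hom_eq0.
Qed.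

End CompGraph.

Lemma tofrac_inj (B : idomainType) : injective (@tofrac B).
Proof. by move=> x y /eqP; rewrite tofrac_eq => /eqP. Qed.

Section Flag.
Variable C : fieldType.

(* The specialization of the rational functions in d variables obtained by
   specializing the variables one after the other, from the outermost one, at
   the point tau: it is also defined at some functions p / q such that p and q
   both vanish at tau. *)
Fixpoint flag (d : nat) (tau : nat -> C) : set ({fraction tower C d} * C) :=
  if d is e.+1 return set ({fraction tower C d} * C) then
    comp_graph (loc_graph (@tofrac {poly tower C e})
      (@tofrac (tower C e) \o horner_eval (tower_const C e (tau e))))
      (@flag e tau)
  else loc_graph (@tofrac C) idfun.
Arguments flag : clear implicits.

Lemma flag_hom d tau : partial_hom (flag d tau).
Proof.
elim: d => [|d IH] /=; first exact: (loc_graph_hom idfun (@tofrac_inj C)).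
apply: comp_graph_hom; last exact: IH.
apply: loc_graph_hom; exact: tofrac_inj.
Qed.

Lemma flag_ext d tau tau' : (forall j, (j < d)%N -> tau j = tau' j) ->
  flag d tau = flag d tau'.
Proof.
elim: d => [//|d IH] tt' /=; rewrite tt' // IH // => j jd.
by apply: tt'; rewrite ltnS ltnW.
Qed.

Lemma flag_cst d tau c : flag d tau (tofrac (tower_const C d c), c).
Proof.
elim: d => [|d IH] /=; first exact: (loc_graph_base (@tofrac C) idfun).
exists (tofrac (tower_const C d c)) => //=.
have := loc_graph_base (@tofrac {poly tower C d})
  (@tofrac (tower C d) \o horner_eval (tower_const C d (tau d))) (tower_const C d c)%:P.
by rewrite /= /horner_eval hornerC.
Qed.

(** Where the denominator does not vanish, specializing the variables one by one agrees with plain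
    evaluation. *)
Lemma flag_ratio d tau p q : tower_eval d idfun tau q != 0 ->
  flag d tau (tofrac p / tofrac q,
    tower_eval d idfun tau p / tower_eval d idfun tau q).
Proof.
elim: d p q => [|d IH] p q /= q0; first by exists p, q.
have ev (r : {poly tower C d}) : tower_eval d idfun tau r.[tower_const C d (tau d)] =
    (map_poly (tower_eval d idfun tau) r).[tau d].
  by rewrite -horner_map /= tower_eval_const.
rewrite /horner_eval -!ev in q0 *.
exists (tofrac p.[tower_const C d (tau d)] / tofrac q.[tower_const C d (tau d)]).
  exists p, q; split=> //=; rewrite tofrac_eq0.
  by apply: contra_neq q0 => q0; rewrite /horner_eval in q0; rewrite q0 rmorph0.
exact: IH.
Qed.

(** As a rational function of the variable [i], [P / Q] equals [u / w] with numerator and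
    denominator of degree less than [B]. The degrees of [P] and [Q] themselves are left free. *)
Definition degree_le (d i B : nat) (P Q : tower C d) : Prop :=
  exists u w : {poly tower C d}, [/\ u != 0, w != 0, (size u <= B)%N, (size w <= B)%N &
    tower_sub C d i P * w = tower_sub C d i Q * u].

(** In characteristic zero the integers provide more candidates than the nonzero polynomial [h] has
    roots; [h] excludes both the roots of [g] and the values already chosen. *)
Lemma many_values (hC : [pchar C] =i pred0) (D : idomainType) (f : {rmorphism C -> D})
    (g : {poly D}) n : g != 0 ->
  exists s : seq C, [/\ uniq s, size s = n & forall c, c \in s -> g.[f c] != 0].
Proof.
move=> g0; elim: n => [|n [s [us ss sg]]]; first by exists [::].
pose h := g * \prod_(c <- s) ('X - (f c)%:P).
have h0 : h != 0.
  by rewrite mulf_neq0 // monic_neq0 // monic_prod_XsubC.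
pose ts := mkseq (fun i => f i%:R) (size h).
have natC_inj : injective (fun i => i%:R : C).
  move=> i j; wlog ij : i j / (i <= j)%N => [H|].
    by case/orP: (leq_total i j) => ij e; [apply: H|apply/esym/H].
  move=> /esym/eqP; rewrite -subr_eq0 -natrB // (iffLR (pcharf0P _) hC).
  rewrite subn_eq0 => ji; apply/eqP; by rewrite eqn_leq ij.
have f_inj : injective f := fmorph_inj f.
have uts : uniq ts.
  by apply/mkseq_uniqP => i j _ _ /f_inj /natC_inj.
have [c cts hc] : exists2 c, c \in [seq i%:R : C | i <- iota 0 (size h)] & h.[f c] != 0.
  apply: contrapT => noc; have : all (root h) ts.
    apply/allP => _ /mapP[i ih ->]; apply/negPn/negP => hi; apply: noc.
    by exists i%:R => //; apply/mapP; exists i.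
  by move=> /(max_poly_roots h0)/(_ uts); rewrite size_mkseq ltnn.
exists (c :: s); move: hc; rewrite hornerM mulf_eq0 negb_or => /andP[gc sc].
split=> [|/=|c']; last by rewrite in_cons => /orP[/eqP ->|/sg].
  rewrite /= us andbT; apply: contra sc => cs; rewrite horner_prod.
  by rewrite (big_rem c) //= hornerXsubC subrr mul0r.
by rewrite ss.
Qed.

(** The grid depends on [g] and [B] only. By induction, a value [c] of the outermost variable is
    found at which [P] and [Q] vanish to the same order; the common power of ['X - c] is divided
    out, and the quotient at [c] inherits the degree bounds in the other variables. *)
Lemma grid (hC : [pchar C] =i pred0) d (g : tower C d) B : g != 0 ->
  exists s : seq (nat -> C), forall P Q : tower C d, P != 0 -> Q != 0 ->
    (forall i, (i < d)%N -> degree_le i B P Q) ->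
    exists tau, [/\ tau \in s, tower_eval d idfun tau g != 0 &
      exists2 a, a != 0 & flag d tau (tofrac P / tofrac Q, a)].
Proof.
elim: d g => [|d IH] g g0.
  exists [:: fun=> 0] => P Q P0 Q0 _; exists (fun=> 0).
  split=> //; first by rewrite mem_head.
  by exists (P / Q); [rewrite mulf_neq0 ?invr_eq0 | exists P, Q].
(* For [u] and [w] of size at most [B], the product [w * u] has fewer than [B + B] roots. *)
have [cs [ucs scs csP]] := many_values hC (tower_const C d) (B + B) g0.
have /choice[S SP] c : exists s : seq (nat -> C), c \in cs ->
    forall P Q : tower C d, P != 0 -> Q != 0 ->
    (forall i, (i < d)%N -> degree_le i B P Q) ->
    exists tau, [/\ tau \in s, tower_eval d idfun tau g.[tower_const C d c] != 0 &
      exists2 a, a != 0 & flag d tau (tofrac P / tofrac Q, a)].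
  have [/csP gc|_] := boolP (c \in cs); last by exists [::].
  by have [s sP] := IH _ gc; exists s.
pose ext (c : C) (tau : nat -> C) j := if j == d then c else tau j.
exists [seq ext c tau | c <- cs, tau <- S c] => P Q P0 Q0 PQ.
(* The relation given by [degree_le] has coefficients that may still involve a second copy of the
   outermost variable; [strip_rel] sets this copy to 0. *)
have [w [u [w0 u0 wB uB Pwu]]] : exists w u : {poly tower C d},
    [/\ w != 0, u != 0, (size w <= B)%N, (size u <= B)%N & P * w = Q * u].
  have [u [w [u0 w0 uB wB]]] := PQ d (ltnSn d); rewrite !tower_sub_last => uw.
  have spK (p : {poly tower C d}) : map_poly (horner_eval 0) (map_poly polyC p) = p.
    rewrite -map_poly_comp map_poly_id // => a _.
    by rewrite /= /horner_eval hornerC.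
  have [||w' [u' [w'0 u'0 w'w u'u E]]] := strip_rel (c := 0) _ _ w0 u0 uw.
  - by rewrite spK.
  - by rewrite spK.
  by exists w', u'; rewrite !spK in E; rewrite (leq_trans w'w) // (leq_trans u'u).
have [c ccs] : exists2 c, c \in cs & (w * u).[tower_const C d c] != 0.
  apply: contrapT => noc; have wu0 : w * u != 0 by rewrite mulf_neq0.
  have : all (root (w * u)) (map (tower_const C d) cs).
    apply/allP => _ /mapP[c ccs ->]; apply/negPn/negP => wuc; apply: noc.
    by exists c.
  move=> /(max_poly_roots wu0); rewrite map_inj_uniq; last exact: fmorph_inj.
  move=> /(_ ucs); rewrite size_map scs ltnNge => /negP; apply.
  rewrite (leq_trans (size_polyMleq _ _)) // (leq_trans (leq_pred _)) //.
  by rewrite leq_add.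
rewrite hornerM mulf_eq0 negb_or => /andP[wc uc].
pose c' := tower_const C d c; rewrite -/c' in wc uc.
have [r [P1 + PE]] := multiplicity_XsubC P c'.
have [s [Q1 + QE]] := multiplicity_XsubC Q c'.
rewrite P0 Q0 /= /root => Q1c P1c.
have X0 : 'X - c'%:P != 0 by rewrite polyXsubC_eq0.
(* In [P * w = Q * u] neither [w] nor [u] vanishes at [c], so [P] and [Q] have the same order of
   vanishing there. *)
have rs : r = s.
  have nroot (p q v x : {poly tower C d}) j : v.[c'] != 0 -> p.[c'] != 0 ->
      p * v = q * ('X - c'%:P) ^+ j * x -> j = 0%N.
    move=> vc pc /(congr1 (horner_eval c')); rewrite /horner_eval.
    case: j => // j; rewrite !hornerM horner_exp hornerXsubC subrr expr0n.
    by rewrite mulr0 mul0r => /eqP; rewrite mulf_eq0 (negPf vc) (negPf pc).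
  have E : P1 * ('X - c'%:P) ^+ r * w = Q1 * ('X - c'%:P) ^+ s * u by rewrite -PE -QE.
  apply/eqP; rewrite eqn_leq -!subn_eq0; apply/andP; split; apply/eqP.
    case/orP: (leq_total r s) => [|sr]; first by move/eqP.
    apply: (nroot Q1 P1 u w) => //; apply: (mulfI (expf_neq0 s X0)).
    rewrite mulrA (mulrC _ Q1) -E -{1}(subnKC sr) exprD; ring.
  case/orP: (leq_total r s) => [rs|]; last by move/eqP.
  apply: (nroot P1 Q1 w u) => //; apply: (mulfI (expf_neq0 r X0)).
  rewrite mulrA (mulrC _ P1) E -{1}(subnKC rs) exprD; ring.
rewrite -{}rs {s} in QE.
(* The relation in the variable [i] is first divided by the common power of ['X - c], then
   specialized at [c] by [strip_rel]. *)
have degc i : (i < d)%N -> degree_le i B P1.[c'] Q1.[c'].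
  move=> id; have [u1 [w1 [u10 w10 u1B w1B E]]] := PQ i (leqW id).
  have nz (p : {poly tower C d}) : p.[c'] != 0 ->
      map_poly (horner_eval c') (tower_sub C d.+1 i p) != 0.
    rewrite tower_sub_horner //; apply: contra_neq => /eqP.
    by rewrite -(rmorph0 (tower_sub C d i)) (inj_eq (@tower_sub_inj _ _ _)) => /eqP.
  have E1 : tower_sub C d.+1 i P1 * w1 = tower_sub C d.+1 i Q1 * u1.
    have S0 : tower_sub C d.+1 i (('X - c'%:P) ^+ r) != 0.
      rewrite -(rmorph0 (tower_sub C d.+1 i)) (inj_eq (@tower_sub_inj _ _ _)).
      exact: expf_neq0.
    apply: (mulfI S0); rewrite !mulrA -!rmorphM /= ![_ ^+ r * _]mulrC.
    by rewrite -PE -QE.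
  have [||w' [u' [w'0 u'0 w'w u'u]]] := strip_rel (c := c') _ _ w10 u10 E1.
  - exact: nz.
  - exact: nz.
  rewrite !tower_sub_horner // => E2; exists u', w'.
  by rewrite (leq_trans w'w) // (leq_trans u'u).
have [tau [tauS gtau [a a0 fa]]] := SP c ccs _ _ P1c Q1c degc.
exists (ext c tau); have ext_d : ext c tau d = c by rewrite /ext eqxx.
have ext_lt j : (j < d)%N -> ext c tau j = tau j by move=> jd; rewrite /ext (ltn_eqF jd).
split.
- by apply/allpairsPdep; exists c, tau.
- rewrite [X in X != 0](_ : _ = tower_eval d idfun tau g.[c']) //.
  rewrite [LHS]tower_evalS ext_d -[RHS]horner_map /= tower_eval_const.
  congr horner.
  by apply: eq_map_poly => p; apply: (tower_eval_comp (g := idfun)).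
exists a => //=; exists (tofrac P1.[c'] / tofrac Q1.[c']) => /=.
  exists P1, Q1; rewrite ext_d; split=> //=; first by rewrite tofrac_eq0.
  rewrite PE QE !tofracM -mulf_div mulfV ?mulr1 // tofrac_eq0.
  exact: expf_neq0.
by rewrite (flag_ext ext_lt).
Qed.

End Flag.
Arguments flag {C} d tau _.

(** * Field extensions *)

Lemma partial_hom_total (L W : comPzRingType) (G : set (L * W)) :
  partial_hom G -> (forall x, exists a, G (x, a)) ->
  {f : {rmorphism L -> W} | forall x, G (x, f x)}.
Proof.
move=> hG tG; have /all_sig[f fG] : forall x, {a | G (x, a)}.
  by move=> x; apply: cid.
have [||g gE] := @rmorph_of _ _ f.
- by move=> x y; apply: (partial_hom_inj hG (fG _)); apply: partial_homB.
- split; first by apply: (partial_hom_inj hG (fG _)); apply: partial_hom1.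
  by move=> x y; apply: (partial_hom_inj hG (fG _)); apply: partial_homM.
by exists g => x; rewrite gE.
Qed.

(** Extend the given map on the image of [O] to a place of [algC]. Rational numbers are finite at
    it, since [W] has characteristic zero, and algebraic numbers are integral over them, so the
    place is an embedding. *)
Lemma algC_embedding (O : comNzRingType) (W : closedFieldType)
    (iota : {rmorphism O -> algC}) (e : {rmorphism O -> W}) :
  [pchar W] =i pred0 -> injective iota ->
  exists psi : {rmorphism algC -> W}, forall o, psi (iota o) = e o.
Proof.
move=> W0 iota_inj; pose G0 : set (algC * W) := [set z | exists2 o, z.1 = iota o & z.2 = e o].
have hG0 : partial_hom G0.
  split.
  - by exists 1; rewrite rmorph1.
  - by move=> _ _ _ _ [o /= -> ->] [o' /= -> ->]; exists (o - o'); rewrite rmorphB.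
  - by move=> _ _ _ _ [o /= -> ->] [o' /= -> ->]; exists (o * o'); rewrite rmorphM.
  - by move=> a [o /= /esym/eqP]; rewrite -(rmorph0 iota) (inj_eq iota_inj) => /eqP -> ->;
      rewrite rmorph0.
have [G [G0G hG vG]] := place_extension hG0.
have Gnat n : G (n%:R, n%:R).
  elim: n => [|n IH]; first exact: partial_hom0.
  by rewrite -!natr1; apply: partial_homD => //; apply: partial_hom1.
have Gint (z : int) : exists a, G (z%:~R, a).
  case: z => n; first by exists n%:R; apply: Gnat.
  by exists (- n.+1%:R); rewrite NegzE mulrNz; apply: partial_homN => //; apply: Gnat.
have Grat (q : rat) : exists a, G (ratr q, a).
  rewrite /ratr; apply: (partial_hom_domM hG); first exact: Gint.
  have := denq_gt0 q; case: (denq q) => // m m0.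
  exists (m%:R^-1); apply: (valuative_inv hG vG); first exact: Gnat.
  by rewrite (iffLR (pcharf0P _) W0); case: m m0.
have [|psi psiG] := partial_hom_total hG.
  move=> x; have [p [_ pm] pP] := minCpolyP x.
  apply: (valuative_integral hG vG (p := map_poly ratr p)).
  - by rewrite map_monic.
  - by move=> i; rewrite coef_map; apply: Grat.
  - by rewrite pP.
exists psi => o; apply: (partial_hom_inj hG (psiG _)).
by apply: G0G; exists o.
Qed.

(** The injection [c] makes [F] a countable field, for which the closure is constructed. *)
Lemma algebraic_closure (F : fieldType) (T : countType) (c : F -> T) :
  injective c -> exists W : closedFieldType, inhabited {rmorphism F -> W}.
Proof.
move=> c_inj; have /all_sig[c' cK] : forall t, {x : option F | forall y, c y = t -> x = Some y}.
  move=> t; apply: cid; have [[y <-]|no] := pselect (exists y, c y = t).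
    by exists (Some y) => z /c_inj ->.
  by exists None => y yt; case: no; exists y.
have pK : pcancel c c' by move=> x; apply: cK.
pose F' : countFieldType := HB.pack F (PCanIsCountable pK).
have [W [e _]] := countable_algebraic_closure F'.
by exists W; split; exact: e.
Qed.

Section FieldExtensions.
Variables (E : fieldType) (W : closedFieldType) (e : {rmorphism E -> W}).
Hypothesis E0 : [pchar E] =i pred0.

(** The generator is an integral linear combination of the given elements. The clause on [S] records
    this and later shows that the generator lies in the field generated by the roots. *)
Lemma primitive_element (s : seq W) : (forall x, x \in s -> algebraicOver e x) ->
  exists z, [/\ algebraicOver e z,
    forall S : set W, S 0 -> (forall x y, S x -> S y -> S (x - y)) ->
      (forall x, x \in s -> S x) -> S z &
    forall x, x \in s -> exists p, (map_poly e p).[z] = x].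
Proof.
elim: s => [_|x s IH sA].
  by exists 0; split=> //; apply: algebraic0.
have [|y [yA yS ys]] := IH; first by move=> t ts; apply: sA; rewrite in_cons ts orbT.
have xA : algebraicOver e x by apply: sA; rewrite mem_head.
have [[p p0 px] [q q0 qy]] := (xA, yA).
have [n [[px1 px1E] [py1 py1E]]] := pchar0_PET p0 px q0 qy E0.
exists (y *+ n - x); split.
- apply: algebraic_sub => //; elim: n {px1E py1E} => [|n IHn]; first exact: algebraic0.
  by rewrite mulrS; apply: algebraic_add.
- move=> S S0 SB Ss.
  have SN t : S t -> S (- t) by move=> St; rewrite -sub0r; apply: SB.
  have Sy : S y by apply: yS => // t ts; apply: Ss; rewrite in_cons ts orbT.
  apply: (SB); last by apply: Ss; rewrite mem_head.
  elim: n {px1E py1E} => [//|n IHn]; rewrite mulrS -[y *+ n]opprK.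
  by apply: SB => //; apply: SN.
- move=> t; rewrite in_cons => /orP[/eqP ->|/ys[r <-]]; first by exists px1.
  exists (r \Po py1); rewrite map_comp_poly horner_comp; by rewrite py1E.
Qed.

Lemma simple_extension z : algebraicOver e z ->
  exists (N : fieldExtType E) (eta : {rmorphism N -> W}) (theta : N),
    [/\ forall a, eta (in_alg N a) = e a, eta theta = z &
        forall x, exists p, x = (map_poly (in_alg N) p).[theta]].
Proof.
move=> [p0 p00 p0z].
have ex : exists n, `[< exists p : {poly E}, [/\ p != 0, root (map_poly e p) z & size p = n] >].
  by exists (size p0); apply/asboolP; exists p0.
case: (ex_minnP ex) => n /asboolP[r [r0 rz sr]] nmin.
have irr_r : irreducible_poly r.
  apply/(subfx_irreducibleP rz r0) => q qz q0; rewrite sr; apply: nmin.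
  by apply/asboolP; exists q.
pose N := SubFieldExtType rz irr_r.
exists N, (@subfx_inj _ _ e z r), (subfx_root e z r); split.
- exact: subfx_inj_base.
- exact: subfx_inj_root.
- by move=> x; have [p ->] := subfxEroot rz r0 x; exists p.
Qed.

(** The splitting field of a polynomial [q] having all of [s] among its roots, built as a simple
    extension by a primitive element of the roots of [q]. Separability comes from characteristic
    zero. *)
Lemma galois_extension (s : seq W) : (forall x, x \in s -> algebraicOver e x) ->
  exists (N : splittingFieldType E) (eta : {rmorphism N -> W}) (theta : N),
    [/\ forall a, eta (in_alg N a) = e a, forall x, x \in s -> exists y, eta y = x,
        forall x, exists p, x = (map_poly (in_alg N) p).[theta] & galois 1 {:N}].
Proof.
move=> sA; have [q q0 qs] : exists2 q : {poly E}, q != 0 &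
    forall x, x \in s -> root (map_poly e q) x.
  elim: s sA => [_|x s IH sA]; first by exists 1; rewrite ?oner_neq0.
  have [|q q0 qs] := IH; first by move=> t ts; apply: sA; rewrite in_cons ts orbT.
  have [p p0 px] : algebraicOver e x by apply: sA; rewrite mem_head.
  exists (p * q); first by rewrite mulf_neq0.
  move=> t; rewrite rmorphM /= rootM in_cons => /orP[/eqP ->|/qs ->].
    by rewrite px.
  by rewrite orbT.
have [rs qE] := closed_field_poly_normal (map_poly e q).
have lq0 : lead_coef (map_poly e q) != 0 by rewrite lead_coef_eq0 map_poly_eq0.
have q_rs x : root (map_poly e q) x = (x \in rs).
  by rewrite qE rootZ // root_prod_XsubC.
have [|z [zA zS zrs]] := @primitive_element rs.
  by move=> x; rewrite -q_rs; exists q.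
have [N0 [eta [theta [etaE etaz gen]]]] := simple_extension zA.
have /all_sig2[inv invE _] : forall x, {y : N0 | x \in rs -> eta y = x & true}.
  move=> x; apply: cid2; have [/zrs[p pE]|_] := boolP (x \in rs); last by exists 0.
  exists (map_poly (in_alg N0) p).[theta] => // _.
  rewrite -horner_map etaz -map_poly_comp /= -pE; congr horner.
  by apply: eq_map_poly => a /=; rewrite etaE.
pose rsN := map inv rs.
have gen_rs : <<1 & rsN>>%VS = fullv :> {vspace N0}.
  (* The images under [eta] of the subspace generated by the roots form an additive group containing
     the roots, hence [z]. *)
  have th : theta \in <<1 & rsN>>%VS.
    have [||x xrs|t tN zE] :=
      zS [set x | exists2 t, t \in <<1 & rsN>>%VS & x = eta t].
    - by exists 0; rewrite ?rmorph0 ?rpred0.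
    - move=> _ _ [t tN ->] [t' t'N ->]; exists (t - t'); rewrite ?rmorphB //.
      exact: rpredB.
    - exists (inv x); last by rewrite invE.
      by apply: seqv_sub_adjoin; apply: map_f.
    by rewrite (_ : theta = t) //; apply: (fmorph_inj eta); rewrite etaz.
  apply/vspaceP => x; rewrite memvf; have [p ->] := gen x.
  rewrite horner_coef rpred_sum // => i _.
  by rewrite coef_map rpredM ?rpredX // rpredZ // rpred1.
have splitN : splitting_field_axiom N0.
  exists (map_poly (in_alg N0) q); first by apply/polyOver1P; exists q.
  exists rsN; last exact: gen_rs.
  have -> : map_poly (in_alg N0) q = in_alg N0 (lead_coef q) *: \prod_(x <- rsN) ('X - x%:P).
    apply: (map_poly_inj eta); rewrite map_polyZ /= rmorph_prod /= big_map.
    rewrite -map_poly_comp (eq_map_poly (g := e)) => [|a /=]; last by rewrite etaE.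
    rewrite qE lead_coef_map etaE; congr (_ *: _).
    rewrite [LHS]big_seq [RHS]big_seq; apply: eq_bigr => x xrs.
    by rewrite rmorphB /= map_polyX map_polyC /= invE.
  by apply: eqp_scale; rewrite fmorph_eq0 lead_coef_eq0.
pose N : splittingFieldType E := HB.pack N0 (FieldExt_isSplittingField.Build E N0 splitN).
exists N, eta, theta; split=> //.
- move=> x /qs; rewrite q_rs => xrs; exists (inv x); exact: invE.
- apply/and3P; split; [exact: sub1v| |exact: normalFieldf].
  apply/separableP => y _; apply: pcharf0_separable => p.
  by rewrite -E0; apply: (fmorph_pchar (in_alg N)).
Qed.

End FieldExtensions.

Lemma irreducible_factor (F : fieldType) (p : {poly F}) : p != 0 -> (1 < size p)%N ->
  exists2 q, irreducible_poly q & q %| p.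
Proof.
move=> p0 sp; have ex : exists n, `[< exists q, [/\ q %| p, (1 < size q)%N & size q = n] >].
  by exists (size p); apply/asboolP; exists p.
case: (ex_minnP ex) => n /asboolP[q [qp sq qn]] nmin; exists q => //.
have q0 : q != 0 by rewrite -size_poly_gt0 ltnW.
split=> // r r1 rq; rewrite -dvdp_size_eqp // eqn_leq dvdp_leq //= qn; apply: nmin.
have r0 : r != 0 by apply: contraNneq q0 => r0; rewrite r0 dvd0p in rq.
apply/asboolP; exists r; split=> //; first exact: dvdp_trans qp.
by rewrite ltn_neqAle eq_sym r1 size_poly_gt0.
Qed.

(** The minimal polynomial of [theta] may become reducible over [F0]. A root of any irreducible
    factor of its image can serve as the image of [theta]. *)
Lemma extend_embedding (E F0 : fieldType) (N : fieldExtType E) (theta : N)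
    (e : {rmorphism E -> F0}) :
  (forall x, exists p, x = (map_poly (in_alg N) p).[theta]) ->
  exists (F : fieldExtType F0) (delta : {rmorphism N -> F}),
    forall a, delta (in_alg N a) = in_alg F (e a).
Proof.
move=> gen; pose I (p : {poly E}) := (map_poly (in_alg N) p).[theta] == 0.
have exI : exists n, `[< exists p, [/\ p != 0, I p & size p = n] >].
  have /polyOver1P[p pE] := minPolyOver 1 theta.
  exists (size p); apply/asboolP; exists p; split=> //.
    rewrite -(map_poly_eq0 (in_alg N)) -pE monic_neq0 //; exact: monic_minPoly.
  by rewrite /I -pE; apply: root_minPoly.
case: (ex_minnP exI) => n /asboolP[m [m0 Im sm]] nmin.
have Idvd p : I p -> m %| p.
  move=> Ip; apply/modp_eq0P/eqP; apply: contraT => r0.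
  have /nmin : `[< exists q, [/\ q != 0, I q & size q = size (p %% m)%R] >].
    apply/asboolP; exists (p %% m); split=> //; move: Ip.
    by rewrite /I {1}(divp_eq p m) rmorphD rmorphM /= hornerD hornerM (eqP Im) mulr0 add0r.
  by rewrite -sm leqNgt ltn_modp m0.
have sme : (1 < size (map_poly e m))%N.
  rewrite size_map_poly ltnNge; apply/negP => /size1_polyC mC.
  by move: Im m0; rewrite mC /I map_polyC hornerC fmorph_eq0 polyC_eq0 => ->.
have [|q irr_q qm] := irreducible_factor _ sme; first by rewrite map_poly_eq0.
have [F _ [z qz _]] := irredp_FAdjoin irr_q.
pose G : set (N * F) := [set x | exists p : {poly E},
  x.1 = (map_poly (in_alg N) p).[theta] /\
  x.2 = (map_poly (in_alg F) (map_poly e p)).[z]].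
have hG : partial_hom G.
  split.
  - by exists 1; rewrite !rmorph1 !hornerC.
  - move=> _ _ _ _ [p /= [-> ->]] [p' /= [-> ->]]; exists (p - p').
    by rewrite !rmorphB /= !hornerE.
  - move=> _ _ _ _ [p /= [-> ->]] [p' /= [-> ->]]; exists (p * p').
    by rewrite !rmorphM /= !hornerE.
  - move=> _ [p /= [/esym/eqP/Idvd/dvdpP[r ->] ->]].
    have /dvdpP[t mE] := qm.
    by rewrite (rmorphM (map_poly e)) /= mE !rmorphM /= !hornerM (rootP qz) !mulr0.
have [x|delta dG] := partial_hom_total hG.
  by have [p pE] := gen x; exists (map_poly (in_alg F) (map_poly e p)).[z], p.
exists F, delta => a; apply: (partial_hom_inj hG (dG _)).
by exists a%:P; rewrite !map_polyC !hornerC.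
Qed.

Lemma inj_countable (T : Type) (U : countType) (c : U -> T) :
  (forall x, exists u, x = c u) -> exists f : T -> U, injective f.
Proof.
move=> /choice[f fP]; exists f => x y xy.
by rewrite (fP x) xy -fP.
Qed.

Lemma finite_type_int_countable (A : comNzRingType) : Z_finitely_generated A ->
  exists (T : countType) (f : A -> T), injective f.
Proof.
move=> [n [x xP]].
pose c (s : seq (n.-tuple nat * int)) : A :=
  \sum_(y <- s) y.2%:~R * \prod_(i < n) x i ^+ tnth y.1 i.
exists (seq (n.-tuple nat * int)); apply: (@inj_countable _ _ c) => a.
have [p ->] := xP a; exists [seq (multinom_val m, p@_m) | m <- msupp p].
by rewrite /c big_map; apply: eq_bigr => m _ /=.
Qed.

Lemma frac_countable (A : idomainType) (T : countType) (f : A -> T) :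
  injective f -> exists g : {fraction A} -> T * T, injective g.
Proof.
move=> f_inj; have /choice[h hP] x : exists pq : A * A, x = tofrac pq.1 / tofrac pq.2.
  by have [p [q [_ ->]]] := frac_repr x; exists (p, q).
exists (fun x => (f (h x).1, f (h x).2)) => x y [/f_inj e1 /f_inj e2].
by rewrite (hP x) (hP y) e1 e2.
Qed.

Lemma clear_denominators (R0 : idomainType) (p : {poly {fraction R0}}) :
  exists a p', a != 0 /\ map_poly (@tofrac R0) p' = tofrac a *: p.
Proof.
elim/poly_ind: p => [|p c [a [p' [a0 pE]]]].
  by exists 1, 0; rewrite oner_neq0 rmorph0 scaler0.
have [n [d [d0 ->]]] := frac_repr c.
exists (a * d), ((d *: p') * 'X + (a * n)%:P); rewrite mulf_neq0 //; split=> //.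
rewrite rmorphD rmorphM /= map_polyX map_polyC map_polyZ /= pE scalerDr.
rewrite scalerA -tofracM (mulrC d) -scalerAl; congr (_ + _).
rewrite -!mul_polyC -polyCM !tofracM -[in RHS]mulrA [X in _ = (_ * X)%:P]mulrCA.
by rewrite mulfV ?mulr1 ?tofrac_eq0.
Qed.

(** Write [P / Q] in lowest terms [p1 / q1] over the fraction field of [R0]. Coprimality persists
    over [W], so [p1] divides [u] and [q1] divides [w], which bounds their sizes. *)
Lemma poly_rel_descent (R0 : idomainType) (W : fieldType) (f : {rmorphism R0 -> W})
    (P Q : {poly R0}) (u w : {poly W}) : injective f ->
  P != 0 -> u != 0 -> w != 0 -> map_poly f P * w = map_poly f Q * u ->
  exists u' w' : {poly R0}, [/\ u' != 0, w' != 0, (size u' <= size u)%N,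
    (size w' <= size w)%N & P * w' = Q * u'].
Proof.
move=> f_inj P0 u0 w0 E; have [g gE] := frac_lift f_inj.
pose p := map_poly (@tofrac R0) P; pose q := map_poly (@tofrac R0) Q.
have gp (r : {poly R0}) : map_poly g (map_poly (@tofrac R0) r) = map_poly f r.
  by rewrite -map_poly_comp; apply: eq_map_poly => a /=; rewrite gE.
have tofrac_poly_inj (r s : {poly R0}) :
    map_poly (@tofrac R0) r = map_poly (@tofrac R0) s -> r = s.
  by apply: map_inj_poly; [exact: tofrac_inj | rewrite rmorph0].
have p0 : p != 0.
  by apply: contra_neq P0 => p0; apply: tofrac_poly_inj; rewrite rmorph0.
pose d := gcdp p q; have d0 : d != 0 by rewrite gcdp_eq0 negb_and p0.
pose p1 := p %/ d; pose q1 := q %/ d.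
have pE : p = p1 * d by rewrite divpK // dvdp_gcdl.
have qE : q = q1 * d by rewrite divpK // dvdp_gcdr.
have p10 : p1 != 0 by apply: contra_neq p0 => e; rewrite pE e mul0r.
have cpq : coprimep (map_poly g p1) (map_poly g q1).
  by rewrite coprimep_map coprimep_div_gcd ?p0.
have E1 : map_poly g p1 * w = map_poly g q1 * u.
  have gd0 : map_poly g d != 0 by rewrite map_poly_eq0.
  apply: (mulIf gd0); rewrite mulrAC -rmorphM -pE /= gp E.
  by rewrite -gp -/q qE rmorphM /= mulrAC.
have q10 : q1 != 0.
  apply: contra_neq (mulf_neq0 (_ : map_poly g p1 != 0) w0) => [e|].
    by rewrite E1 e rmorph0 mul0r.
  by rewrite map_poly_eq0.
have sp1 : (size p1 <= size u)%N.
  rewrite -(size_map_poly g); apply: dvdp_leq => //.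
  by rewrite -(Gauss_dvdpr _ cpq) -E1 dvdp_mulr.
have sq1 : (size q1 <= size w)%N.
  rewrite -(size_map_poly g); apply: dvdp_leq => //.
  by rewrite coprimep_sym in cpq; rewrite -(Gauss_dvdpr _ cpq) E1 dvdp_mulr.
have [a [u1 [a0 u1E]]] := clear_denominators p1.
have [b [w1 [b0 w1E]]] := clear_denominators q1.
have ta0 : tofrac a != 0 by rewrite tofrac_eq0.
have tb0 : tofrac b != 0 by rewrite tofrac_eq0.
have st (r : {poly R0}) : size (map_poly (@tofrac R0) r) = size r.
  by rewrite size_map_inj_poly ?rmorph0 //; apply: tofrac_inj.
have u10 : u1 != 0 by rewrite -size_poly_gt0 -st u1E size_scale // size_poly_gt0.
have w10 : w1 != 0 by rewrite -size_poly_gt0 -st w1E size_scale // size_poly_gt0.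
have su1 : size u1 = size p1 by rewrite -st u1E size_scale.
have sw1 : size w1 = size q1 by rewrite -st w1E size_scale.
(* As [u1] is [a] times [p1] and [w1] is [b] times [q1], crossing the denominators gives both the
   factor [a * b]. *)
exists (b *: u1), (a *: w1).
split.
- by rewrite -mul_polyC mulf_neq0 ?polyC_eq0.
- by rewrite -mul_polyC mulf_neq0 ?polyC_eq0.
- by rewrite size_scale // su1.
- by rewrite size_scale // sw1.
apply: tofrac_poly_inj; rewrite !rmorphM /= !map_polyZ /= u1E w1E -/p -/q pE qE.
by rewrite -!mul_polyC; ring.
Qed.

Section TranscendenceBasis.
Variables (C W : fieldType) (psi : {rmorphism C -> W}).

Lemma transcendence_basis (s : seq W) : exists d t,
  injective (tower_eval d psi t) /\
  forall x, x \in s -> exists2 p : {poly tower C d},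
    p != 0 & root (map_poly (tower_eval d psi t) p) x.
Proof.
elim: s => [|x s [d [t [t_inj ts]]]].
  by exists 0%N, (fun=> 0); split=> //; apply: fmorph_inj.
have [xA|xA] := pselect (exists2 p : {poly tower C d},
    p != 0 & root (map_poly (tower_eval d psi t) p) x).
  by exists d, t; split=> // y; rewrite in_cons => /orP[/eqP ->|/ts].
pose t' j := if j == d then x else t j.
have tt' (p : tower C d) : tower_eval d psi t' p = tower_eval d psi t p.
  by apply: (tower_eval_comp (g := idfun)) => // j jd; rewrite /t' (ltn_eqF jd).
exists d.+1, t'; split=> [p q|y].
  rewrite !tower_evalS /t' eqxx -/t' !(eq_map_poly tt') => /eqP.
  rewrite -subr_eq0 -hornerN -hornerD -rmorphB => pq0.
  apply/eqP; rewrite -subr_eq0; apply: contraPT pq0 => pq pq0; apply: xA.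
  by exists (p - q).
rewrite in_cons => /orP[/eqP ->|/ts[p p0 py]].
  exists ('X - (tower_var C d.+1 d)%:P); first by rewrite polyXsubC_eq0.
  by rewrite map_polyXsubC root_XsubC tower_eval_var // /t' eqxx.
exists (map_poly polyC p); first by rewrite map_polyC_eq0.
rewrite -map_poly_comp; rewrite (eq_map_poly (g := tower_eval d psi t)) // => a /=.
by rewrite /horner_eval map_polyC hornerC; apply: tt'.
Qed.

End TranscendenceBasis.

(** Making all variables but the [i]-th constant in [W] amounts to applying [tower_eval] to the
    coefficients of [tower_sub]. Since this map is injective, the relation descends by
    [poly_rel_descent]. *)
Lemma degree_le_descent (C W : fieldType) (psi : {rmorphism C -> W}) (d i B : nat)
    (t : nat -> W) (P Q : tower C d) (p q : {poly W}) :
  injective (tower_eval d psi t) -> P != 0 -> p != 0 -> q != 0 ->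
  (size p <= B)%N -> (size q <= B)%N ->
  tower_eval d (@polyC W \o psi) (fun j => if j == i then 'X else (t j)%:P) P * q =
  tower_eval d (@polyC W \o psi) (fun j => if j == i then 'X else (t j)%:P) Q * p ->
  degree_le i B P Q.
Proof.
move=> t_inj P0 p0 q0 pB qB.
have epsE r : tower_eval d (@polyC W \o psi) (fun j => if j == i then 'X else (t j)%:P) r =
    map_poly (tower_eval d psi t) (tower_sub C d i r).
  apply/esym/(tower_eval_comp (g := map_poly (tower_eval d psi t))) => [c|j jd] /=.
    by rewrite map_polyC /= tower_eval_const.
  by case: eqP => _; rewrite ?map_polyX // map_polyC /= tower_eval_var.
rewrite !epsE => E.
have sP0 : tower_sub C d i P != 0.
  by rewrite -(rmorph0 (tower_sub C d i)) (inj_eq (@tower_sub_inj _ _ _)).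
have [u [w [u0 w0 up wq uw]]] := poly_rel_descent t_inj sP0 p0 q0 E.
by exists u, w; rewrite (leq_trans up) // (leq_trans wq).
Qed.

(** * Subrings of a field *)

Lemma integral_frac (Q : comNzRingType) :
  (forall x y : Q, x * y = 0 -> x = 0 \/ y = 0) ->
  exists (F : fieldType) (h : {rmorphism Q -> F}), injective h.
Proof.
move=> Qint; pose U : {pred Q} := fun x => `[< exists y, y * x = 1 >].
have /all_sig[inv invP] : forall x, {y : Q | (x \in U -> y * x = 1) /\ (x \notin U -> y = x)}.
  move=> x; apply: cid; have [xU|xU] := boolP (x \in U); last by exists x.
  by move/asboolP: (xU) => [y yx]; exists y.
have mulVx : {in U, left_inverse 1 inv *%R} by move=> x /(invP x).1.
have unitPl x y : y * x = 1 -> U x by move=> yx; apply/asboolP; exists y.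
have inv_out : {in [predC U], inv =1 id} by move=> x /(invP x).2.
pose Q1 : comUnitRingType := HB.pack Q
  (GRing.ComNzRing_hasMulInverse.Build Q mulVx unitPl inv_out).
have Q1int : GRing.integral_domain_axiom Q1.
  by move=> x y /Qint[] ->; rewrite eqxx ?orbT.
pose Q2 : idomainType := HB.pack Q1 (GRing.ComUnitRing_isIntegral.Build Q1 Q1int).
have [||h hE] := @rmorph_of Q {fraction Q2} (fun x : Q => @tofrac Q2 x).
- exact: (@tofracB Q2).
- by split; [exact: (@tofrac1 Q2) | exact: (@tofracM Q2)].
by exists {fraction Q2}, h => x y; rewrite !hE; apply: (@tofrac_inj Q2).
Qed.

(** The residue field of the prime ideal: the fraction field of the quotient ring. *)
Lemma prime_field (B : comNzRingType) (I : set B) : prime_ideal I ->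
  exists (F : fieldType) (h : {rmorphism B -> F}), forall b, h b = 0 <-> I b.
Proof.
move=> [[I0 ID IM] I1 Iprime].
pose S : {pred B} := fun x => `[< I x >].
have SE x : x \in S = `[< I x >] by [].
have S_ideal : idealr_closed S.
  split; rewrite ?SE; first exact/asboolP.
    by apply/asboolP.
  move=> a x y; rewrite !SE => /asboolP xI /asboolP yI; apply/asboolP.
  by apply: ID => //; apply: IM.
pose J : idealr B := HB.pack S (isIdealr.Build B S S_ideal).
pose Q : comNzRingType := {ideal_quot J}.
pose pi : {rmorphism B -> Q} := \pi_Q%qT.
have piE b : pi b = 0 <-> I b.
  rewrite -(rmorph0 pi); split=> [/eqP|bI].
    by rewrite /pi -Quotient.idealrBE subr0 => /asboolP.
  by apply/eqP; rewrite /pi -Quotient.idealrBE subr0; apply/asboolP.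
have pi_surj x : exists b, x = pi b.
  by exists (repr x); apply/esym/reprK.
have [|F [h h_inj]] := @integral_frac Q.
  move=> x y; have [b ->] := pi_surj x; have [c ->] := pi_surj y.
  by rewrite -rmorphM => /piE /Iprime[] /piE ->; [left|right].
exists F, (h \o pi) => b /=; rewrite -piE; split=> [|->]; last by rewrite rmorph0.
by rewrite -(rmorph0 h) => /h_inj.
Qed.

Lemma ideal_span_ideal (B : comPzRingType) (G : set B) : ideal (ideal_span G).
Proof.
split.
- exists 0%N, (fun=> 0), (fun=> 0); split=> [[]//|]; by rewrite big_ord0.
- move=> _ _ [m [c [g [gG ->]]]] [m' [c' [g' [gG' ->]]]].
  pose cat (f : 'I_m -> B) (f' : 'I_m' -> B) (i : 'I_(m + m')) :=
    match fintype.split i with inl j => f j | inr j => f' j end.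
  exists (m + m')%N, (cat c c'), (cat g g'); split.
    by move=> i; rewrite /cat; case: (fintype.split i).
  rewrite big_split_ord /=; congr (_ + _); apply: eq_bigr => i _; rewrite /cat.
    by rewrite (unsplitK (inl i)).
  by rewrite (unsplitK (inr i)).
- move=> b _ [m [c [g [gG ->]]]]; exists m, (fun i => b * c i), g; split=> //.
  by rewrite mulr_sumr; apply: eq_bigr => i _; rewrite mulrA.
Qed.

Lemma ideal_span_sub (B : comPzRingType) (G : set B) : G `<=` ideal_span G.
Proof.
move=> x Gx; exists 1%N, (fun=> 1), (fun=> x); split=> //.
by rewrite big_ord1 mul1r.
Qed.

Lemma ideal_span_min (B : comPzRingType) (G I : set B) : ideal I -> G `<=` I ->
  ideal_span G `<=` I.
Proof.
move=> [I0 ID IM] GI _ [m [c [g [gG ->]]]]; apply: (big_ind I) => // i _.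
exact/IM/GI.
Qed.

Lemma proper_ideal_prime (B : comNzRingType) (I : set B) : ideal I -> ~ I 1 ->
  exists P, prime_ideal P /\ I `<=` P.
Proof.
move=> hI I1; case: (hI) => I0 ID IM.
have [|A [[hA A1] Amax]] := @Zorn_bigcup B [set X | ideal (I `|` X) /\ ~ (I `|` X) 1].
  move=> F FP Ftot; have [[X0 FX0]|noF] := pselect (exists X, F X); last first.
    have -> : \bigcup_(X in F) X = set0.
      by apply/seteqP; split=> // z [X FX]; case: noF; exists X.
    by split; rewrite setU0.
  have two z t : (I `|` \bigcup_(X in F) X) z -> (I `|` \bigcup_(X in F) X) t ->
      exists X, [/\ F X, (I `|` X) z & (I `|` X) t].
    move=> [zG|[X FX Xz]] [tG|[Y FY Yt]].
    - by exists X0; split=> //; left.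
    - by exists Y; split=> //; [left|right].
    - by exists X; split=> //; [right|left].
    - have [XY|YX] := Ftot _ _ FX FY.
        by exists Y; split=> //; right=> //; apply: XY.
      by exists X; split=> //; right=> //; apply: YX.
  have up X : F X -> I `|` X `<=` I `|` \bigcup_(X in F) X.
    by move=> FX z [|Xz]; [left|right; exists X].
  split; last first.
    by move=> h1; have [X [/FP[_ nX] X1 _]] := two _ _ h1 h1.
  split; first by left.
  - move=> x y /two H /H[X [FX xX yX]]; apply: (up _ FX).
    by have [[_ + _] _] := FP _ FX; apply.
  - move=> b x xU; have [X [FX xX _]] := two _ _ xU xU; apply: (up _ FX).
    by have [[_ _ +] _] := FP _ FX; apply.
pose P := I `|` A; have {hA A1} [[P0 PD PM] P1] : ideal P /\ ~ P 1 by [].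
have Pmax J : ideal J -> ~ J 1 -> P `<=` J -> J `<=` P.
  move=> hJ J1 PJ; have [JA|nJA] := pselect (J `<=` A); first by move=> z /JA; right.
  case: (Amax J); first by split=> // z Az; apply: PJ; right.
  have IJ : I `|` J = J.
    apply/seteqP; split=> z; last by move=> ?; right.
    by case=> // Iz; apply: PJ; left.
  by split; rewrite IJ.
exists P; split; last by move=> z Iz; left.
split=> // x y Pxy.
have ext x' : ~ P x' -> exists p b, P p /\ p + b * x' = 1.
  move=> Px'; apply: contrapT => no.
  pose J := [set z | exists p b, P p /\ z = p + b * x'].
  apply: Px'; apply: (Pmax J).
  - split.
    + by exists 0, 0; rewrite mul0r addr0.
    + move=> _ _ [p [b [Pp ->]]] [p' [b' [Pp' ->]]]; exists (p + p'), (b + b').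
      by split; [exact: PD | rewrite mulrDl addrACA].
    + move=> c _ [p [b [Pp ->]]]; exists (c * p), (c * b).
      by split; [exact: PM | rewrite mulrDr mulrA].
  - by move=> [p [b [Pp /esym e]]]; apply: no; exists p, b.
  - by move=> z Pz; exists z, 0; rewrite mul0r addr0.
  - by exists 0, 1; rewrite mul1r add0r.
have [|Px] := pselect (P x); first by left.
have [|Py] := pselect (P y); first by right.
have [p [b [Pp e]]] := ext _ Px; have [p' [b' [Pp' e']]] := ext _ Py.
case: P1; rewrite -[1]mulr1 -{1}e -e' mulrDl; apply: (PD); first by rewrite mulrC; apply: PM.
rewrite mulrDr; apply: (PD); first exact: PM.
by rewrite mulrACA; apply: PM.
Qed.

(** Rings are kept as subsets of one field [F], so that inclusions and localizations can be compared
    by their values in [F]. *)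
Record subalg (A : comNzRingType) (F : fieldType) (alpha : {rmorphism A -> F}) := Subalg {
  subalg_set :> F -> Prop;
  subalg1 : subalg_set 1;
  subalgB : forall x y, subalg_set x -> subalg_set y -> subalg_set (x - y);
  subalgM : forall x y, subalg_set x -> subalg_set y -> subalg_set (x * y);
  subalg_base : forall a, subalg_set (alpha a)
}.

Section SubalgRing.
Variables (A : comNzRingType) (F : fieldType) (alpha : {rmorphism A -> F}).
Variable S : subalg alpha.

Definition subalg_pred : {pred F} := fun x => `[< S x >].

Lemma subalg_pred_closed : subring_closed subalg_pred.
Proof.
split=> [|x y /asboolP xS /asboolP yS|x y /asboolP xS /asboolP yS]; apply/asboolP.
- exact: subalg1.
- exact: subalgB.
- exact: subalgM.
Qed.

HB.instance Definition _ :=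
  GRing.isSubringClosed.Build F subalg_pred subalg_pred_closed.

Record subalg_type := SubalgElt {
  subalg_val :> F;
  _ : subalg_val \in subalg_pred
}.

HB.instance Definition _ := [isSub for subalg_val].
HB.instance Definition _ := [Choice of subalg_type by <:].
HB.instance Definition _ := [SubChoice_isSubComNzRing of subalg_type by <:].

Lemma subalg_valP (x : subalg_type) : S (subalg_val x).
Proof. by case: x => x xP; apply/asboolP. Qed.

Lemma subalg_valX n : {morph subalg_val : x / x ^+ n}.
Proof. exact: (rmorphXn (val : {rmorphism subalg_type -> F})). Qed.

Lemma subalg_elt x : S x -> exists y : subalg_type, subalg_val y = x.
Proof. by move=> /asboolP xS; exists (SubalgElt xS). Qed.

Lemma subalg_lift (R : comPzRingType) (h : {rmorphism R -> F}) :
  (forall r, S (h r)) -> {g : {rmorphism R -> subalg_type} | forall r, subalg_val (g r) = h r}.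
Proof.
move=> hS; pose g r : subalg_type := SubalgElt (introT (asboolP _) (hS r)).
have [||g' g'E] := @rmorph_of _ _ g.
- by move=> x y; apply: val_inj; rewrite /= !rmorphB.
- by split=> [|x y]; apply: val_inj; rewrite /= ?rmorph1 ?rmorphM.
by exists g' => r; rewrite g'E.
Qed.

Definition subalg_map : {rmorphism A -> subalg_type} :=
  sval (subalg_lift (subalg_base S)).

Lemma subalg_mapE a : subalg_val (subalg_map a) = alpha a.
Proof. exact: (svalP (subalg_lift (subalg_base S))). Qed.

Definition subalg_algebra : algebra A := Algebra subalg_map.

End SubalgRing.

(** * Points of schemes *)

Section FunctorOfPoints.
Variables (A : comNzRingType) (X : functor_of_points A).

Definition alg_id (B : algebra A) : alg_hom B B :=
  @AlgHom A B B idfun (fun a => erefl).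

Lemma alg_comp_proof (B C D : algebra A) (g : alg_hom C D) (f : alg_hom B C) a :
  (g \o f) (alg_map B a) = alg_map D a.
Proof. by rewrite /= !alg_homP. Qed.

Definition alg_comp (B C D : algebra A) (g : alg_hom C D) (f : alg_hom B C) :
  alg_hom B D := @AlgHom A B D (g \o f) (alg_comp_proof g f).

Lemma fop_map_ext (B C : algebra A) (f g : alg_hom B C) (x : X B) :
  f =1 g -> fop_map f x = fop_map g x.
Proof.
move=> fg; rewrite (fop_map_comp (h := f) (g := g) (f := alg_id B)) //=.
by rewrite fop_map_id.
Qed.

Lemma fop_map_square (B C C' D : algebra A) (g : alg_hom C D) (f : alg_hom B C)
    (g' : alg_hom C' D) (f' : alg_hom B C') (x : X B) :
  g \o f =1 g' \o f' -> fop_map g (fop_map f x) = fop_map g' (fop_map f' x).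
Proof.
move=> sq; have := @fop_map_comp A X B C D g f (alg_comp g f) (fun=> erefl) x.
have := @fop_map_comp A X B C' D g' f' (alg_comp g' f') (fun=> erefl) x.
by move=> /= <- <-; apply: fop_map_ext.
Qed.

Lemma fop_mapM (B C D : algebra A) (g : alg_hom C D) (f : alg_hom B C)
    (h : alg_hom B D) (x : X B) :
  (forall b, g (f b) = h b) -> fop_map g (fop_map f x) = fop_map h x.
Proof.
move=> sq; rewrite -[fop_map h x](@fop_map_id A X D (alg_id D) (fun=> erefl)).
exact: fop_map_square.
Qed.

(** The ideal cutting out the locus where [x] and [y] agree is killed by [f], hence is zero. *)
Lemma separated_inj (B C : algebra A) (f : alg_hom B C) (x y : X B) :
  separated X -> injective f -> fop_map f x = fop_map f y -> x = y.
Proof.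
move=> sepX f_inj fxy; have [I [I0 _ _] IP] := sepX B x y.
have := (IP B (alg_id B)).2; rewrite !fop_map_id //; apply=> b Ib /=.
by apply: f_inj; rewrite rmorph0; apply: (IP C f).1.
Qed.

End FunctorOfPoints.

Section SubalgHom.
Variables (A : comNzRingType) (F : fieldType) (alpha : {rmorphism A -> F}).
Implicit Types S T : subalg alpha.

Lemma subalg_hom (B : algebra A) T (h : {rmorphism B -> F}) :
  (forall a, h (alg_map B a) = alpha a) -> (forall b, T (h b)) ->
  {g : alg_hom B (subalg_algebra T) | forall b, subalg_val (g b) = h b}.
Proof.
move=> hB hT; have [g gE] := subalg_lift hT.
have gA a : g (alg_map B a) = alg_map (subalg_algebra T) a.
  by apply: val_inj; rewrite /= gE hB subalg_mapE.
by exists (@AlgHom A B (subalg_algebra T) g gA).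
Qed.

Lemma subalg_val_homP S a : val (alg_map (subalg_algebra S) a) = alg_map (Algebra alpha) a.
Proof. exact: subalg_mapE. Qed.

Definition subalg_val_hom S : alg_hom (subalg_algebra S) (Algebra alpha) :=
  @AlgHom A (subalg_algebra S) (Algebra alpha) (val : {rmorphism subalg_type S -> F})
    (@subalg_val_homP S).

Lemma subalg_incl S T : (forall x, S x -> T x) ->
  {g : alg_hom (subalg_algebra S) (subalg_algebra T) |
    forall b, subalg_val (g b) = subalg_val b}.
Proof.
move=> ST; have [] := @subalg_hom (subalg_algebra S) T (subalg_val_hom S).
- exact: subalg_mapE.
- by move=> b; apply/ST/subalg_valP.
by move=> g gE; exists g.
Qed.

Lemma subalg_sum S I (r : seq I) (P : pred I) (f : I -> F) :
  (forall i, P i -> S (f i)) -> S (\sum_(i <- r | P i) f i).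
Proof.
have S0 : S 0 by rewrite -(subrr 1); apply: subalgB; apply: subalg1.
have SN x : S x -> S (- x) by move=> xS; rewrite -sub0r; apply: subalgB.
move=> fS; apply: (big_ind S) => // x y xS yS.
by rewrite -[y]opprK; apply: subalgB => //; apply: SN.
Qed.

Lemma subalgX S x m : S x -> S (x ^+ m).
Proof.
by move=> xS; elim: m => [|m IH]; [apply: subalg1 | rewrite exprS; apply: subalgM].
Qed.

Lemma subalg_prod S I (r : seq I) (P : pred I) (f : I -> F) :
  (forall i, P i -> S (f i)) -> S (\prod_(i <- r | P i) f i).
Proof.
move=> fS; apply: (big_ind S) => //; first exact: subalg1.
exact: subalgM.
Qed.

Section Localize.
Variables (S : subalg alpha) (g : F).
Hypothesis Sg : S g.

Let loc_set (x : F) := exists m, S (x * g ^+ m).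

Let locB x y : loc_set x -> loc_set y -> loc_set (x - y).
Proof.
move=> [m xm] [m' ym]; exists (m + m')%N; rewrite mulrBl; apply: subalgB.
  by rewrite exprD mulrA; apply: subalgM => //; apply: subalgX.
by rewrite exprD mulrCA mulrC; apply: subalgM => //; apply: subalgX.
Qed.

Let locM x y : loc_set x -> loc_set y -> loc_set (x * y).
Proof.
by move=> [m xm] [m' ym]; exists (m + m')%N; rewrite exprD mulrACA; apply: subalgM.
Qed.

Let loc_sub x : S x -> loc_set x.
Proof. by move=> xS; exists 0%N; rewrite mulr1. Qed.

Definition localize : subalg alpha :=
  @Subalg A F alpha loc_set (loc_sub (subalg1 S)) locB locM
    (fun a => loc_sub (subalg_base S a)).

Lemma localize_sub x : S x -> localize x. Proof. exact: loc_sub. Qed.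

End Localize.

Lemma localize_is_localization S (g : F) (Sg : S g) (b : subalg_type S)
    (l : alg_hom (subalg_algebra S) (subalg_algebra (localize Sg))) :
  g != 0 -> subalg_val b = g -> (forall x, subalg_val (l x) = subalg_val x) ->
  @is_localization A (subalg_algebra S) (subalg_algebra (localize Sg)) b l.
Proof.
move=> g0 bE lE; split.
- have [u uE] : exists u : subalg_type (localize Sg), val u = g^-1.
    by apply: subalg_elt; exists 1%N; rewrite mulVf //; apply: subalg1.
  by exists u; apply: val_inj; rewrite rmorphM rmorph1 /= lE bE uE mulfV.
- move=> c; have [m cm] := subalg_valP c; have [b' b'E] := subalg_elt cm.
  by exists b', m; apply: val_inj; rewrite rmorphM rmorphXn /= !lE bE -b'E.
- move=> b' lb'; exists 0%N; rewrite expr0 mul1r; apply: val_inj.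
  by rewrite -[LHS]lE lb'.
Qed.

End SubalgHom.

(** * Gluing sections that agree at the generic point *)

Section Glue.
Variables (A : comNzRingType) (F : fieldType) (alpha : {rmorphism A -> F}).
Variables (X : functor_of_points A).
Hypotheses (sheafX : Zariski_sheaf X) (sepX : separated X).

Lemma subalg_val_hom_inj (S : subalg alpha) : injective (subalg_val_hom S).
Proof. exact: val_inj. Qed.

(** The universal property of the localization at [gi * gj], in the form in which the sheaf
    condition tests agreement on overlaps. *)
Lemma localize_common (S : subalg alpha) (gi gj : F) (Si : S gi) (Sj : S gj)
    (Sij : S (gi * gj)) (D : algebra A)
    (li : alg_hom (subalg_algebra S) (subalg_algebra (localize Si)))
    (lj : alg_hom (subalg_algebra S) (subalg_algebra (localize Sj)))
    (ki : alg_hom (subalg_algebra (localize Si)) (subalg_algebra (localize Sij)))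
    (kj : alg_hom (subalg_algebra (localize Sj)) (subalg_algebra (localize Sij)))
    (g : alg_hom (subalg_algebra (localize Si)) D)
    (h : alg_hom (subalg_algebra (localize Sj)) D) :
  gi != 0 -> gj != 0 ->
  (forall x, subalg_val (li x) = subalg_val x) ->
  (forall x, subalg_val (lj x) = subalg_val x) ->
  (forall x, subalg_val (ki x) = subalg_val x) ->
  (forall x, subalg_val (kj x) = subalg_val x) ->
  g \o li =1 h \o lj ->
  exists f : alg_hom (subalg_algebra (localize Sij)) D,
    (forall x, f (ki x) = g x) /\ (forall x, f (kj x) = h x).
Proof.
move=> gi0 gj0 liE ljE kiE kjE gh.
have [ei eiE] : exists u : subalg_type (localize Si), subalg_val u = gi^-1.
  by apply: subalg_elt; exists 1%N; rewrite mulVf //; apply: subalg1.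
have [ej ejE] : exists u : subalg_type (localize Sj), subalg_val u = gj^-1.
  by apply: subalg_elt; exists 1%N; rewrite mulVf //; apply: subalg1.
have [bi biE] := subalg_elt Si; have [bj bjE] := subalg_elt Sj.
pose be (b : subalg_type S) := g (li b).
have wi : be bi * g ei = 1.
  rewrite /be -rmorphM (_ : li bi * ei = 1) ?rmorph1 //.
  by apply: val_inj; rewrite rmorphM /= liE biE eiE mulfV.
have wj : be bj * h ej = 1.
  rewrite /be [g _]gh /= -rmorphM (_ : lj bj * ej = 1) ?rmorph1 //.
  by apply: val_inj; rewrite rmorphM /= ljE bjE ejE mulfV.
have beM b b' : be (b * b') = be b * be b' by rewrite /be !rmorphM.
have beB b b' : be (b - b') = be b - be b' by rewrite /be !rmorphB.
have beX b m : be (b ^+ m) = be b ^+ m by rewrite /be !rmorphXn.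
pose w := g ei * h ej.
have wE : be (bi * bj) * w = 1 by rewrite beM /w mulrACA wi wj mulr1.
have wX m : be (bi * bj) ^+ m * w ^+ m = 1 by rewrite -exprMn wE expr1n.
pose gij := gi * gj.
have gijE : gij = val (bi * bj) by rewrite rmorphM /= biE bjE.
(* A fraction b / gij^m is sent to the image of b times [w ^+ m], where [w] is the inverse of the
   image of [bi * bj]. *)
pose G : set (subalg_type (localize Sij) * D) := [set z | exists m b,
  subalg_val z.1 * gij ^+ m = subalg_val b /\ z.2 = be b * w ^+ m].
have hG : partial_hom G.
  split.
  - exists 0%N, 1; rewrite !mulr1; split=> //; by rewrite /be !rmorph1.
  - move=> x a y c [m [b /= [xb ->]]] [m' [b' /= [yb' ->]]].
    exists (m + m')%N, (b * (bi * bj) ^+ m' - b' * (bi * bj) ^+ m); split=> /=.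
      rewrite mulrBl exprD mulrA xb (mulrC (gij ^+ m)) mulrA yb' gijE.
      by rewrite ?subalg_valX.
    rewrite beB !beM !beX mulrBl exprD; congr (_ - _).
      by rewrite -mulrA (mulrCA (be _ ^+ m')) wX mulr1.
    by rewrite -mulrA (mulrA (be _ ^+ m)) wX mul1r.
  - move=> x a y c [m [b /= [xb ->]]] [m' [b' /= [yb' ->]]].
    exists (m + m')%N, (b * b'); split=> /=.
      by rewrite exprD mulrACA xb yb'.
    by rewrite beM exprD mulrACA.
  - move=> _ [m [b /= [/esym xb ->]]].
    rewrite (_ : b = 0) /be ?rmorph0 ?mul0r //; apply: val_inj.
    by rewrite /= xb mul0r.
have [x|k kG] := partial_hom_total hG.
  have [m xm] := subalg_valP x; have [b bE] := subalg_elt xm.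
  by exists (be b * w ^+ m), m, b; rewrite bE.
have kki x : k (ki x) = g x.
  have [m xm] := subalg_valP x; have [b bE] := subalg_elt xm.
  apply: (partial_hom_inj hG (kG _)); exists m, (b * bj ^+ m); split=> /=.
    rewrite kiE /gij exprMn mulrA -bE -bjE.
    by rewrite ?subalg_valX.
  have -> : x = li b * ei ^+ m.
    apply: val_inj; rewrite rmorphM rmorphXn /= liE bE eiE exprVn mulfK //.
    exact: expf_neq0.
  rewrite rmorphM rmorphXn beM beX /w exprMn mulrACA -[be bj ^+ m * _]exprMn.
  by rewrite wj expr1n mulr1.
have kkj x : k (kj x) = h x.
  have [m xm] := subalg_valP x; have [b bE] := subalg_elt xm.
  apply: (partial_hom_inj hG (kG _)); exists m, (b * bi ^+ m); split=> /=.
    rewrite kjE /gij exprMn mulrA mulrAC -bE -biE.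
    by rewrite ?subalg_valX.
  have -> : x = lj b * ej ^+ m.
    apply: val_inj; rewrite rmorphM rmorphXn /= ljE bE ejE exprVn mulfK //.
    exact: expf_neq0.
  rewrite rmorphM rmorphXn beM beX /w exprMn -[RHS]mulrA.
  by rewrite [X in _ = _ * X]mulrA -exprMn wi expr1n mul1r /be [g _]gh.
have kA a : k (alg_map (subalg_algebra (localize Sij)) a) = alg_map D a.
  by rewrite -(alg_homP ki) kki alg_homP.
by exists (@AlgHom A (subalg_algebra (localize Sij)) D k kA).
Qed.

(** On the overlap of two pieces, both sections restrict to points over a subring of [F] with the
    same image [x] over [F], so they agree by separatedness. *)
Lemma glue_generic (S : subalg alpha) (M : nat) (c g : 'I_M -> F)
    (Sg : forall i, S (g i)) (s : forall i, X (subalg_algebra (localize (Sg i))))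
    (x : X (Algebra alpha)) :
  (forall i, S (c i)) -> (forall i, g i != 0) -> \sum_(i < M) c i * g i = 1 ->
  (forall i, fop_map (subalg_val_hom _) (s i) = x) ->
  exists U : X (subalg_algebra S), fop_map (subalg_val_hom S) U = x.
Proof.
move=> Sc g0 cg sx.
have [i0 _] : exists i : 'I_M, True.
  case: M c g Sg s Sc g0 cg sx => [|M] c g Sg s Sc g0 cg sx; last by exists ord0.
  by move: cg => /eqP; rewrite big_ord0 eq_sym oner_eq0.
have /all_sig[b bE] : forall i, {b : subalg_type S | subalg_val b = g i}.
  by move=> i; apply: cid; apply: subalg_elt.
have /all_sig[d dE] : forall i, {d : subalg_type S | subalg_val d = c i}.
  by move=> i; apply: cid; apply: subalg_elt.
have /all_sig[l lE] := fun i => @subalg_incl _ _ alpha S (localize (Sg i)) (localize_sub (Sg i)).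
have b_span : ideal_span (range b) (1 : subalg_algebra S).
  exists M, d, b; split=> [i|]; first by exists i.
  apply: val_inj; rewrite rmorph1 -cg rmorph_sum; apply: eq_bigr => i _.
  by rewrite rmorphM /= bE dE.
have [||U [UE _]] := @sheafX (subalg_algebra S) M b _ l s b_span.
- by move=> i; apply: localize_is_localization.
- move=> i j D gi hj gh.
  have Sij : S (g i * g j) by apply: subalgM.
  have locij z : localize (Sg i) z -> localize Sij z.
    move=> [m zm]; exists m; rewrite exprMn mulrA.
    by apply: subalgM => //; apply: subalgX.
  have locji z : localize (Sg j) z -> localize Sij z.
    move=> [m zm]; exists m; rewrite exprMn mulrA mulrAC.
    by apply: subalgM => //; apply: subalgX.
  have [ki kiE] := subalg_incl locij; have [kj kjE] := subalg_incl locji.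
  have [f [fi fj]] :=
    localize_common (g0 i) (g0 j) (lE i) (lE j) kiE kjE gh.
  rewrite -(@fop_mapM _ X _ _ _ f ki gi (s i) fi) -(@fop_mapM _ X _ _ _ f kj hj (s j) fj).
  congr (fop_map f _).
  apply: (separated_inj sepX (@subalg_val_hom_inj (localize Sij))).
  rewrite (@fop_mapM _ X _ _ _ _ ki (subalg_val_hom _)) //.
  by rewrite (@fop_mapM _ X _ _ _ _ kj (subalg_val_hom _)) // !sx.
exists U; rewrite -(sx i0) -UE.
by rewrite (@fop_mapM _ X _ _ _ _ (l i0) (subalg_val_hom S)) // => z /=; apply: lE.
Qed.

End Glue.

(** * Descent of the generic point *)

Lemma mmap_rmorph (n : nat) (R S : comNzRingType) (f : {rmorphism R -> S}) (y : 'I_n -> S) :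
  {g : {rmorphism {mpoly R[n]} -> S} |
    forall p, g p = \sum_(m <- msupp p) f p@_m * \prod_(i < n) y i ^+ m i}.
Proof.
exists (mmap f y : {rmorphism {mpoly R[n]} -> S}) => p.
by rewrite /= /mmap; apply: eq_bigr.
Qed.

Lemma poly_eval_rmorph (A : comNzRingType) (B : algebra A) (S : pzRingType) n
    (x : 'I_n -> B) (h : {rmorphism B -> S}) p :
  h (poly_eval x p) =
  \sum_(m <- msupp p) h (alg_map B p@_m) * \prod_(i < n) h (x i) ^+ m i.
Proof.
rewrite rmorph_sum; apply: eq_bigr => m _; rewrite rmorphM rmorph_prod.
by congr (_ * _); apply: eq_bigr => i _; rewrite rmorphXn.
Qed.

Lemma subalg_adjoin (A : comNzRingType) (F : fieldType) (iota : {rmorphism A -> F})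
    (t : seq F) : Z_finitely_generated A ->
  exists S : subalg iota, (forall c, c \in t -> S c) /\
    Z_finitely_generated (subalg_type S).
Proof.
move=> [nA [xA genA]].
have [y [yl yr]] : exists y : 'I_(nA + size t) -> F,
    (forall j, y (lshift (size t) j) = iota (xA j)) /\
    (forall j, y (rshift nA j) = t`_j).
  exists (fun i => match fintype.split i with inl j => iota (xA j) | inr j => t`_j end).
  by split=> j; [rewrite (unsplitK (inl j)) | rewrite (unsplitK (inr j))].
have [ev evE] := mmap_rmorph (intmul 1 : {rmorphism int -> F}) y.
have evX i : ev 'X_i = y i.
  rewrite evE msuppX big_seq1 mcoeffX eqxx rmorph1 mul1r (bigD1 i) //=.
  rewrite mnm1E eqxx expr1 big1 ?mulr1 // => j ji.
  by rewrite mnm1E eq_sym (negPf ji).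
pose S0 : set F := [set ev p | p in setT].
have S01 : S0 1 by exists 1; rewrite ?rmorph1.
have S0B a b : S0 a -> S0 b -> S0 (a - b).
  by move=> [p _ <-] [q _ <-]; exists (p - q); rewrite ?rmorphB.
have S0M a b : S0 a -> S0 b -> S0 (a * b).
  by move=> [p _ <-] [q _ <-]; exists (p * q); rewrite ?rmorphM.
have S0A a : S0 (iota a).
  have [p ->] := genA a.
  rewrite (@poly_eval_rmorph int (Algebra (intmul 1 : {rmorphism int -> A})) F nA xA iota).
  apply: (big_ind S0); first by exists 0; rewrite ?rmorph0.
    by move=> _ _ [q _ <-] [q' _ <-]; exists (q + q'); rewrite ?rmorphD.
  move=> m _; apply: (S0M); first by exists (p@_m)%:~R; rewrite ?rmorph_int.
  apply: (big_ind S0) => [||i _]; [exact: S01 | exact: S0M |].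
  exists ('X_(lshift (size t) i) ^+ m i); first by [].
  by rewrite rmorphXn evX yl.
pose S := @Subalg A F iota S0 S01 S0B S0M S0A; exists S; split.
  move=> c ct; have ic : (index c t < size t)%N by rewrite index_mem.
  exists 'X_(rshift nA (Ordinal ic)) => //.
  by rewrite evX yr nth_index.
have /all_sig[z zE] : forall i, {z : subalg_type S | subalg_val z = y i}.
  by move=> i; apply: cid; apply: subalg_elt; exists 'X_i.
exists (nA + size t)%N, z => b; have [p _ pb] := subalg_valP b.
exists p; apply: val_inj.
rewrite (@poly_eval_rmorph int (Algebra (intmul 1 : {rmorphism int -> subalg_type S}))
  F _ z (val : {rmorphism subalg_type S -> F})) /=.
rewrite -pb evE; apply: eq_bigr => m _; congr (_ * _).
  exact/esym/(rmorph_int (val : {rmorphism subalg_type S -> F})).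
by apply: eq_bigr => i _; rewrite zE.
Qed.

Section GenericPoint.
Variables (n : nat) (C Fr : fieldType) (ev : {rmorphism {mpoly C[n]} -> Fr}).
Variables (A : comNzRingType) (iota : {rmorphism A -> C}).

Definition coord_const : {rmorphism C -> Fr} := ev \o @mpolyC n C.

Let rangeB x y : range ev x -> range ev y -> range ev (x - y).
Proof. by move=> [p _ <-] [q _ <-]; exists (p - q); rewrite ?rmorphB. Qed.
Let rangeM x y : range ev x -> range ev y -> range ev (x * y).
Proof. by move=> [p _ <-] [q _ <-]; exists (p * q); rewrite ?rmorphM. Qed.
Let range1 : range ev 1. Proof. by exists 1; rewrite ?rmorph1. Qed.

(** When the kernel of [ev] is the prime ideal of X, this image is the coordinate ring of X inside
    its function field; [coord_ringA] is the same ring viewed over [A]. *)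
Definition coord_ring : subalg coord_const :=
  @Subalg C Fr coord_const (range ev) range1 rangeB rangeM
    (fun c => ex_intro2 _ _ c%:MP I erefl).

Definition coord_ringA : subalg (coord_const \o iota) :=
  @Subalg A Fr (coord_const \o iota) (range ev) range1 rangeB rangeM
    (fun a => ex_intro2 _ _ (iota a)%:MP I erefl).

(** The ring generated over [S] by the coordinate functions, described as an intersection of
    subalgebras. *)
Definition coord_subring_set (S : subalg iota) (b : Fr) : Prop :=
  forall T : subalg (coord_const \o iota), (forall i, T (ev 'X_i)) ->
    (forall c, S c -> T (coord_const c)) -> T b.

Lemma coord_subring1 S : coord_subring_set S 1.
Proof. by move=> T _ _; apply: subalg1. Qed.

Lemma coord_subringB S x y : coord_subring_set S x -> coord_subring_set S y ->
  coord_subring_set S (x - y).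
Proof. by move=> xS yS T TX TS; apply: subalgB; [apply: xS|apply: yS]. Qed.

Lemma coord_subringM S x y : coord_subring_set S x -> coord_subring_set S y ->
  coord_subring_set S (x * y).
Proof. by move=> xS yS T TX TS; apply: subalgM; [apply: xS|apply: yS]. Qed.

Lemma coord_subring_base S a : coord_subring_set S ((coord_const \o iota) a).
Proof. by move=> T _ TS; apply: TS; apply: subalg_base. Qed.

Definition coord_subring (S : subalg iota) : subalg (coord_const \o iota) :=
  @Subalg A Fr _ (coord_subring_set S) (@coord_subring1 S) (@coord_subringB S)
    (@coord_subringM S) (@coord_subring_base S).

Lemma coord_subring_poly (S : subalg iota) p :
  (forall m, m \in msupp p -> S p@_m) -> coord_subring S (ev p).
Proof.
move=> pS T TX TS; rewrite [p]mpolyE rmorph_sum big_seq.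
apply: subalg_sum => m mp; rewrite -mul_mpolyC rmorphM; apply: subalgM.
  exact/TS/pS.
rewrite mpolyXE_id rmorph_prod; apply: subalg_prod => i _.
by rewrite rmorphXn; apply: subalgX.
Qed.

Lemma coord_subring_sub (S : subalg iota) b : coord_subring S b -> coord_ringA b.
Proof.
apply; first by move=> i; exists 'X_i.
by move=> c _; exists c%:MP.
Qed.

Lemma coord_eval (B : comNzRingType) (v : {rmorphism B -> Fr}) (y : 'I_n -> C) :
  injective v -> (forall b, range ev (v b)) ->
  (forall p, ev p = 0 -> p.@[y] = 0) ->
  {e : {rmorphism B -> C} | forall b p, v b = ev p -> e b = p.@[y]}.
Proof.
move=> v_inj vr ker; pose G : set (B * C) := [set z | exists p, v z.1 = ev p /\ z.2 = p.@[y]].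
have hG : partial_hom G.
  split.
  - by exists 1; rewrite !rmorph1.
  - move=> x _ z _ [p /= [vp ->]] [q /= [vq ->]]; exists (p - q).
    by rewrite !rmorphB /= vp vq.
  - move=> x _ z _ [p /= [vp ->]] [q /= [vq ->]]; exists (p * q).
    by rewrite !rmorphM /= vp vq.
  - by move=> _ [p /= [/esym + ->]]; rewrite rmorph0; apply: ker.
have [b|e eG] := partial_hom_total hG.
  by have [p _ pb] := vr b; exists p.@[y], p.
exists e => b p bp; apply: (partial_hom_inj hG (eG b)).
by exists p.
Qed.

End GenericPoint.

(** Zero generators are discarded because localizations are formed inside the field. *)
Lemma ideal_span_nonzero (B : comPzRingType) (G : set B) :
  ideal_span G `<=` ideal_span (G `\ 0).
Proof.
apply: ideal_span_min; first exact: ideal_span_ideal.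
move=> b Gb; have [->|/eqP b0] := eqVneq b 0; last exact: ideal_span_sub.
by have [] := ideal_span_ideal (G `\ 0).
Qed.

(** Were the ideal proper, some prime would contain it, and the point of X over the residue field
    would lie in one of the open pieces; but the ideal of that piece becomes zero there. *)
Lemma cover_unit_ideal (A : comNzRingType) (F : fieldType) (alpha : {rmorphism A -> F})
    (S : subalg alpha) (X : functor_of_points A) (m : nat)
    (U : 'I_m -> forall B : algebra A, set (X B)) (x : X (subalg_algebra S))
    (J : 'I_m -> set (subalg_algebra S)) :
  (forall (k : fieldType) (f : {rmorphism A -> k}) (z : X (Algebra f)),
    exists i, U i (Algebra f) z) ->
  (forall i (C : algebra A) (f : alg_hom (subalg_algebra S) C),
    U i C (fop_map f x) <-> ideal_span (f @` J i) 1) ->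
  ideal_span (\bigcup_i J i) 1.
Proof.
move=> cov JP; apply: contrapT => span1.
have [P [P_prime sub]] :=
  @proper_ideal_prime (subalg_type S) _ (ideal_span_ideal _) span1.
have [k [q qP]] := prime_field P_prime.
pose f : {rmorphism A -> k} := q \o subalg_map S.
have qA a : q (alg_map (subalg_algebra S) a) = alg_map (Algebra f) a by [].
pose g : alg_hom (subalg_algebra S) (Algebra f) :=
  @AlgHom A (subalg_algebra S) (Algebra f) q qA.
have [i /(JP i (Algebra f) g) span] := cov k f (fop_map g x).
have k_ideal0 : ideal [set (0 : Algebra f)].
  split=> [//|a b /= -> ->|a b /= ->]; [exact: addr0 | exact: mulr0].
have : [set (0 : Algebra f)] 1.
  apply: (ideal_span_min k_ideal0 _ span) => _ [b Jb <-] /=.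
  by apply/qP/sub/ideal_span_sub; exists i.
by move=> /= /eqP; rewrite oner_eq0.
Qed.

Lemma finite_family_seq (T : eqType) (I : finType) (P : I -> seq T -> Prop) :
  (forall i s s', P i s -> {subset s <= s'} -> P i s') ->
  (forall i, exists s, P i s) -> exists s, forall i, P i s.
Proof.
move=> mono /choice[f fP]; exists (flatten [seq f i | i : I]) => i.
apply: mono (fP i) _ => x xf; apply/flattenP; exists (f i) => //.
by apply/mapP; exists i; rewrite ?mem_enum.
Qed.

Section Descent.
Variables (n : nat) (C Fr : fieldType) (ev : {rmorphism {mpoly C[n]} -> Fr}).
Variables (A : comNzRingType) (iota : {rmorphism A -> C}).
Let alpha : {rmorphism A -> Fr} := coord_const ev \o iota.
Let R : subalg alpha := coord_ringA ev iota.
Variables (X : functor_of_points A).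
Hypotheses (sheafX : Zariski_sheaf X) (sepX : separated X).
Hypothesis coverX : finite_affine_open_cover X.

Lemma coord_subring_range b : range ev b -> exists t : seq C,
  forall S : subalg iota, (forall c, c \in t -> S c) -> coord_subring ev S b.
Proof.
move=> [p _ <-]; exists [seq p@_m | m <- msupp p] => S St.
by apply: coord_subring_poly => m mp; apply/St/mapP; exists m.
Qed.

(* A section over the localization at g of an affine piece of finite type only
   involves finitely many constants. *)
Lemma descend_affine (g : Fr) (Rg : R g) (B0 : algebra A)
    (f : alg_hom B0 (subalg_algebra (localize Rg))) : g != 0 -> finite_type B0 ->
  exists t : seq C, forall S : subalg iota, (forall c, c \in t -> S c) ->
    exists Sg : coord_subring ev S g, forall b, localize Sg (subalg_val (f b)).
Proof.
move=> g0 [N [y genB0]].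
have [tg tgP] := coord_subring_range Rg.
have [||t tP] := @finite_family_seq C 'I_N (fun j t => forall S : subalg iota,
    (forall c, c \in t -> S c) -> exists m, coord_subring ev S (subalg_val (f (y j)) * g ^+ m)).
- by move=> i s s' sP ss' S s'S; apply: sP => c /ss' /s'S.
- move=> j; have [m /coord_subring_range[t tP]] := subalg_valP (f (y j)).
  by exists t => S /tP; exists m.
exists (tg ++ t) => S St.
have Sg : coord_subring ev S g.
  by apply: tgP => c ct; apply: St; rewrite mem_cat ct.
exists Sg => b; have [p ->] := genB0 b.
pose h : {rmorphism B0 -> Fr} := (val : {rmorphism subalg_type (localize Rg) -> Fr}) \o f.
rewrite -[subalg_val _]/(h (poly_eval y p)) poly_eval_rmorph.
apply: subalg_sum => m _; apply: subalgM.
  rewrite /h /= alg_homP -[alg_map _ _]/(subalg_map (localize Rg) _) subalg_mapE.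
  exact: (subalg_base (localize Sg)).
apply: subalg_prod => i _; apply: subalgX.
by apply: (tP i S) => c ct; apply: St; rewrite mem_cat ct orbT.
Qed.

(** The section lives on finitely many basic open sets, each mapped into an affine piece of finite
    type. The constants occurring in these maps, in the [g l] and in the partition of unity are
    finitely many, and over any [S] containing them the pieces glue. *)
Lemma descend_point (U : X (subalg_algebra R)) : exists t : seq C,
  forall S : subalg iota, (forall c, c \in t -> S c) ->
    exists U' : X (subalg_algebra (coord_subring ev S)),
      fop_map (subalg_val_hom _) U' = fop_map (subalg_val_hom R) U.
Proof.
have [m [O [Oprop cov]]] := coverX.
have Oopen i : open_subfunctor (O i) := (Oprop i).1.
have /all_sig2[J J_ideal JP] : forall i, {J : set (subalg_algebra R) | ideal J &
    forall (D : algebra A) (f : alg_hom (subalg_algebra R) D),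
      O i D (fop_map f U) <-> ideal_span (f @` J) 1}.
  move=> i; apply: cid2; have [_ /(_ _ U)[J hJ JP]] := Oopen i.
  by exists J.
have /ideal_span_nonzero[M [c [g [gJ cg]]]] := cover_unit_ideal cov JP.
have g0 l : subalg_val (g l) != 0.
  by have [_ /= gl0] := gJ l; apply: contra_notN gl0 => /eqP e; apply: val_inj.
pose x := fop_map (subalg_val_hom R) U.
have [||t tP] := @finite_family_seq C 'I_M (fun l t => forall S : subalg iota,
    (forall c, c \in t -> S c) ->
    coord_subring ev S (subalg_val (c l)) /\
    exists (Sg : coord_subring ev S (subalg_val (g l)))
      (s : X (subalg_algebra (localize Sg))), fop_map (subalg_val_hom _) s = x).
- by move=> l s s' sP ss' S s'S; apply: sP => d /ss' /s'S.
- move=> l; have [[i _ Ji] _] := gJ l.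
  have Rg : R (subalg_val (g l)) := subalg_valP (g l).
  have [la laE] := subalg_incl (localize_sub Rg).
  (* An element of [J i] becomes invertible in this localization. *)
  have OU : O i _ (fop_map la U).
    apply/JP; have [u uE] : exists u : subalg_type (localize Rg), subalg_val u = (subalg_val (g l))^-1.
      by apply: subalg_elt; exists 1%N; rewrite mulVf //; apply: subalg1.
    have [_ _ IM] := ideal_span_ideal (la @` J i).
    have -> : 1 = u * la (g l) by apply: val_inj; rewrite rmorphM rmorph1 /= laE uE mulVf.
    by apply/IM/ideal_span_sub; exists (g l).
  have [B0 ftB0 [u0 _ uP]] := (Oprop i).2.
  have [f fu _] := uP _ _ OU.
  have [t1 t1P] := descend_affine f (g0 l) ftB0.
  have [t2 t2P] := coord_subring_range (subalg_valP (c l)).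
  exists (t1 ++ t2) => S St; split.
    by apply: t2P => d dt; apply: St; rewrite mem_cat dt orbT.
  have [|Sg Sf] := t1P S; first by move=> d dt; apply: St; rewrite mem_cat dt.
  exists Sg.
  pose h : {rmorphism B0 -> Fr} := (val : {rmorphism subalg_type (localize Rg) -> Fr}) \o f.
  have [||f' f'E] := @subalg_hom _ _ alpha B0 (localize Sg) h.
  - move=> a; rewrite /h /= alg_homP; exact: subalg_mapE.
  - exact: Sf.
  exists (fop_map f' u0).
  rewrite (@fop_map_square _ X _ _ (subalg_algebra (localize Rg)) _ _ _ (subalg_val_hom _) f).
    by rewrite fu; apply: fop_mapM => b /=; rewrite laE.
  by move=> b /=; rewrite f'E.
exists t => S St; have {}tP l := tP l S St.
have Sg l : coord_subring ev S (subalg_val (g l)) by have [_ []] := tP l.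
have Sc l : coord_subring ev S (subalg_val (c l)) by have [] := tP l.
have /all_sig[s sE] : forall l, {s : X (subalg_algebra (localize (Sg l))) |
    fop_map (subalg_val_hom _) s = x}.
  move=> l; apply: cid; have [_ [Sg' [s sx]]] := tP l.
  by rewrite (Prop_irrelevance (Sg l) Sg'); exists s.
apply: (glue_generic sheafX sepX (s := s)) Sc g0 _ sE.
rewrite -[RHS](rmorph1 (val : {rmorphism subalg_type R -> Fr})) cg rmorph_sum.
by apply: eq_bigr => l _; rewrite rmorphM.
Qed.

End Descent.

(** The generic point of X, descended to a point [U'] of the model over S[x_1, ..., x_n],
    specializes at each [y] with coordinates in [S] to an [S]-point of the model from which [y] is
    recovered. The model has finitely many [S]-points since [S] is finitely generated. *)
Lemma hyperbolic_finite (C : fieldType) (n : nat) (I : set {mpoly C[n]}) (t : seq C) :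
  prime_ideal I -> arithmetically_hyperbolic I ->
  exists S : set C,
    [/\ S 1, (forall x y, S x -> S y -> S (x - y)),
        (forall x y, S x -> S y -> S (x * y)), (forall c, c \in t -> S c) &
        finite_set [set y : 'I_n -> C | (forall p, I p -> p.@[y] = 0) /\
                                        forall i, S (y i)]].
Proof.
move=> I_prime [A [iota [X [iota_inj fgA [sheafX coverX sepX] [phi [phi_bij phi_nat]] finX]]]].
have [Fr [ev evE]] := prime_field I_prime.
pose SI := coord_ring ev; pose SIA := coord_ringA ev iota.
pose BI : algebra C := subalg_algebra SI.
(* The tautological point of X over its own coordinate ring. *)
have /all_sig[u uE] : forall i, {b : subalg_type SI | subalg_val b = ev 'X_i}.
  by move=> i; apply: cid; apply: subalg_elt; exists 'X_i.
have u_eval p : subalg_val (poly_eval (B := BI) u p) = ev p.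
  have := @poly_eval_rmorph C BI Fr n u (val : {rmorphism subalg_type SI -> Fr}) p.
  move=> /= ->; rewrite [in RHS](mpolyE p) rmorph_sum; apply: eq_bigr => m _.
  rewrite subalg_mapE -mul_mpolyC rmorphM; congr (_ * _).
  by rewrite mpolyXE_id rmorph_prod; apply: eq_bigr => i _; rewrite rmorphXn uE.
have uI : zeros I BI u.
  by move=> p Ip; apply: val_inj; rewrite /= u_eval; apply/evE.
have [_ _ phi_surj] := phi_bij BI; have [U0 _ U0E] := phi_surj _ uI.
have [||toA toAE] := @subalg_hom _ _ (coord_const ev \o iota) (Defs.restrict iota BI) SIA
    (val : {rmorphism subalg_type SI -> Fr}).
- by move=> a /=; apply: subalg_mapE.
- by move=> b; apply: (subalg_valP b).
pose U : X (subalg_algebra SIA) := fop_map toA U0.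
have [t' t'P] := descend_point sheafX sepX coverX U.
have [S [St S_fg]] := subalg_adjoin iota (t ++ t') fgA.
have [|U' U'E] := t'P S; first by move=> c ct; apply: St; rewrite mem_cat ct orbT.
have [ka kaE] := subalg_incl (@coord_subring_sub _ _ _ ev _ iota S).
have kU : fop_map ka U' = U.
  apply: (separated_inj sepX (@subalg_val_hom_inj _ _ _ SIA)).
  by rewrite -U'E; apply: fop_mapM => b; apply: kaE.
exists S; split; [exact: subalg1 | exact: subalgB | exact: subalgM | |].
  by move=> c ct; apply: St; rewrite mem_cat ct.
pose Ck : algebra C := Algebra (idfun : {rmorphism C -> C}).
pose w : alg_hom (subalg_algebra S) (Defs.restrict iota Ck) :=
  @AlgHom A (subalg_algebra S) (Defs.restrict iota Ck)
    (val : {rmorphism subalg_type S -> C}) (fun a => subalg_mapE S a).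
have S_fin : finite_set [set: X (subalg_algebra S)].
  apply: (finX _ (val : {rmorphism subalg_type S -> C}) (subalg_map S)) => //.
  by move=> a; apply: subalg_mapE.
apply: (sub_finite_set _ (finite_image (fun xi => phi Ck (fop_map w xi) : 'I_n -> C) S_fin)).
move=> y [yI yS].
have ker p : ev p = 0 -> p.@[y] = 0 by move=> /evE /yI.
have [||e eE] := @coord_eval _ _ _ ev (subalg_type SI) (val : {rmorphism subalg_type SI -> Fr}) y _ _ ker.
- exact: val_inj.
- by move=> b; apply: (subalg_valP b).
have [||e1 e1E] := @coord_eval _ _ _ ev (subalg_type SIA) (val : {rmorphism subalg_type SIA -> Fr}) y _ _ ker.
- exact: val_inj.
- by move=> b; apply: (subalg_valP b).
have eA c : e (alg_map BI c) = alg_map Ck c.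
  by rewrite (eE _ c%:MP) ?mevalC //; apply: subalg_mapE.
pose eh : alg_hom BI Ck := @AlgHom C BI Ck e eA.
have e1A a : e1 (alg_map (subalg_algebra SIA) a) = alg_map (Defs.restrict iota Ck) a.
  by rewrite (e1E _ (iota a)%:MP) ?mevalC //; apply: subalg_mapE.
pose e1h : alg_hom (subalg_algebra SIA) (Defs.restrict iota Ck) :=
  @AlgHom A (subalg_algebra SIA) (Defs.restrict iota Ck) e1 e1A.
have [||e' e'E] := @subalg_hom _ _ iota (subalg_algebra (coord_subring ev S)) S (alg_comp e1h ka).
- exact: (alg_homP (alg_comp e1h ka)).
(* The functions with value in [S] at [y] form a subalgebra containing the generators of
   [coord_subring ev S], hence all of it. *)
- pose T0 (b : Fr) := exists2 b' : subalg_type SIA, subalg_val b' = b & S (e1 b').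
  have T01 : T0 1 by exists 1; rewrite ?rmorph1 //; apply: subalg1.
  have T0B a b : T0 a -> T0 b -> T0 (a - b).
    move=> [a' <- Sa] [b' <- Sb]; exists (a' - b') => //.
    by rewrite rmorphB; apply: subalgB.
  have T0M a b : T0 a -> T0 b -> T0 (a * b).
    move=> [a' <- Sa] [b' <- Sb]; exists (a' * b') => //.
    by rewrite rmorphM; apply: subalgM.
  have T0p p : S p.@[y] -> T0 (ev p).
    move=> Sp; have [|b bE] := @subalg_elt _ _ _ SIA (ev p); first by exists p.
    by exists b => //; rewrite (e1E _ p).
  have T0A a : T0 ((coord_const ev \o iota) a).
    by apply: T0p; rewrite mevalC; apply: subalg_base.
  pose T := @Subalg A Fr (coord_const ev \o iota) T0 T01 T0B T0M T0A.
  move=> b; have [||b' b'E Sb'] := subalg_valP b T.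
  + by move=> i; apply: T0p; rewrite mevalXU.
  + by move=> c Sc; apply: T0p; rewrite mevalC.
  rewrite /= (_ : ka b = b') //; apply: val_inj.
  by rewrite /= kaE b'E.
exists (fop_map e' U') => //.
(* Specializing [U'] over [S] and then passing to [C] is the same as evaluating the generic point
   [U0] at [y]. *)
have -> : fop_map w (fop_map e' U') = fop_map (restrict_hom iota eh) U0.
  rewrite (@fop_map_square _ X _ _ (subalg_algebra SIA) _ _ _ e1h ka); last first.
    by move=> b /=; rewrite e'E.
  rewrite kU; apply: fop_mapM => b /=.
  have [p _ pE] := subalg_valP b; rewrite (eE _ p) //.
  by apply: e1E; rewrite /= toAE.
rewrite phi_nat U0E; apply/funext => i /=.
by rewrite (eE _ 'X_i) ?mevalXU // /= uE.
Qed.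

(** * Specializations separating points of bounded height *)

Lemma finitely_generated_sub (A : comNzRingType) (r : nat) (a : 'I_r -> A)
    (S : comNzRingType) (h : {rmorphism A -> S}) (T : set S) :
  (forall b, exists p, b = poly_eval (B := Algebra (intmul 1 : {rmorphism int -> A})) a p) ->
  T 1 -> (forall x y, T x -> T y -> T (x - y)) ->
  (forall x y, T x -> T y -> T (x * y)) -> (forall l, T (h (a l))) ->
  forall b, T (h b).
Proof.
move=> gen T1 TB TM Ta b; have [p ->] := gen b.
rewrite (@poly_eval_rmorph int (Algebra (intmul 1 : {rmorphism int -> A})) S r a h).
have T0 : T 0 by rewrite -(subrr 1); apply: TB.
have TN x : T x -> T (- x) by move=> Tx; rewrite -sub0r; apply: TB.
have TD x y : T x -> T y -> T (x + y).
  by move=> Tx Ty; rewrite -[y]opprK; apply: TB => //; apply: TN.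
have Tint (z : int) : T z%:~R.
  have Tnat m : T m%:R by elim: m => [//|m IH]; rewrite -natr1; apply: TD.
  by case: z => m; rewrite ?NegzE ?mulrNz; [exact: Tnat | apply/TN/Tnat].
apply: (big_ind T) => // m _; apply: (TM); first by rewrite /= rmorph_int.
apply: (big_ind T) => // i _.
by elim: (m i : nat) => [//|j IH]; rewrite exprS; apply: TM.
Qed.

Section Specialize.
Variables (C : closedFieldType) (d : nat).
Local Notation E := {fraction tower C d}.
Variable N : splittingFieldType E.

(* g is a common denominator of the minimal polynomials of the y l. *)
Lemma integral_denominator (r : nat) (y : 'I_r -> N) :
  exists2 g : tower C d, g != 0 & forall tau, tower_eval d idfun tau g != 0 ->
    forall l, exists m : {poly E}, [/\ m \is monic, root (map_poly (in_alg N) m) (y l) &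
      forall k, exists c, flag d tau (m`_k, c)].
Proof.
have /all_sig[m mE] : forall l, {m : {poly E} | minPoly 1 (y l) = map_poly (in_alg N) m}.
  by move=> l; apply: cid; apply/polyOver1P; apply: minPolyOver.
have /choice[a /choice[p ap]] l := @clear_denominators (tower C d) (m l).
exists (\prod_l a l); first by apply/prodf_neq0 => l _; have [] := ap l.
move=> tau; rewrite rmorph_prod => /prodf_neq0 a_tau l; exists (m l).
have [al0 pE] := ap l; split.
- by rewrite -(map_monic (in_alg N)) -mE monic_minPoly.
- by rewrite -mE root_minPoly.
move=> k; exists (tower_eval d idfun tau (p l)`_k / tower_eval d idfun tau (a l)).
have -> : (m l)`_k = tofrac (p l)`_k / tofrac (a l).
  have ta0 : tofrac (a l) != 0 by rewrite tofrac_eq0.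
  apply: (mulIf ta0); rewrite divfK // mulrC -coefZ -pE coef_map; reflexivity.
by apply: flag_ratio; apply: a_tau.
Qed.

(** [s] is the restriction to [A] of a place of [N] above [flag d tau]. If [s f] is 0, the norm of
    [f] has one factor sent to 0 and all others finite, so it is sent to 0 too. *)
Lemma specialize (A : comNzRingType) (gamma : {rmorphism A -> N}) (r : nat)
    (a : 'I_r -> A) (tau : nat -> C) :
  (forall b, exists p, b = poly_eval (B := Algebra (intmul 1 : {rmorphism int -> A})) a p) ->
  (forall l, exists m : {poly E}, [/\ m \is monic,
     root (map_poly (in_alg N) m) (gamma (a l)) &
     forall k, exists c, flag d tau (m`_k, c)]) ->
  exists s : {rmorphism A -> C},
    (forall b c, gamma b = in_alg N (tofrac (tower_const C d c)) -> s b = c) /\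
    (forall f phi c, in_alg N phi = galNorm 1 {:N} (gamma f) ->
       flag d tau (phi, c) -> c != 0 -> s f != 0).
Proof.
move=> gen int_a.
have hG0 := map_graph_hom (in_alg N) (flag_hom d tau).
have [G [G0G hG vG]] := place_extension hG0.
have GF x c : flag d tau (x, c) -> G (in_alg N x, c) by move=> xc; apply: G0G; exists x.
(* The conjugates of a generator are roots of the same monic polynomial over [E], so finiteness
   follows from integral closedness for all of them at once. *)
have dom (sigma : gal_of {:N}) b : exists c, G (sigma (gamma b), c).
  pose h : {rmorphism A -> N} := (sigma : {rmorphism N -> N}) \o gamma.
  apply: (finitely_generated_sub (h := h) (T := fun x => exists c, G (x, c)) gen).
  - by exists 1; apply: partial_hom1.
  - by move=> x y [c xc] [c' yc]; exists (c - c'); apply: partial_homB.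
  - exact: partial_hom_domM.
  move=> l; have [m [m_monic mx mc]] := int_a l.
  apply: (valuative_integral hG vG (p := map_poly (in_alg N) m)).
  - by rewrite map_monic.
  - by move=> k; have [c kc] := mc k; exists c; rewrite coef_map; apply: GF.
  have -> : map_poly (in_alg N) m = map_poly (sigma : {rmorphism N -> N}) (map_poly (in_alg N) m).
    rewrite -map_poly_comp; apply: eq_map_poly => c /=.
    by rewrite linearZ /= rmorph1.
  by rewrite /h /= /root horner_map (rootP mx) rmorph0.
have domg b : exists c, G (gamma b, c) by have := dom 1%g b; rewrite gal_id.
have /all_sig[s0 s0G] : forall b, {c | G (gamma b, c)} by move=> b; apply: cid.
have [||s sE] := @rmorph_of _ _ s0.
- move=> x y; apply: (partial_hom_inj hG (s0G _)); rewrite rmorphB.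
  exact: partial_homB.
- split; first by apply: (partial_hom_inj hG (s0G _)); rewrite rmorph1; apply: partial_hom1.
  move=> x y; apply: (partial_hom_inj hG (s0G _)); rewrite rmorphM.
  exact: partial_homM.
exists s; split=> [b c bc|f phi c phiE phic c0].
  rewrite sE; apply: (partial_hom_inj hG (s0G b)); rewrite bc.
  by apply: GF; apply: flag_cst.
apply: contra_neq c0 => sf; have := s0G f; rewrite -sE sf => f0.
apply: (partial_hom_inj hG (GF _ _ phic)); rewrite phiE /galNorm.
rewrite (bigD1 (1%g : gal_of {:N})) ?group1 //= gal_id; apply: (partial_homM0 hG) => //.
apply: (big_ind (fun x => exists c, G (x, c))) => [||i _]; last exact: dom.
  by exists 1; apply: partial_hom1.
exact: partial_hom_domM.
Qed.

End Specialize.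

(** If [x] is not in [T'], a product over [z] in [T'] of linear forms separating [x] from [z]
    vanishes on [T'] but not at [x]. *)
Lemma finite_closure (L : fieldType) (n : nat) (J : set {mpoly L[n]})
    (T T' : set ('I_n -> L)) : finite_set T' ->
  (forall x p, (T `|` T') x -> J p -> p.@[x] = 0) ->
  Zariski_closure J [set point_ideal x | x in T'] =
    Zariski_closure J [set point_ideal x | x in T] -> T `<=` T'.
Proof.
move=> T'_fin TJ clE x Tx.
have spec z : (T `|` T') z -> spectrum J (point_ideal z).
  move=> Tz; split; last by move=> p Jp; apply: TJ.
  split; [split| |].
  - by rewrite /point_ideal /= meval0.
  - by move=> p q; rewrite /point_ideal /= mevalD => -> ->; rewrite addr0.
  - by move=> p q; rewrite /point_ideal /= mevalM => ->; rewrite mulr0.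
  - by rewrite /point_ideal /= meval1 => /eqP; rewrite oner_eq0.
  - move=> p q /eqP; rewrite mevalM mulf_eq0 => /orP[] /eqP h; [left|right]; exact: h.
pose V : set {mpoly L[n]} := [set p | forall z, T' z -> p.@[z] = 0].
have : Zariski_closure J [set point_ideal z | z in T] (point_ideal x).
  by move=> Z [_ TZ]; apply: TZ; exists x.
rewrite -clE => /(_ [set P | spectrum J P /\ V `<=` P]) [].
  split; first by exists V.
  move=> _ [z T'z <-]; split; first by apply: spec; right.
  by move=> p pV; apply: pV.
move=> _ Vx; apply: contrapT => T'x.
(* A coordinate in which [x] differs from [z]; [None] is the default outside [T']. *)
have /all_sig[j jP] : forall z, {j : option 'I_n | T' z ->
    if j is Some i then x i != z i else false}.
  move=> z; apply: cid; have [T'z|nT'z] := pselect (T' z); last by exists None.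
  have : exists i, x i != z i.
    apply: contrapT => noi; apply: T'x; suff -> : x = z by [].
    by apply/funext => i; apply/eqP/negPn/negP => xz; apply: noi; exists i.
  by move=> [i xz]; exists (Some i).
have /finite_seqP[s sE] := T'_fin.
pose p := \prod_(z <- s) (if j z is Some i then 'X_i - (z i)%:MP else 1) : {mpoly L[n]}.
have pev (y : 'I_n -> L) :
    p.@[y] = \prod_(z <- s) (if j z is Some i then y i - z i else 1).
  rewrite rmorph_prod; apply: eq_bigr => z _; case: (j z) => [i|].
    by rewrite rmorphB /= mevalXU mevalC.
  by rewrite rmorph1.
have : p.@[x] = 0.
  apply: (Vx p) => z T'z; rewrite pev; apply/eqP; rewrite prodf_seq_eq0.
  apply/hasP; exists z; first by move: T'z; rewrite sE.
  by move: (jP z T'z); case: (j z) => // i _; rewrite subrr eqxx.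
apply/eqP; rewrite pev prodf_seq_neq0; apply/allP => z zs /=.
have T'z : T' z by rewrite sE.
by move: (jP z T'z); case: (j z) => // i; rewrite subr_eq0.
Qed.

(** [A] is countable, being finitely generated, and of characteristic zero, since [O] embeds both in
    it and in [algC]. So its fraction field has an algebraic closure [W] into which [algC] embeds
    compatibly with [O]. *)
Lemma galois_model (A : idomainType) (O : comNzRingType) (iota : {rmorphism O -> algC})
    (phi : {rmorphism O -> A}) : injective iota -> injective phi -> Z_finitely_generated A ->
  exists (W : closedFieldType) (psi : {rmorphism algC -> W}) (d : nat) (t : nat -> W)
      (N : splittingFieldType {fraction tower algC d}) (theta : N)
      (gamma : {rmorphism A -> N}),
    [/\ [pchar W] =i pred0, injective (tower_eval d psi t),
        forall x, exists p, x = (map_poly (in_alg N) p).[theta],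
        galois 1 {:N} &
        injective gamma /\
        forall o, gamma (phi o) = in_alg N (tofrac (tower_const algC d (iota o)))].
Proof.
move=> iota_inj phi_inj fgA; have [T [c c_inj]] := finite_type_int_countable fgA.
have [c' c'_inj] := frac_countable c_inj.
have [W [e0]] := algebraic_closure c'_inj.
pose jA : {rmorphism A -> W} := e0 \o @tofrac A.
have jA_inj : injective jA.
  by apply: inj_comp; [apply: fmorph_inj | apply: tofrac_inj].
have charA n : (n%:R == 0 :> A) = (n == 0)%N.
  rewrite -(rmorph_nat phi) -(rmorph0 phi) (inj_eq phi_inj).
  by rewrite -(inj_eq iota_inj) rmorph0 rmorph_nat pnatr_eq0.
have W0 : [pchar W] =i pred0.
  by apply/pcharf0P => n; rewrite -(rmorph_nat jA) -(rmorph0 jA) (inj_eq jA_inj).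
have [psi psiE] := @algC_embedding O W iota (jA \o phi) W0 iota_inj.
have [r [a gen]] := fgA.
have [d [t [t_inj ts]]] := transcendence_basis psi [seq jA (a i) | i <- enum 'I_r].
have [e eE] := frac_lift t_inj.
have e_cst x : e (tofrac (tower_const algC d x)) = psi x by rewrite eE tower_eval_const.
have E0 : [pchar {fraction tower algC d}] =i pred0.
  by move=> p; rewrite -W0; apply/esym; apply: (fmorph_pchar e).
have [x /ts[p p0 px]|N [eta [theta [etaE s_eta N_gen N_gal]]]] :=
  @galois_extension _ _ e E0 [seq jA (a i) | i <- enum 'I_r].
  exists (map_poly (@tofrac _) p); first by rewrite map_poly_eq0_id0 // tofrac_eq0 lead_coef_eq0.
  by rewrite -map_poly_comp (eq_map_poly (g := tower_eval d psi t)).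
have /all_sig[g gE] : forall b, {x | eta x = jA b}.
  move=> b; apply: cid.
  apply: (finitely_generated_sub (h := jA) (T := fun y => exists x, eta x = y) gen).
  - by exists 1; rewrite rmorph1.
  - by move=> _ _ [x <-] [y <-]; exists (x - y); rewrite rmorphB.
  - by move=> _ _ [x <-] [y <-]; exists (x * y); rewrite rmorphM.
  - by move=> l; apply: s_eta; apply: map_f; rewrite mem_enum.
have eta_inj : injective eta := fmorph_inj eta.
have [||gamma gammaE] := @rmorph_of _ _ g.
- by move=> x y; apply: eta_inj; rewrite rmorphB !gE rmorphB.
- split; first by apply: eta_inj; rewrite gE !rmorph1.
  by move=> x y; apply: eta_inj; rewrite rmorphM !gE rmorphM.
exists W, psi, d, t, N, theta, gamma; split=> //; split.
  by move=> x y xy; apply: jA_inj; rewrite -!gE -!gammaE xy.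
by move=> o; apply: eta_inj; rewrite gammaE gE etaE e_cst psiE.
Qed.

Lemma cross_mul (F : fieldType) (a b p q : F) : b != 0 -> q != 0 ->
  a / b = p / q -> a * q = b * p.
Proof.
by move=> b0 q0 /eqP; rewrite eqr_div // => /eqP ->; apply: mulrC.
Qed.

Section Direction.
Variables (C : fieldType) (W : closedFieldType) (psi : {rmorphism C -> W}).
Variables (d : nat) (t : nat -> W).
Hypothesis t_inj : injective (tower_eval d psi t).
Variable N : splittingFieldType {fraction tower C d}.

(* All the variables but the i-th one become constants. *)
Definition direction (i : nat) : {rmorphism tower C d -> {poly W}} :=
  tower_eval d (@polyC W \o psi) (fun j => if j == i then 'X else (t j)%:P).

(** Substituting [t i] for ['X] gives back [tower_eval d psi t]. *)
Lemma direction_inj i : injective (direction i).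
Proof.
move=> p q pq; apply: t_inj; have ev r : (direction i r).[t i] = tower_eval d psi t r.
  apply: (tower_eval_comp (g := horner_eval (t i))) => [c|j _] /=.
    by rewrite /horner_eval hornerC.
  by rewrite /horner_eval; case: eqP => [->|_]; rewrite ?hornerX ?hornerC.
by rewrite -!ev pq.
Qed.

(** [F] contains both [N] and W(t_i), compatibly over the rational function field in [d]
    variables. *)
Lemma direction_field (theta : N) i :
  (forall x, exists p, x = (map_poly (in_alg N) p).[theta]) ->
  exists (F : fieldExtType {fraction {poly W}}) (delta : {rmorphism N -> F})
      (e : {rmorphism {fraction tower C d} -> {fraction {poly W}}}),
    (forall p, e (tofrac p) = tofrac (direction i p)) /\
    (forall x, delta (in_alg N x) = in_alg F (e x)).
Proof.
move=> gen; pose h : {rmorphism tower C d -> {fraction {poly W}}} :=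
  @tofrac {poly W} \o direction i.
have [|e eE] := @frac_lift _ _ h.
  by apply: inj_comp; [apply: tofrac_inj | apply: direction_inj].
have [F [delta deltaE]] := extend_embedding e gen.
by exists F, delta, e; split.
Qed.

(** The bound is the larger one of [degree_bound], applied to the norm as a product of conjugates
    with at most [m] poles each. *)
Lemma norm_degree_le i (F : fieldExtType {fraction {poly W}}) (delta : {rmorphism N -> F})
    (e : {rmorphism {fraction tower C d} -> {fraction {poly W}}}) (z : N) m P Q :
  (forall p, e (tofrac p) = tofrac (direction i p)) ->
  (forall x, delta (in_alg N x) = in_alg F (e x)) ->
  z != 0 -> P != 0 -> Q != 0 ->
  (forall sigma : gal_of {:N}, poles_le (delta (sigma z)) m) ->
  in_alg N (tofrac P / tofrac Q) = galNorm 1 {:N} z ->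
  degree_le i (#|{: gal_of {:N}}| * m + #|{: gal_of {:N}}| * m).+1 P Q.
Proof.
move=> eE deltaE z0 P0 Q0 poles normE.
(* The index type is all of [gal_of {:N}], so the factor 1 fills in outside the Galois group over
   which the norm is taken. *)
pose f (sigma : gal_of {:N}) := if sigma \in 'Gal({:N} / 1)%g then delta (sigma z) else 1.
have [|||p [q [q0 phiE sq sp]]] := @degree_bound W F (e (tofrac P / tofrac Q)) _ f m.
- move=> sigma; rewrite /f; case: ifP => _; last exact: oner_neq0.
  by rewrite !fmorph_eq0.
- move=> sigma; rewrite /f; case: ifP => _; first exact: poles.
  move=> s _ sP; rewrite big_seq big1 // => v /sP[_ _ _ vc _].
  have := vc 1 (oner_neq0 _); rewrite tofrac1 scale1r => ->.
  by rewrite oppr0 maxxx.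
- by rewrite -deltaE normE /galNorm rmorph_prod big_mkcond.
have dQ0 : direction i Q != 0.
  by rewrite -(rmorph0 (direction i)) (inj_eq (@direction_inj i)).
have dP0 : direction i P != 0.
  by rewrite -(rmorph0 (direction i)) (inj_eq (@direction_inj i)).
have E : direction i P * q = direction i Q * p.
  apply: tofrac_inj; rewrite !tofracM; apply: cross_mul.
  - by rewrite tofrac_eq0.
  - by rewrite tofrac_eq0.
  by rewrite -!eE -fmorph_div; exact: phiE.
have p0 : p != 0.
  apply: contra_neq (mulf_neq0 dP0 q0) => p0; rewrite E p0 mulr0; reflexivity.
apply: (degree_le_descent t_inj P0 p0 q0 sp _ E).
by rewrite (leq_trans sq) // ltnS leq_addr.
Qed.

End Direction.

(** The field is the same for every [sigma]; only the embedding of Frac A varies. Its height for the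
    index [sigma] controls the poles of the conjugate of [f] by [sigma]. *)
Lemma direction_function_fields (A : idomainType) (C : fieldType) (W : closedFieldType)
    (psi : {rmorphism C -> W}) (d : nat) (t : nat -> W)
    (N : splittingFieldType {fraction tower C d}) (theta : N)
    (gamma : {rmorphism A -> N}) (i : nat) :
  [pchar W] =i pred0 -> injective (tower_eval d psi t) ->
  (forall x, exists p, x = (map_poly (in_alg N) p).[theta]) -> injective gamma ->
  exists F : gal_of {:N} -> function_field {fraction A},
    forall f m P Q, f != 0 -> P != 0 -> Q != 0 ->
      (forall sigma, poles_le (ff_embed (F sigma) (tofrac f)) m) ->
      in_alg N (tofrac P / tofrac Q) = galNorm 1 {:N} (gamma f) ->
      degree_le i (#|{: gal_of {:N}}| * m + #|{: gal_of {:N}}| * m).+1 P Q.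
Proof.
move=> W0 t_inj gen gamma_inj.
have [F [delta [e [eE deltaE]]]] := direction_field t_inj i gen.
pose h (sigma : gal_of {:N}) : {rmorphism A -> F} :=
  delta \o (sigma : {rmorphism N -> N}) \o gamma.
have /all_sig[g gE] : forall sigma,
    {g : {rmorphism {fraction A} -> F} | forall b, g (tofrac b) = h sigma b}.
  move=> sigma; apply: frac_lift.
  by apply: inj_comp => //; apply: fmorph_inj.
exists (fun sigma => @FunctionField {fraction A} W W0 F (g sigma)) => f m P Q f0 P0 Q0 poles.
apply: (norm_degree_le t_inj eE deltaE) => //.
  by rewrite -(rmorph0 gamma) (inj_eq gamma_inj).
by move=> sigma; have := poles sigma; rewrite /= gE.
Qed.

Lemma separating_specializations (A : idomainType) (O : comNzRingType)
    (iota : {rmorphism O -> algC}) (phi : {rmorphism O -> A}) :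
  injective iota -> injective phi -> Z_finitely_generated A ->
  exists (t : nat) (F : 'I_t -> function_field {fraction A}),
    forall (R : realType) (n : nat) (T : set ('I_n -> A)),
      (forall i, exists b : R, forall x, T x ->
        (affine_height R (fun j => ff_embed (F i) (tofrac (x j))) <= b%:E)%E) ->
      exists (m : nat) (s : 'I_m -> {rmorphism A -> algC}),
        (forall k o, s k (phi o) = iota o) /\
        forall x y, T x -> T y -> (forall k j, s k (x j) = s k (y j)) -> x = y.
Proof.
move=> iota_inj phi_inj fgA.
have [W [psi [d [u [N [theta [gamma [W0 u_inj N_gen N_gal [gamma_inj gammaE]]]]]]]]] :=
  galois_model iota_inj phi_inj fgA.
have [r [a gen]] := fgA.
have /choice[FF FFP] i := @direction_function_fields A _ W psi d u N theta gamma i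
  W0 u_inj N_gen gamma_inj.
pose I : finType := ('I_d * gal_of {:N})%type.
pose ix (k : 'I_#|I|) : 'I_d * gal_of {:N} := enum_val k.
exists #|I|, (fun k => FF (ix k).1 (ix k).2) => R n T /choice[b bT].
(* One integer for all the function fields; the factor 2 comes from passing to differences of
   points. *)
have [m bm] : exists m : nat, forall i, b i *+ 2 <= m%:R.
  exists (\max_i (Num.bound `|b i *+ 2|)) => i.
  apply: (@le_trans _ _ (Num.bound `|b i *+ 2|)%:R).
    by rewrite (le_trans (ler_norm _)) // ltW // archi_boundP.
  by rewrite ler_nat; apply: (leq_bigmax i).
have poles x y i sigma j : T x -> T y -> (i < d)%N ->
    poles_le (ff_embed (FF i sigma) (tofrac (x j - y j))) m.
  move=> Tx Ty id; pose k : 'I_#|I| := enum_rank ((Ordinal id, sigma) : I).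
  have := bT k; have := bm k; rewrite /ix enum_rankK /= => bk xk.
  rewrite rmorphB /= rmorphB.
  exact: (poles_leB j (xk x Tx) (xk y Ty) bk).
have [g g0 g_int] := integral_denominator (gamma \o a).
have C0 : [pchar algC] =i pred0 := pchar_num _.
have [taus tausP] := grid C0 (#|{: gal_of {:N}}| * m + #|{: gal_of {:N}}| * m).+1 g0.
have special tau : tower_eval d idfun tau g != 0 -> exists h : {rmorphism A -> algC},
    (forall o, h (phi o) = iota o) /\
    (forall f phi c, in_alg N phi = galNorm 1 {:N} (gamma f) ->
       flag d tau (phi, c) -> c != 0 -> h f != 0).
  move=> tau0; have [h [h_cst hP]] := specialize gen (g_int tau tau0); exists h.
  by split=> // o; apply: h_cst; apply: gammaE.
have sep x y j : T x -> T y -> x j != y j -> exists2 tau, tau \in taus &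
    tower_eval d idfun tau g != 0 /\ forall h : {rmorphism A -> algC},
    (forall f phi c, in_alg N phi = galNorm 1 {:N} (gamma f) ->
       flag d tau (phi, c) -> c != 0 -> h f != 0) -> h (x j) != h (y j).
  move=> Tx Ty xy; pose f := x j - y j; have f0 : f != 0 by rewrite subr_eq0.
  (* The norm is fixed by the Galois group, hence lies in the base field. *)
  have [nu nuE] : exists nu, galNorm 1 {:N} (gamma f) = in_alg N nu.
    by apply/vlineP; apply: (mem_galNorm N_gal); apply: memvf.
  have nu0 : nu != 0.
    have : in_alg N nu != 0.
      by rewrite -nuE galNorm_eq0 -(rmorph0 gamma) (inj_eq gamma_inj).
    by apply: contra_neq => ->; rewrite rmorph0.
  have [P [Q [Q0 nuPQ]]] := frac_repr nu.
  have P0 : P != 0 by apply: contra_neq nu0 => P0; rewrite nuPQ P0 tofrac0 mul0r.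
  have [|tau [tau_in tau0 [c c0 nuc]]] := tausP P Q P0 Q0.
    move=> i id; apply: (FFP i f) => // [sigma|]; first exact: poles.
    by rewrite -nuPQ -nuE.
  exists tau => //; split=> // h /(_ f nu c (esym nuE)).
  by rewrite {1}nuPQ => /(_ nuc c0); rewrite rmorphB subr_eq0.
(* The default h0 only serves the points of the grid where g vanishes. *)
have [[h0 h0P]|noh] := pselect (exists h : {rmorphism A -> algC}, forall o, h (phi o) = iota o).
  have /choice[s sP] tau : exists h : {rmorphism A -> algC},
      (forall o, h (phi o) = iota o) /\ (tower_eval d idfun tau g != 0 ->
      forall f phi c, in_alg N phi = galNorm 1 {:N} (gamma f) ->
       flag d tau (phi, c) -> c != 0 -> h f != 0).
    have [tau0|/special[h [h_cst hP]]] := eqVneq (tower_eval d idfun tau g) 0.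
      by exists h0; split=> // /eqP.
    by exists h.
  exists (size taus), (fun k => s (tnth (in_tuple taus) k)).
  split=> [k|x y Tx Ty sxy]; first by have [] := sP (tnth (in_tuple taus) k).
  apply/funext => j; apply/eqP; apply: contraT => /(sep x y j Tx Ty)[tau tau_in [tau0 hxy]].
  have /tnthP[k tauE] : tau \in in_tuple taus by [].
  by have := hxy _ ((sP tau).2 tau0); rewrite {1 2}tauE sxy eqxx.
(* If there is no morphism to [algC] over [O] at all, [sep] shows that [T] has at most one point,
   and the empty family separates. *)
have s0 : 'I_0 -> {rmorphism A -> algC} by case.
exists 0%N, s0; split=> [[]//|x y Tx Ty _].
apply/funext => j; apply/eqP; apply: contraT.
move=> /(sep x y j Tx Ty)[tau _ [/special[h [h_cst _]] _]].
by case: noh; exists h.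
Qed.

(** * Finiteness *)

Lemma base_change_zero (O A : comNzRingType) (F : comNzRingType) (phi : {rmorphism O -> A})
    (g : {rmorphism O -> F}) (s : {rmorphism A -> F}) (n : nat) (J : set {mpoly O[n]})
    (x : 'I_n -> A) (p : {mpoly F[n]}) :
  (forall o, s (phi o) = g o) -> zeros J (Algebra phi) x -> base_change g J p ->
  p.@[fun i => s (x i)] = 0.
Proof.
move=> sphi Jx [m [c [h [hJ ->]]]]; rewrite rmorph_sum big1 // => i _.
have [q Jq <-] := hJ i; rewrite rmorphM /=.
suff -> : (map_mpoly g q).@[fun i => s (x i)] = 0 by rewrite mulr0.
rewrite -(rmorph0 s) -(Jx q Jq).
rewrite (@poly_eval_rmorph O (Algebra phi) F n x s) /map_mpoly /mmap rmorph_sum.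
apply: eq_bigr => j _. rewrite rmorphM /= mevalC /= sphi; congr (_ * _).
by rewrite /mmap1 rmorph_prod; apply: eq_bigr => l _; rewrite rmorphXn /= mevalXU.
Qed.

Theorem theorem1p5 (R : realType) (n : nat)
    (* X, by its prime ideal *)
    (X : set {mpoly algC[n]}) (X_variety : prime_ideal X)
    (K : fieldExtType rat) (iota : {rmorphism K -> algC})
    (S : set (K -> R)) (S_finite : finite_set S)
    (S_places : forall v, S v -> nontrivial_absolute_value v)
    (* the model of X, by its ideal *)
    (J : set {mpoly (S_integers S)[n]}) (J_ideal : ideal J)
    (J_model : base_change
       (iota \o (val : S_integers S -> K) : {rmorphism S_integers S -> algC}) J = X)
    (A : idomainType) (phi : {rmorphism S_integers S -> A})
    (phi_inj : injective phi) (A_fg : Z_finitely_generated A)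
    (R0 : set ('I_n -> A)) (R0_points : R0 `<=` zeros J (Algebra phi)) :
  let L : fieldType := {fraction A} in
  let J_L := base_change (@tofrac A \o phi : {rmorphism S_integers S -> L}) J in
  let closure_L (T : set ('I_n -> A)) :=
    Zariski_closure J_L
      [set point_ideal ((fun i => tofrac (x i)) : 'I_n -> L) | x in T] in
  arithmetically_hyperbolic X ->
  (forall (t : nat) (F : 'I_t -> function_field L),
     exists R' : set ('I_n -> A),
       [/\ R' `<=` R0,
           closure_L R' = closure_L R0 &
           forall i : 'I_t, exists b : R, forall x, R' x ->
             (affine_height R (fun j => ff_embed (F i) (tofrac (x j)))
                <= b%:E)%E]) ->
  finite_set R0.
Proof.
move=> L J_L closure_L hyp heights.
pose iota' : {rmorphism S_integers S -> algC} := iota \o (val : S_integers S -> K).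
have iota'_inj : injective iota'.
  by apply: inj_comp; [apply: fmorph_inj | apply: val_inj].
have [t [F sep]] := separating_specializations iota'_inj phi_inj A_fg.
have [R' [R'R0 clE bd]] := heights t F.
have [m [s [sO sR']]] := sep R n R' bd.
have [r [a gen]] := A_fg.
(* A subring containing the values of the [s k] at the generators of [A] contains the images of all
   of [A]. *)
pose ts := [seq s k (a l) | k <- enum 'I_m, l <- enum 'I_r].
have [S' [S'1 S'B S'M S'ts Y_fin]] := hyperbolic_finite ts X_variety hyp.
have R'_fin : finite_set R'.
  pose f (x : 'I_n -> A) k i := s k (x i).
  have f_inj : {in R' &, injective f}.
    move=> x y /set_mem xR' /set_mem yR' xy; apply: sR' => // k j.
    exact: (congr1 (fun g => g k j) xy).
  rewrite -(eq_finite_set (inj_card_eq f_inj)).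
  have /finite_seqP[ys ysE] := Y_fin.
  (* A point of [R'] is determined by its [m] specializations, each of which is in the finite list
     [ys]; [g] enumerates all such families. *)
  pose g (w : {ffun 'I_m -> 'I_(size ys)}) k := nth (fun=> 0) ys (w k).
  apply: (sub_finite_set _ (finite_image g (@finite_finset _ setT))).
  move=> _ [x xR' <-]; have fx k : f x k \in ys.
    have : [set` ys] (f x k); last by [].
    rewrite -ysE; split=> [p Xp|i].
      rewrite -J_model in Xp.
      exact: (base_change_zero (sO k) (R0_points _ (R'R0 _ xR')) Xp).
    apply: (finitely_generated_sub gen) => // l.
    by apply: S'ts; apply: allpairs_f; rewrite mem_enum.
  have idx k : (index (f x k) ys < size ys)%N by rewrite index_mem.
  exists [ffun k => Ordinal (idx k)] => //; apply/funext => k.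
  by rewrite /g ffunE /= nth_index.
apply: (sub_finite_set _ R'_fin) => x xR0.
pose u (x : 'I_n -> A) i : L := tofrac (x i).
have clE' (T : set ('I_n -> A)) : closure_L T =
    Zariski_closure J_L [set point_ideal z | z in u @` T].
  by rewrite /closure_L -image_comp.
have uJ z p : (u @` R0 `|` u @` R') z -> J_L p -> p.@[z] = 0.
  case=> -[y yR <-]; apply: base_change_zero => //; first exact: R0_points.
  exact: (R0_points _ (R'R0 _ yR)).
rewrite !clE' in clE.
have [x' x'R' x'x] := finite_closure (finite_image u R'_fin) uJ clE (imageP u xR0).
suff <- : x' = x by [].
by apply/funext => i; apply: tofrac_inj; apply: (congr1 (fun g => g i) x'x).
Qed.
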